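(* (i) Let $n\le 12$. For every Belavin-Drinfeld triple $(\Gamma_1,\Gamma_2,\tau)$ of type $A_{n-1}$ and every $r^0\in\mathfrak h\wedge\mathfrak h$ solving the equation ( * ) of the context for this triple, the matrix $R_{\mathrm{GGS}}$ satisfies the quantum Yang-Baxter equation $R_{12}R_{13}R_{23}=R_{23}R_{13}R_{12}$ and the Hecke relation $(PR-q)(PR+q^{-1})=0$. (ii) For every $n$, every Belavin-Drinfeld triple of type $A_{n-1}$ and every $r^0\in\mathfrak h\wedge\mathfrak h$ solving ( * ), the matrix $R=R_{\mathrm{GGS}}$ satisfies both relations modulo $\hbar^3$, i.e. $R_{12}R_{13}R_{23}\equiv R_{23}R_{13}R_{12}$ and $(PR-q)(PR+q^{-1})\equiv 0 \pmod{\hbar^3}$.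
   Context: Roots and triples. Fix $n\ge2$. Let $(e_i)_{1\le i\le n}$ be the standard basis of $\mathbb C^n$, $(\,,\,)$ the bilinear inner product for which it is orthonormal, $\alpha_i=e_i-e_{i+1}$, $\Gamma=\{\alpha_1,\dots,\alpha_{n-1}\}$. A Belavin-Drinfeld triple of type $A_{n-1}$ is $(\Gamma_1,\Gamma_2,\tau)$ with $\Gamma_1,\Gamma_2\subset\Gamma$ and $\tau:\Gamma_1\to\Gamma_2$ a bijection such that $(\tau\alpha,\tau\beta)=(\alpha,\beta)$ for all $\alpha,\beta\in\Gamma_1$, and for every $\alpha\in\Gamma_1$ there is $k\in\mathbb N$ with $\tau^k\alpha\notin\Gamma_1$. Let $e_{ij}$ be the matrix units of $Mat_n(\mathbb C)$. For $\alpha=e_i-e_j$ ($i\ne j$) put $e_\alpha=e_{ij}$, $|\alpha|=|j-i|$, and $\alpha>0$ iff $i<j$. For $Y\subset\Gamma$ let $\tilde Y$ be the set of $v\in\mathrm{Span}(Y)$ of the form $v=e_i-e_j$ with $i<j$. Extend $\tau$ additively to $\tilde\Gamma_1\to\tilde\Gamma_2$. Write $\alpha\prec\beta$ if $\beta=\tau^p\alpha$ for some $p\ge1$. If $\alpha\prec\beta=\tau^p\alpha$ with $\alpha=e_j-e_i$, $\beta=e_k-e_{k+i-j}$, $i-j\ge2$, write $\alpha\prec^{\leftarrow}\beta$ (orientation reversed) if $\tau^p\alpha_j=\alpha_{k+i-j-1}$, and $\alpha\prec^{\rightarrow}\beta$ (orientation preserved) if $\tau^p\alpha_j=\alpha_k$.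 Put $\mathrm{sign}(\alpha,\beta)=(-1)^{1-|\alpha|}$ if $\alpha\prec^{\leftarrow}\beta$, and $\mathrm{sign}(\alpha,\beta)=1$ if $\alpha\prec^{\rightarrow}\beta$ or $|\alpha|=1$. The matrix $R_{\mathrm{GGS}}$. Let $\mathfrak h$ be the diagonal matrices, with $e_i\in\mathbb C^n$ acting as a linear function on $\mathfrak h$ by $e_i(e_{jj})=\delta_{ij}$. Let $P=\sum_{i,j}e_{ij}\otimes e_{ji}$, $P^0=\sum_i e_{ii}\otimes e_{ii}$, $x\wedge y=x\otimes y-y\otimes x$. Equation ( * ) for $r^0\in\mathfrak h\wedge\mathfrak h$ is $$[(\alpha-\tau\alpha)\otimes1]\,r^0=\tfrac12[(\alpha+\tau\alpha)\otimes1]\,P^0\quad\text{for all }\alpha\in\Gamma_1.\qquad( * )$$ Set $q=e^\hbar$ ($\hbar$ formal; $q^x=\exp(\hbar x)$), and $$a=\sum_{\alpha\prec\beta}\mathrm{sign}(\alpha,\beta)\,e_{-\alpha}\wedge e_\beta,\quad r_s=\tfrac12P^0+\sum_{\alpha>0}e_{-\alpha}\otimes e_\alpha,\quad \epsilon=ar_s+r_sa+a^2,$$ $$R_s=q\sum_i e_{ii}\otimes e_{ii}+\sum_{i\ne j}e_{ii}\otimes e_{jj}+(q-q^{-1})\sum_{i>j}e_{ij}\otimes e_{ji}.$$ Writing $z=\sum z_{ik}^{jl}e_{ij}\otimes e_{kl}$ for $z\in Mat_n\otimes Mat_n$, set $\tilde a=\sum a_{ik}^{jl}q^{a_{ik}^{jl}\epsilon_{ik}^{jl}}e_{ij}\otimes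 e_{kl}$, $\bar R_{\mathrm{GGS}}=R_s+(q-q^{-1})\tilde a$ and $R_{\mathrm{GGS}}=q^{r^0}\bar R_{\mathrm{GGS}}q^{r^0}$. (Equivalently, with $r=r^0+a+r_s$, $R_{\mathrm{GGS}}$ is the unique matrix with coefficients of the form $xq^y(q-q^{-1})^z$, $x,y\in\mathbb C$, $z\in\{0,1\}$, congruent to $1+2\hbar r+2\hbar^2r^2$ modulo $\hbar^3$.) *)

(* Defs.v *)
From HB Require Import structures.
From mathcomp Require Import all_boot all_order all_algebra.
From mathcomp Require Import boolp reals ring.
From mathcomp.real_closed Require Export complex mxtens.
Set Implicit Arguments.
Unset Strict Implicit.
Unset Printing Implicit Defensive.
Import GRing.Theory Num.Theory.
Local Open Scope ring_scope.

(* A wrapper type is needed: nat -> K carries the pointwise ring structure. *)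
Record fps (K : Type) := Fps { fcoef : nat -> K }.

HB.instance Definition _ (K : Type) := [isNew for @fcoef K].
HB.instance Definition _ (K : choiceType) := [Choice of fps K by <:].

Lemma fpsP (K : Type) (f g : fps K) : fcoef f =1 fcoef g -> f = g.
Proof. by case: f g => [f] [g] /= /funext ->. Qed.

Section FpsRing.
Context (K : comNzRingType).
Implicit Types f g h : fps K.

Definition fps0 : fps K := Fps (fun=> 0).
Definition fps_opp f := Fps (fun m => - fcoef f m).
Definition fps_add f g := Fps (fun m => fcoef f m + fcoef g m).
Definition fpsC (c : K) : fps K := Fps (fun m => if m is 0%N then c else 0).
Definition fps_mul f g :=
  Fps (fun m => \sum_(i < m.+1) fcoef f i * fcoef g (m - i)%N).

Fact fps_addA : associative fps_add.
Proof. by move=> f g h; apply: fpsP => m /=; rewrite addrA. Qed.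
Fact fps_addC : commutative fps_add.
Proof. by move=> f g; apply: fpsP => m /=; rewrite addrC. Qed.
Fact fps_add0 : left_id fps0 fps_add.
Proof. by move=> f; apply: fpsP => m /=; rewrite add0r. Qed.
Fact fps_addN : left_inverse fps0 fps_opp fps_add.
Proof. by move=> f; apply: fpsP => m /=; rewrite addNr. Qed.

HB.instance Definition _ :=
  GRing.isZmodule.Build (fps K) fps_addA fps_addC fps_add0 fps_addN.

Definition fps_trunc (N : nat) f : {poly K} := \poly_(i < N.+1) fcoef f i.

Fact coef_fps_trunc N f m : (m <= N)%N -> (fps_trunc N f)`_m = fcoef f m.
Proof. by move=> mN; rewrite coef_poly ltnS mN. Qed.

Fact coef_trunc_mul N f g m : (m <= N)%N ->
  (fps_trunc N f * fps_trunc N g)`_m = fcoef (fps_mul f g) m.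
Proof.
move=> mN; rewrite coefM; apply: eq_bigr => i _.
rewrite !coef_fps_trunc ?(leq_trans (leq_subr _ _)) //.
by rewrite (leq_trans _ mN) // -ltnS.
Qed.

Fact fps_mulA : associative fps_mul.
Proof.
move=> f g h; apply: fpsP => m.
transitivity ((fps_trunc m f * (fps_trunc m g * fps_trunc m h))`_m).
  rewrite coefM; apply: eq_bigr => i _; have im : (i <= m)%N by rewrite -ltnS.
  by rewrite coef_trunc_mul ?leq_subr // coef_fps_trunc.
rewrite mulrA coefM; apply: eq_bigr => i _; have im : (i <= m)%N by rewrite -ltnS.
by rewrite coef_trunc_mul // coef_fps_trunc ?leq_subr.
Qed.

Fact fps_mulC : commutative fps_mul.
Proof. by move=> f g; apply: fpsP => m; rewrite -!(coef_trunc_mul _ _ (leqnn m)) mulrC. Qed.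

Fact fps_mul1 : left_id (fpsC 1) fps_mul.
Proof.
move=> f; apply: fpsP => m /=; rewrite big_ord_recl /= mul1r subn0.
by rewrite big1 ?addr0 // => i _; rewrite mul0r.
Qed.

Fact fps_mulDl : left_distributive fps_mul fps_add.
Proof.
move=> f g h; apply: fpsP => m /=; rewrite -big_split /=.
by apply: eq_bigr => i _; rewrite mulrDl.
Qed.

Fact fps_1neq0 : fpsC 1 != 0.
Proof. by apply/eqP => /(congr1 (fun f => fcoef f 0)) /eqP; rewrite /= oner_eq0. Qed.

HB.instance Definition _ := GRing.Zmodule_isComNzRing.Build (fps K)
  fps_mulA fps_mulC fps_mul1 fps_mulDl fps_1neq0.

End FpsRing.

(* q ^ X = exp (hbar X) for a square matrix X over K, resp. for a scalar x. *)
Definition qpow_mx (K : fieldType) (N : nat) (X : 'M[K]_N) : 'M[fps K]_N :=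
  \matrix_(i, j) Fps (fun m => (m`!%:R^-1 *: X ^+ m) i j).
Definition qpow (K : fieldType) (x : K) : fps K :=
  Fps (fun m => m`!%:R^-1 * x ^+ m).
Arguments qpow {K} x.

Definition q (K : fieldType) : fps K := qpow 1.
Definition qinv (K : fieldType) : fps K := qpow (-1).
Arguments q {K}.
Arguments qinv {K}.

Lemma mulq_qinv (K : numFieldType) : q * qinv = 1 :> fps K.
Proof.
apply: fpsP => m; transitivity (m`!%:R^-1 * (-1 + 1) ^+ m : K); last first.
  by rewrite addNr expr0n; case: m => [|m] /=; rewrite ?mulr0 // mulr1 invr1.
rewrite exprDn mulr_sumr; apply: eq_bigr => i _ /=.
have im : (i <= m)%N by rewrite -ltnS.
have nz N : N`!%:R != 0 :> K by rewrite pnatr_eq0 -lt0n fact_gt0.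
rewrite !expr1n !mulr1 -mulr_natr mulrCA mulrA mulrC.
apply: (mulfI (nz m)); rewrite -{1}(bin_fact im) !natrM.
rewrite mulrA mulVKf //; by field; rewrite !nz.
Qed.

(* The series below is hbar ^ k. *)
Definition eqmod_hbar (K : comNzRingType) (k M N : nat) (A B : 'M[fps K]_(M, N)) :=
  exists C : 'M[fps K]_(M, N),
    A - B = (Fps (fun m => (m == k)%:R : K)) *: C.

Section Roots.
Context (K : fieldType) (n : nat).
Implicit Types (v w : 'rV[K]_n) (Y : {set 'I_n.-1}).

(* Indices start at 0; the index i is a nat, meant to be < n. *)
Definition evec (i : nat) : 'rV[K]_n := \row_(j < n) (j == i :> nat)%:R.

(* The simple roots are alpha k for k : 'I_n.-1, and a subset of Gamma is given
   by the set of indices of its elements. *)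
Definition alpha (k : nat) : 'rV[K]_n := evec k - evec k.+1.

Definition inner v w : K := \sum_(i < n) v 0 i * w 0 i.

(* A map Gamma1 -> Gamma2 is represented by a total function whose values
   outside Gamma1 are irrelevant. In particular the least k such that
   iter k tau i \notin Gamma1 only depends on tau on Gamma1. *)
Definition BD_triple (Gamma1 Gamma2 : {set 'I_n.-1}) (tau : 'I_n.-1 -> 'I_n.-1) :=
  [/\ {in Gamma1 &, injective tau},
      tau @: Gamma1 = Gamma2,
      {in Gamma1 &, forall i j,
         inner (alpha (tau i)) (alpha (tau j)) = inner (alpha i) (alpha j)}
    & forall i, i \in Gamma1 -> exists k : nat, iter k tau i \notin Gamma1].

Definition tilde Y : pred 'rV[K]_n := fun v =>
  (v <= \sum_(k in Y) <<alpha k>>)%MS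
  && [exists i : 'I_n, exists j : 'I_n, (i < j)%N && (v == evec i - evec j)].

(* The coefficient of alpha k in v = \sum_k c_k *: alpha k is the partial sum
   \sum_(l <= k) v_l. *)
Definition root_coef v (k : nat) : K := \sum_(l < n | (l <= k)%N) v 0 l.

Definition tau_ext (tau : 'I_n.-1 -> 'I_n.-1) v : 'rV[K]_n :=
  \sum_(k < n.-1) root_coef v k *: alpha (tau k).

Lemma tau_ext_alpha (tau : 'I_n.-1 -> 'I_n.-1) (k : 'I_n.-1) :
  tau_ext tau (alpha k) = alpha (tau k).
Proof.
have E (i m : nat) : (i < n)%N -> root_coef (evec i) m = (i <= m)%N%:R.
  move=> ltin; rewrite /root_coef big_mkcond (bigD1 (Ordinal ltin)) //=.
  rewrite big1 ?addr0 => [|l /negPf ne_l]; first by rewrite mxE /= eqxx; case: leq.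
  by rewrite mxE -[l == i :> nat]/(l == Ordinal ltin) ne_l; case: leq.
have kn : (k.+1 < n)%N by rewrite -ltn_predRL.
have coefE (j : 'I_n.-1) : root_coef (alpha k) j = (j == k)%:R.
  have -> : root_coef (alpha k) j = root_coef (evec k) j - root_coef (evec k.+1) j.
    by rewrite /root_coef -sumrB; apply: eq_bigr => l _; rewrite !mxE.
  rewrite !E // ?(ltnW kn) //.
  by rewrite -val_eqE /=; case: ltngtP; rewrite ?subrr ?subr0.
rewrite /tau_ext (bigD1 k) //= coefE eqxx scale1r big1 ?addr0 // => j /negPf ne_jk.
by rewrite coefE ne_jk scale0r.
Qed.

Context (Gamma1 : {set 'I_n.-1}) (tau : 'I_n.-1 -> 'I_n.-1).

(* w = tau^p v, where tau^p v is defined iff tau^m v lies in tilde Gamma1 for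
   all m < p. *)
Definition tau_pow (p : nat) v w : bool :=
  [forall m : 'I_p, tilde Gamma1 (iter m (tau_ext tau) v)]
  && (w == iter p (tau_ext tau) v).

Definition prec v w : bool :=
  `[< exists2 p : nat, (0 < p)%N & tau_pow p v w >].

(* Below, the roots are e_i - e_j (i < j) and e_k - e_l, so that
   |e_i - e_j| = j - i, the first simple root of e_i - e_j is alpha i, and the
   last simple root of e_k - e_l is alpha l.-1. *)
Definition prec_rev (i j k l : nat) : bool :=
  `[< exists p : nat,
        [/\ (0 < p)%N, tau_pow p (evec i - evec j) (evec k - evec l),
            (2 <= j - i)%N & tau_pow p (alpha i) (alpha l.-1)] >].

(* For a Belavin-Drinfeld triple, when e_i - e_j precedes e_k - e_l, the else
   branch is taken exactly when the orientation is preserved or j - i = 1. *)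
Definition sgn (i j k l : nat) : K :=
  if prec_rev i j k l then (-1) ^ (1 - (j - i)%N%:Z) else 1.

End Roots.
Arguments evec {K n} i.
Arguments alpha {K n} k.
Arguments BD_triple K {n} Gamma1 Gamma2 tau.

(* Mat_n (x) Mat_n is 'M_(n * n), and x (x) y is the Kronecker product x *t y.
   The coefficient z_{ik}^{jl} of e_ij (x) e_kl in z is the matrix entry below. *)
Definition tcoef (A : Type) (n : nat) (z : 'M[A]_(n * n)) (i k j l : 'I_n) : A :=
  z (mxtens_index (i, k)) (mxtens_index (j, l)).

Section Tensor.
Context (A : comNzRingType) (n : nat).
Implicit Types (x y : 'M[A]_n) (z : 'M[A]_(n * n)).

Definition munit (i j : 'I_n) : 'M[A]_n := delta_mx i j.

Definition wedge x y : 'M[A]_(n * n) := x *t y - y *t x.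

Definition flipP : 'M[A]_(n * n) := \sum_i \sum_j munit i j *t munit j i.

Definition P0 : 'M[A]_(n * n) := \sum_i munit i i *t munit i i.

Definition leg12 z : 'M[A]_(n * n * n) :=
  \sum_i \sum_j \sum_k \sum_l
    tcoef z i k j l *: (munit i j *t munit k l *t (1%:M : 'M_n)).
Definition leg13 z : 'M[A]_(n * n * n) :=
  \sum_i \sum_j \sum_k \sum_l
    tcoef z i k j l *: (munit i j *t (1%:M : 'M_n) *t munit k l).
Definition leg23 z : 'M[A]_(n * n * n) :=
  \sum_i \sum_j \sum_k \sum_l
    tcoef z i k j l *: ((1%:M : 'M_n) *t munit i j *t munit k l).

Lemma tens_expansion z :
  z = \sum_i \sum_j \sum_k \sum_l tcoef z i k j l *: (munit i j *t munit k l).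
Proof.
apply/matrixP => s t.
case: (mxtens_indexP s) => i0 k0; case: (mxtens_indexP t) => j0 l0.
rewrite summxE (bigD1 i0) //= [X in _ + X]big1 ?addr0 => [|i ne]; last first.
  rewrite summxE big1 // => j _; rewrite summxE big1 // => k _.
  rewrite summxE big1 // => l _.
  by rewrite mxE tensmxE !mxE (eq_sym i0) (negPf ne) mul0r mulr0.
rewrite summxE (bigD1 j0) //= [X in _ + X]big1 ?addr0 => [|j ne]; last first.
  rewrite summxE big1 // => k _; rewrite summxE big1 // => l _.
  by rewrite mxE tensmxE !mxE (eq_sym j0) (negPf ne) andbF mul0r mulr0.
rewrite summxE (bigD1 k0) //= [X in _ + X]big1 ?addr0 => [|k ne]; last first.
  rewrite summxE big1 // => l _.
  by rewrite mxE tensmxE !mxE (eq_sym k0) (negPf ne) mulr0 mulr0.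
rewrite summxE (bigD1 l0) //= [X in _ + X]big1 ?addr0 => [|l ne]; last first.
  by rewrite mxE tensmxE !mxE (eq_sym l0) (negPf ne) andbF mulr0 mulr0.
by rewrite mxE tensmxE !mxE !eqxx !mulr1.
Qed.

End Tensor.
Arguments munit {A n} i j.
Arguments flipP {A n}.
Arguments P0 {A n}.

Section GGS.
Context (K : fieldType) (n : nat).
Implicit Types (z : 'M[K]_(n * n)).

(* The span of the x /\ y for diagonal x and y. *)
Definition in_hwedgeh (r0 : 'M[K]_(n * n)) :=
  exists s : seq ('rV[K]_n * 'rV[K]_n),
    r0 = \sum_(xy <- s) wedge (diag_mx xy.1) (diag_mx xy.2).

(* v in C^n as a linear function on diagonal matrices. *)
Definition hform (v : 'rV[K]_n) (x : 'M[K]_n) : K := \sum_(i < n) v 0 i * x i i.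

(* (v (x) 1) z, with values in C (x) Mat_n = Mat_n; on h (x) h only the terms
   with i = j and k = l contribute. *)
Definition contract (v : 'rV[K]_n) z : 'M[K]_n :=
  \sum_i \sum_j \sum_k \sum_l
    (tcoef z i k j l * hform v (munit i j)) *: munit k l.

Context (Gamma1 : {set 'I_n.-1}) (tau : 'I_n.-1 -> 'I_n.-1).

Definition r0_equation (r0 : 'M[K]_(n * n)) :=
  forall i, i \in Gamma1 ->
    contract (alpha i - alpha (tau i)) r0
    = 2^-1 *: contract (alpha i + alpha (tau i)) P0.

(* e_{-alpha} is e_ji for alpha = e_i - e_j. *)
Definition GGS_a : 'M[K]_(n * n) :=
  \sum_(i < n) \sum_(j < n) \sum_(k < n)
    \sum_(l < n | prec Gamma1 tau (evec i - evec j : 'rV[K]_n) (evec k - evec l))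
      sgn K Gamma1 tau i j k l *: wedge (munit j i) (munit k l).

Definition r_s : 'M[K]_(n * n) :=
  2^-1 *: P0 + \sum_(i < n) \sum_(j < n | (i < j)%N) munit j i *t munit i j.

Definition GGS_eps : 'M[K]_(n * n) :=
  GGS_a *m r_s + r_s *m GGS_a + GGS_a *m GGS_a.

Definition R_s : 'M[fps K]_(n * n) :=
  q *: (\sum_i munit i i *t munit i i)
  + \sum_i \sum_(j | i != j) munit i i *t munit j j
  + (q - qinv) *: \sum_(i < n) \sum_(j < n | (j < i)%N) munit i j *t munit j i.

Definition GGS_atilde : 'M[fps K]_(n * n) :=
  \sum_i \sum_j \sum_k \sum_l
    (fpsC (tcoef GGS_a i k j l)
     * qpow (tcoef GGS_a i k j l * tcoef GGS_eps i k j l))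
    *: (munit i j *t munit k l).

Definition Rbar_GGS : 'M[fps K]_(n * n) := R_s + (q - qinv) *: GGS_atilde.

Definition R_GGS (r0 : 'M[K]_(n * n)) : 'M[fps K]_(n * n) :=
  qpow_mx r0 *m Rbar_GGS *m qpow_mx r0.

End GGS.

(* Main.v *)
(* Put R_0 = q ^ r0 R_s q ^ r0. The powers tau ^ k, k >= 1, give unipotent matrices
   Theta_k = 1 + (q - q^-1) (...), and J = Theta_1 Theta_2 ... is a finite product since
   tau is nilpotent. The equation of r0 makes the Theta_k satisfy Yang-Baxter equations
   in which the factor on the legs 1 and 3 is dressed by a diagonal factor on the leg 2;
   they give a cocycle identity for J, so that R = J21^-1 R_0 J satisfies the quantum
   Yang-Baxter and Hecke relations, for every n.
   It remains to see that R = R_GGS. The equation J21 R = R_0 J is solved for the entries of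
   R by induction: each is a sum of monomials ("hops"), one for each power of tau that
   carries the root of its first leg to that of its second leg. The remaining entries follow
   from the mirror symmetry (tau, r0, q) -> (tau^-1, - r0, q^-1). Hence every entry has the
   form x q ^ y (q - q^-1) ^ z of an entry of R_GGS; the x are those of a and r_s, and
   the terms of order 2 in the Hecke relation force the exponents to be those of epsilon. *)
Require Import Defs.
From mathcomp Require Import all_boot all_order all_algebra.
From mathcomp Require Import boolp reals zify ring.
Set Implicit Arguments.
Unset Strict Implicit.
Unset Printing Implicit Defensive.
Import GRing.Theory Num.Theory.

(** The exponents of [R_GGS] involve [GGS_eps], a sum of matrix products that is never evaluated. A
    hop with sign x and exponent t has a mirror image with sign - x and exponent - t, so each of the
    two has the coefficient 2 x t at hbar ^ 2. The Hecke relation at this order makes their sum 4 x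
    t equal to 4 times the entry of epsilon, whence t = x epsilon. Only the shape of the entries,
    the signs and this antisymmetry have to be known. The obstacle is the reversal of orientation.
    An interval reversed by a power of tau can be cut into pieces whose images come in the order in
    which products of kernels produce them, so sums over cut points arise. The weight (- q ^ -1) ^
    (L - 1) of a reversed interval of length L turns them into geometric series of ratio q ^ -2 or q
    ^ 2, which the factor q - q ^ -1 sums. In the solution for R the induction passes from the
    simple root i to tau ^ g i, where g is the least positive power that preserves the orientation
    of an interval starting at i; the smaller powers reverse it and contribute isolated terms. *)

Definition adj (x y : nat) : bool := (y == x.+1) || (x == y.+1).

(** * Powers of tau on positive roots *)

Section Steps.
Context (n : nat) (arr : nat -> nat -> Prop).

(** The bound in the case k = 0 makes tau ^ 0 the identity on the simple roots only. *)
Fixpoint tau_step (k x y : nat) : Prop :=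
  if k is k'.+1 then exists2 z, arr x z & tau_step k' z y else x = y /\ x.+1 < n.
Local Notation step := tau_step.

(* The simple root e_x - e_{x+1} is represented by x, and the positive root
   e_i - e_j by the interval (i, j) of its endpoints. [o = true] means that the
   orientation is reversed; both values are possible when j = i + 1. *)
Definition tau_im (o : bool) (k i j u v : nat) : Prop :=
  [/\ i < j, v = u + (j - i)
    & forall x, i <= x < j -> step k x (if o then v - (x - i).+1 else u + (x - i))].
Local Notation im := tau_im.

(** The combinatorial content of a Belavin-Drinfeld triple: [arr_adj] expresses the preservation of
    inner products, since distinct simple roots have inner product -1 or 0 according to adjacency.
    For a relation, unlike a function, these axioms are symmetric in source and target, so they hold
    for the inverse of tau as well. *)
Record arrows : Prop := Arrows {
  arr_lt : forall x y, arr x y -> x.+1 < n /\ y.+1 < n;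
  arr_fun : forall x y y', arr x y -> arr x y' -> y = y';
  arr_inj : forall x x' y, arr x y -> arr x' y -> x = x';
  arr_adj : forall x y x' y', arr x y -> arr x' y' -> adj x x' = adj y y';
  arr_nil : exists m, forall x y, ~ step m x y }.

End Steps.

Section StepTheory.
Context (n : nat) (arr : nat -> nat -> Prop) (arrP : arrows n arr).
Local Notation step := (tau_step n arr).
Local Notation im := (tau_im n arr).

Lemma step_lt k x y : step k x y -> x.+1 < n /\ y.+1 < n.
Proof.
elim: k x => [|k IH] x /=; first by case=> ->.
by case=> z /(arr_lt arrP) [? _] /IH [].
Qed.

Lemma step_fun k x y y' : step k x y -> step k x y' -> y = y'.
Proof.
elim: k x => [|k IH] x /=; first by case=> -> _ [->].
by case=> z xz zy [z' xz' z'y']; move: z'y'; rewrite -(arr_fun arrP xz xz') => /(IH _ zy).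
Qed.

Lemma step_inj k x x' y : step k x y -> step k x' y -> x = x'.
Proof.
elim: k x x' => [|k IH] x x' /=; first by case=> -> _ [->].
case=> z xz zy [z' xz' z'y]; move: xz'; rewrite -(IH _ _ zy z'y).
exact: (arr_inj arrP).
Qed.

Lemma step_adj k x x' y y' : step k x y -> step k x' y' -> adj x x' = adj y y'.
Proof.
elim: k x x' => [|k IH] x x' /=; first by case=> -> _ [->].
by case=> z xz zy [z' xz' zy']; rewrite (arr_adj arrP xz xz') (IH _ _ zy zy').
Qed.

Lemma stepD k l x y : step (k + l) x y <-> exists2 z, step k x z & step l z y.
Proof.
elim: k x => [|k IH] x /=; split.
- by move=> xy; exists x => //; have [] := step_lt xy.
- by case=> z [-> _].
- by case=> z xz /IH [w zw wy]; exists w => //; exists z.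
- by case=> w [z xz zw] wy; exists z => //; apply/IH; exists w.
Qed.

Lemma step1 x y : step 1 x y <-> arr x y.
Proof.
split=> [[z xz [<- _]] //|xy]; exists y => //; split=> //.
by have [] := arr_lt arrP xy.
Qed.

(** The form of nilpotency that excludes configurations: a set to which each of its elements returns
    after a positive number of steps would give chains of arbitrary length. *)
Lemma step_stable (W : nat -> Prop) (x0 : nat) : W x0 ->
  (forall x, W x -> exists k y, [/\ 0 < k, step k x y & W y]) -> False.
Proof.
move=> Wx0 WW; have [m nil] := arr_nil arrP.
have long N : exists k y, [/\ N <= k, step k x0 y & W y].
  elim: N => [|N [k [y [Nk xy Wy]]]].
    by have [k [y [k0 xy Wy]]] := WW _ Wx0; exists k, y.
  have [l [z [l0 yz Wz]]] := WW _ Wy; exists (k + l), z; split=> //; first by lia.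
  by apply/stepD; exists y.
have [k [y [mk xy _]]] := long m.
by move: xy; rewrite -(subnKC mk) => /stepD [z /nil].
Qed.

Lemma im_lt o k i j u v : im o k i j u v -> [/\ i < j, j < n, u < v & v < n].
Proof.
case=> ij vE H.
have [i1 i2] : i.+1 < n /\ (if o then v - (i - i).+1 else u + (i - i)).+1 < n.
  by apply: (@step_lt k); apply: H; lia.
have [j1 j2] : j.-1.+1 < n /\ (if o then v - (j.-1 - i).+1 else u + (j.-1 - i)).+1 < n.
  by apply: (@step_lt k); apply: H; lia.
by case: o i2 j2 {H} => i2 j2; split; lia.
Qed.

Lemma im_sub o k i j u v i' j' : im o k i j u v -> i <= i' -> i' < j' -> j' <= j ->
  im o k i' j' (if o then v - (j' - i) else u + (i' - i))
               (if o then v - (i' - i) else u + (j' - i)).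
Proof.
move=> imE ii' ij' jj'; case: imE => ij vE H.
split=> //; first by case: (o); lia.
move=> x xi; have /H : i <= x < j by lia.
by congr (step _ _ _); case: (o) => /=; lia.
Qed.

Lemma im_subF k i j u v i' j' : im false k i j u v -> i <= i' -> i' < j' -> j' <= j ->
  im false k i' j' (u + (i' - i)) (u + (j' - i)).
Proof. exact: im_sub. Qed.

Lemma im_subT k i j u v i' j' : im true k i j u v -> i <= i' -> i' < j' -> j' <= j ->
  im true k i' j' (v - (j' - i)) (v - (i' - i)).
Proof. exact: im_sub. Qed.

Lemma im_root o k i j u v x : im o k i j u v -> i <= x < j ->
  exists2 y, step k x y & u <= y < v.
Proof. by case=> ij vE H xi; eexists; first exact: H; case: (o); lia. Qed.

Lemma im_rootF k i j u v x : im false k i j u v -> i <= x < j -> step k x (u + (x - i)).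
Proof. by case=> _ _ H /H. Qed.

Lemma im_fun o o' k i j u v u' v' : im o k i j u v -> im o' k i j u' v' -> u = u' /\ v = v'.
Proof.
case=> ij vE H [_ vE' H'].
have ii : i <= i < j by lia.
have jj : i <= j.-1 < j by lia.
have := step_fun (H _ ii) (H' _ ii); have := step_fun (H _ jj) (H' _ jj).
by case: (o); case: (o'); lia.
Qed.

Lemma im_or o o' k i j u v u' v' : i.+1 < j ->
  im o k i j u v -> im o' k i j u' v' -> o = o'.
Proof.
move=> ij1 [ij vE H] [_ vE' H'].
have ii : i <= i < j by lia.
have jj : i <= j.-1 < j by lia.
have := step_fun (H _ ii) (H' _ ii); have := step_fun (H _ jj) (H' _ jj).
by case: (o); case: (o') => //; lia.
Qed.

Lemma im_inj o o' k i j i' j' u v : im o k i j u v -> im o' k i' j' u v -> i = i' /\ j = j'.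
Proof.
case=> ij vE H [ij' vE' H'].
have [L1 L2] : j = i + (v - u) /\ j' = i' + (v - u) by lia.
have: i = i'; last by lia.
have ii : i <= i < j by lia.
have jj : i <= j.-1 < j by lia.
have ii' : i' <= i' < j' by lia.
have jj' : i' <= j'.-1 < j' by lia.
move: (H _ ii) (H _ jj) (H' _ ii') (H' _ jj'); case: (o); case: (o').
- by move=> h _ h' _; apply: step_inj h _; congr (step _ _ _): h'; lia.
- move=> h1 h2 h1' h2'.
  have : i = j'.-1 by apply: step_inj h1 _; congr (step _ _ _): h2'; lia.
  have : j.-1 = i' by apply: step_inj h2 _; congr (step _ _ _): h1'; lia.
  by lia.
- move=> h1 h2 h1' h2'.
  have : i = j'.-1 by apply: step_inj h1 _; congr (step _ _ _): h2'; lia.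
  have : j.-1 = i' by apply: step_inj h2 _; congr (step _ _ _): h1'; lia.
  by lia.
- by move=> h _ h' _; apply: step_inj h _; congr (step _ _ _): h'; lia.
Qed.

Lemma im_comp o o' k l i j u v u' v' :
  im o k i j u v -> im o' l u v u' v' -> im (o (+) o') (k + l) i j u' v'.
Proof.
case=> ij vE H [_ vE' H']; split=> //; first by lia.
move=> x xi; apply/stepD; eexists; first exact: (H _ xi).
have /H' : u <= (if o then v - (x - i).+1 else u + (x - i)) < v by case: (o); lia.
by congr (step _ _ _); case: (o); case: (o') => /=; lia.
Qed.

(** The image of an interval grows root by root. The image of the next root is adjacent to that of
    the last one by [step_adj] and differs from the earlier ones by injectivity, so it extends the
    image at one end; the second root decides at which end, and thereby the orientation. *)
Lemma im_of_dom k i j : i < j -> (forall x, i <= x < j -> exists y, step k x y) ->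
  exists o u v, im o k i j u v.
Proof.
move=> ij; rewrite -(subnKC ij); elim: (j - i.+1) => [|L IH] dom {j ij}.
  have [|y iy] := dom i; first by lia.
  exists false, y, y.+1; split; [lia|lia|] => x xi.
  have -> : x = i by lia.
  by congr (step _ _ _): iy; lia.
have [|o [u [v imE]]] := IH; first by move=> x xi; apply: dom; lia.
have [j jE] : exists j, j = i.+1 + L by exists (i.+1 + L).
rewrite -jE in imE; have jE1 : i.+1 + L.+1 = j.+1 by lia.
rewrite jE1 in dom *.
have [|y jy] := dom j; first by lia.
have [ij vE H] := imE.
have jm : i <= j.-1 < j by lia.
have adjE := step_adj jy (H _ jm).
have {adjE} adjE : adj y (if o then u else v.-1).
  have <- : (if o then v - (j.-1 - i).+1 else u + (j.-1 - i)) = (if o then u else v.-1).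
    by case: (o); lia.
  by rewrite -adjE /adj; apply/orP; right; lia.
have new x : i <= x < j -> y <> (if o then v - (x - i).+1 else u + (x - i)).
  by move=> xi yE; have := step_inj jy; rewrite yE => /(_ _ (H _ xi)); lia.
(* While the interval is a single root, the recorded o carries no information, so the next image may
   lie on either side; hence the two cases with j = i + 1. *)
have [o1|] : o = false /\ y = v \/ o = true /\ u = y.+1 \/ j = i.+1 /\ y.+2 = v \/ j = i.+1 /\ y = v.
  case: o adjE {imE} H new => adjE H new; move: adjE; rewrite /adj => /orP [] /eqP yE.
  - by right; left; split=> //; lia.
  - have [je|j1] := eqVneq j i.+1; first by right; right; right; split=> //; lia.
    have /new : i <= j.-2 < j by lia.
    by lia.
  - have [je|j1] := eqVneq j i.+1; first by right; right; left; split=> //; lia.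
    have /new : i <= j.-2 < j by lia.
    by lia.
  - by left; split=> //; lia.
- case: o1 => o1 yE; subst o y; exists false, u, v.+1; split; [lia|lia|] => x xi.
  have [xj|xj] := eqVneq x j; first by subst x; congr (step _ _ _): jy; lia.
  have /H : i <= x < j by lia.
  by congr (step _ _ _); lia.
case=> [[o1 yE]|[[j1 yE]|[j1 yE]]].
- subst o u; exists true, y, v; split; [lia|lia|] => x xi.
  have [xj|xj] := eqVneq x j; first by subst x; congr (step _ _ _): jy; lia.
  have /H : i <= x < j by lia.
  by congr (step _ _ _); lia.
- exists true, y, v; split; [lia|lia|] => x xi.
  have [xj|xj] := eqVneq x j; first by subst x; congr (step _ _ _): jy; lia.
  have /H : i <= x < j by lia.
  by congr (step _ _ _); case: (o) => /=; lia.
- exists false, u, v.+1; split; [lia|lia|] => x xi.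
  have [xj|xj] := eqVneq x j; first by subst x; congr (step _ _ _): jy; lia.
  have /H : i <= x < j by lia.
  by congr (step _ _ _); case: (o) => /=; lia.
Qed.

Lemma im_decomp o k l i j u' v' : im o (k + l) i j u' v' ->
  exists o1 u v, im o1 k i j u v /\ im (o (+) o1) l u v u' v'.
Proof.
move=> imE; have [ij vE H] := imE.
have [x /H/stepD [z xz _]|o1 [u [v im1]]] := @im_of_dom k i j ij; first by exists z.
have [_ vE1 H1] := im1.
exists o1, u, v; split=> //; split; [lia|lia|] => y yu.
set x := if o1 then i + (v - y.+1) else i + (y - u).
have xi : i <= x < j by rewrite /x; case: (o1); lia.
have /stepD [z xz zy] := H x xi.
have zE : z = y by rewrite (step_fun xz (H1 _ xi)) /x; case: (o1); lia.
by rewrite zE in zy; congr (step _ _ _): zy; rewrite /x; case: (o); case: (o1) => /=; lia.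
Qed.

Lemma im_dom k l o i j u v : im o k i j u v -> l <= k -> exists o' u' v', im o' l i j u' v'.
Proof.
move=> imE lk; move: imE; rewrite -(subnKC lk) => /im_decomp [o1 [u1 [v1 [h _]]]].
by exists o1, u1, v1.
Qed.

(** The union of the pieces is mapped with one orientation by [im_of_dom], and this orientation
    decides which of the two images comes first, whatever orientations were recorded for the
    pieces. *)
Lemma im_cat o1 o2 k i m j u1 v1 u2 v2 : im o1 k i m u1 v1 -> im o2 k m j u2 v2 ->
  (im false k i j u1 v2 /\ v1 = u2) \/ (im true k i j u2 v1 /\ v2 = u1).
Proof.
move=> h1 h2; have [im1 vE1 H1] := h1; have [mj vE2 H2] := h2.
have [||o [u [v h]]] := @im_of_dom k i j; first by lia.
  move=> x xi; have [xm|mx] := ltnP x m.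
    have xi1 : i <= x < m by lia.
    by have [y xy _] := im_root h1 xi1; exists y.
  have xi2 : m <= x < j by lia.
  by have [y xy _] := im_root h2 xi2; exists y.
have [ij vE _] := h.
have [e1 e1'] := im_fun h1 (im_sub h (leqnn _) im1 (ltnW mj)).
have [e2 e2'] := im_fun h2 (im_sub h (ltnW im1) mj (leqnn _)).
case: o h e1 e1' e2 e2' => h /= e1 e1' e2 e2'; [right|left].
- have [eu ev] : u2 = u /\ v1 = v by lia.
  by rewrite eu ev; split=> //; lia.
- have [eu ev] : u1 = u /\ v2 = v by lia.
  by rewrite eu ev; split=> //; lia.
Qed.

(** If two powers agreed on the interval, the difference of their exponents would give a positive
    power that carries (u, v) onto itself. Hence the endpoints of a hop determine its power of
    tau. *)
Lemma im_self o o' k l i j u v : im o k i j u v -> im o' l i j u v -> k = l.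
Proof.
wlog kl : k l o o' / k < l => [th h h'|].
  by have [lt|lt|//] := ltngtP k l; [exact: th h h'|symmetry; exact: th h' h].
move=> h h'; exfalso; move: h'; rewrite -(subnKC (ltnW kl)).
move=> /im_decomp [o1 [u1 [v1 [h1 h2]]]].
have [eu ev] := im_fun h h1; subst u1 v1.
have [_ _ uv _] := im_lt h.
apply: (@step_stable (fun x => u <= x < v) u); first by lia.
move=> x /(im_root h2) [y xy uy]; exists (l - k), y; split=> //; lia.
Qed.

End StepTheory.

Section Converse.
Context (n : nat) (arr : nat -> nat -> Prop) (arrP : arrows n arr).
Local Notation cnv := (fun x y => arr y x).

Lemma step_cnv k x y : tau_step n cnv k x y <-> tau_step n arr k y x.
Proof.
have stepS k' (a : nat -> nat -> Prop) x' y' : arrows n a ->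
    tau_step n a k'.+1 x' y' <-> exists2 z, tau_step n a k' x' z & a z y'.
  move=> aP; rewrite -addn1 stepD //.
  by split=> [] [z h1 /(step1 aP) h2]; exists z.
elim: k x y => [|k IH] x y.
  by split=> /= -[-> ?].
rewrite (stepS k arr y x arrP); split=> /=.
- by case=> z zx /IH yz; exists z.
- by case=> z /IH yz zx; exists z.
Qed.

Lemma arrows_cnv : arrows n cnv.
Proof.
split.
- by move=> x y /(arr_lt arrP) [].
- by move=> x y y' /(arr_inj arrP) h /h.
- by move=> x y y' /(arr_fun arrP) h /h.
- by move=> x y x' y' xy /(arr_adj arrP xy).
- by have [m nil] := arr_nil arrP; exists m => x y /step_cnv /nil.
Qed.

Lemma im_cnv o k i j u v : tau_im n cnv o k u v i j <-> tau_im n arr o k i j u v.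
Proof.
split=> -[h1 h2 h3]; split; [lia|lia| |lia|lia|] => x xi.
- have h : u <= (if o then v - (x - i).+1 else u + (x - i)) < v by case: (o); lia.
  by have /step_cnv := h3 _ h; congr (tau_step _ _ _ _ _); case: (o); lia.
- have h : i <= (if o then j - (x - u).+1 else i + (x - u)) < j by case: (o); lia.
  by apply/step_cnv; have := h3 _ h; congr (tau_step _ _ _ _ _); case: (o); lia.
Qed.

(** This is [im_cat] for the inverse arrows: intervals with neighbouring images are neighbours. *)
Lemma im_cat_inv o1 o2 k i m i2 j u1 v1 v2 :
  tau_im n arr o1 k i m u1 v1 -> tau_im n arr o2 k i2 j v1 v2 ->
  (tau_im n arr false k i j u1 v2 /\ m = i2) \/ (tau_im n arr true k i2 m u1 v2 /\ j = i).
Proof.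
move=> /im_cnv h1 /im_cnv h2; have := im_cat arrows_cnv h1 h2.
by case=> -[/im_cnv h e]; [left|right].
Qed.

End Converse.

Section ImSums.
Context (n : nat) (arr : nat -> nat -> Prop).
Local Notation im := (tau_im n arr).
Local Notation step := (tau_step n arr).
Local Open Scope ring_scope.

Lemma im_sum (V : zmodType) (F G : nat -> V) o k i j u v : im o k i j u v ->
  (forall x y, (i <= x < j)%N -> step k x y -> F x = G y) ->
  \sum_(i <= x < j) F x = \sum_(u <= y < v) G y.
Proof.
case=> ij vE H FG; rewrite {}vE in H *.
rewrite -{1}(add0n i) -[u in RHS]add0n (big_addn 0 j i) (big_addn 0 _ u).
rewrite (_ : u + (j - i) - u = j - i)%N; last by lia.
case: o H => H.
- rewrite [RHS]big_nat_rev /=; apply: eq_big_nat => x xj; apply: FG; first by lia.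
  have /H : (i <= x + i < j)%N by lia.
  by congr (step _ _ _); lia.
- apply: eq_big_nat => x xj; apply: FG; first by lia.
  have /H : (i <= x + i < j)%N by lia.
  by congr (step _ _ _); lia.
Qed.

Lemma tele (V : zmodType) (F : nat -> V) i j : (i <= j)%N ->
  F i - F j = \sum_(i <= x < j) (F x - F x.+1).
Proof.
move=> ij; rewrite -opprB -telescope_sumr // -sumrN.
by apply: eq_bigr => x _; rewrite opprB.
Qed.

End ImSums.

(* [kappa] is the bilinear form 2 r0 + P0 in the basis of the e_u, and [r0_arr] is
   the equation of r0 in the form kappa (tau a, v) = - kappa (v, a). *)
Definition kappa (K : pzRingType) (s : nat -> nat -> K) (u v : nat) : K :=
  (s u v *+ 2 + (u == v)%:R)%R.
Local Notation kap := kappa.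

Record r0_form (K : numFieldType) (n : nat) (arr : nat -> nat -> Prop)
    (s : nat -> nat -> K) : Prop := R0Form {
  s_skew : forall u v, s u v = (- s v u)%R;
  r0_arr : forall x y v, arr x y -> (v < n)%N ->
    (kappa s y v - kappa s y.+1 v = - (kappa s v x - kappa s v x.+1))%R }.

(** * Invariance of r0 under the powers of tau *)

Section Forms.
Context (K : numFieldType) (n : nat) (arr : nat -> nat -> Prop) (arrP : arrows n arr).
Context (s : nat -> nat -> K) (sP : r0_form n arr s).
Local Notation im := (tau_im n arr).
Local Notation step := (tau_step n arr).
Local Notation kap := (kappa s).
Local Open Scope ring_scope.

Lemma s_diag u : s u u = 0.
Proof.
have /eqP : s u u *+ 2 = 0 by rewrite mulr2n {2}(s_skew sP) subrr.
by rewrite mulrn_eq0 => /eqP.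
Qed.

Lemma kapC u v : kap u v = - kap v u + (u == v)%:R *+ 2.
Proof. by rewrite /kappa (s_skew sP u v) [v == u]eq_sym; ring. Qed.

Definition ip_root_vec (i j v : nat) : K := (i == v)%:R - (j == v)%:R.
Definition ip_roots (i j k l : nat) : K := ip_root_vec i j k - ip_root_vec i j l.

(** The value of the skew form s on the roots e_i - e_j and e_k - e_l. *)
Definition br (i j k l : nat) : K := s i k - s i l - s j k + s j l.

Lemma ipr_step k x y x' y' : step k x y -> step k x' y' ->
  ip_roots x x.+1 x' x'.+1 = ip_roots y y.+1 y' y'.+1.
Proof.
move=> xy xy'.
have E (u w : nat) : ip_roots u u.+1 w w.+1 = (u == w)%:R *+ 2 - (adj u w)%:R :> K.
  rewrite /ip_roots /ip_root_vec /adj eqSS.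
  have [->|uw] := eqVneq u w.
    have -> : (w == w.+1) = false by lia.
    have -> : (w.+1 == w) = false by lia.
    by rewrite ?eqxx /=; ring.
  have [->|uw1] := eqVneq u w.+1.
    have -> : (w.+2 == w) = false by lia.
    have -> : (w == w.+2) = false by lia.
    by rewrite ?eqxx /=; ring.
  have [e|uw2] := eqVneq u.+1 w.
    subst w; by rewrite ?eqxx /=; ring.
  by rewrite /=; ring.
rewrite !E (step_adj arrP xy xy'); congr ((nat_of_bool _)%:R *+ 2 - _).
by apply/eqP/eqP => [e|e]; subst; [exact: step_fun xy xy'|exact: step_inj xy xy'].
Qed.

(** On simple roots a and b the equation of r0, used twice, gives kappa (tau a, tau b) = - kappa
    (tau b, a) = kappa (a, b). The symmetric part of kappa is the inner product, which tau
    preserves, so the skew part is preserved too. *)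
Lemma br_arr x y x' y' : arr x y -> arr x' y' ->
  br x x.+1 x' x'.+1 = br y y.+1 y' y'.+1.
Proof.
move=> xy xy'.
have [x1 y1] := arr_lt arrP xy; have [x1' y1'] := arr_lt arrP xy'.
have e1 := r0_arr sP xy (ltnW y1'); have e2 := r0_arr sP xy y1'.
have e3 := r0_arr sP xy' (ltnW x1); have e4 := r0_arr sP xy' x1.
have h : step 1 x y by apply/step1.
have h' : step 1 x' y' by apply/step1.
have e := ipr_step h h'.
have brE i j k l :
    2%:R * br i j k l = kap i k - kap i l - (kap j k - kap j l) - ip_roots i j k l.
  by rewrite /br /kappa /ip_roots /ip_root_vec; ring.
apply: (mulfI (_ : 2%:R != 0)); first by rewrite pnatr_eq0.
rewrite !brE e; congr (_ - _).
have -> : kap y y' - kap y y'.+1 - (kap y.+1 y' - kap y.+1 y'.+1)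
  = (kap y y' - kap y.+1 y') - (kap y y'.+1 - kap y.+1 y'.+1) by ring.
rewrite e1 e2.
have -> : - (kap y' x - kap y' x.+1) - - (kap y'.+1 x - kap y'.+1 x.+1)
  = - (kap y' x - kap y'.+1 x) + (kap y' x.+1 - kap y'.+1 x.+1) by ring.
by rewrite e3 e4; ring.
Qed.

Lemma br_step k x y x' y' : step k x y -> step k x' y' ->
  br x x.+1 x' x'.+1 = br y y.+1 y' y'.+1.
Proof.
elim: k x x' => [|k IH] x x' /=; first by case=> -> _ [->].
by case=> z xz zy [z' xz' zy']; rewrite (br_arr xz xz') (IH _ _ zy zy').
Qed.

Lemma br_im o o' k i j u v i' j' u' v' :
  im o k i j u v -> im o' k i' j' u' v' -> br i j i' j' = br u v u' v'.
Proof.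
move=> h h'; have [ij vE _] := h; have [ij' vE' _] := h'.
have brE a b a' b' : (a <= b)%N -> (a' <= b')%N ->
    br a b a' b' = \sum_(a <= x < b) \sum_(a' <= x' < b') br x x.+1 x' x'.+1.
  move=> ab ab'.
  have -> : br a b a' b' = (s a a' - s a b') - (s b a' - s b b') by rewrite /br; ring.
  rewrite (tele (fun x => s x a' - s x b')) //; apply: eq_bigr => x _.
  have -> : s x a' - s x b' - (s x.+1 a' - s x.+1 b')
    = (s x a' - s x.+1 a') - (s x b' - s x.+1 b') by ring.
  rewrite (tele (fun x' => s x x' - s x.+1 x')) //; apply: eq_bigr => x' _.
  by rewrite /br; ring.
rewrite !brE; [|lia..].
apply: (im_sum h) => x y xi xy; apply: (im_sum h') => x' y' xi' xy'.
exact: br_step xy xy'.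
Qed.

Lemma s_cat i m j : s i j = s i m + s m j - br i m m j.
Proof. by rewrite /br s_diag; ring. Qed.

Lemma br_sym i j k l : br i j k l = - br k l i j.
Proof.
by rewrite /br (s_skew sP i k) (s_skew sP i l) (s_skew sP j k) (s_skew sP j l); ring.
Qed.

(** By [s_cat] the defect of additivity of s at a cut is a value of [br] on two neighbouring roots,
    which powers of tau preserve. A reversing power exchanges the two roots, which is the origin of
    the sign in [s_catT]. *)
Lemma s_catF k i m j u w v : im false k i j u v -> (i < m < j)%N -> w = (u + (m - i))%N ->
  s i j - s i m - s m j = s u v - s u w - s w v.
Proof.
move=> h mi wE.
have h1 : im false k i m u w.
  have := im_subF h (leqnn i) _ _ (j' := m); rewrite subnn addn0 wE; apply; lia.
have h2 : im false k m j w v.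
  have := im_subF h _ _ (leqnn j) (i' := m); have [_ -> _] := h; rewrite -wE; apply; lia.
by rewrite (s_cat i m j) (s_cat u w v) (br_im h1 h2); ring.
Qed.

Lemma s_catT k i m j u w v : im true k i j u v -> (i < m < j)%N -> w = (v - (m - i))%N ->
  s i j - s i m - s m j = - (s u v - s u w - s w v).
Proof.
move=> h mi wE; have [ij vE _] := h.
have h1 : im true k i m w v.
  have := im_subT h (leqnn i) _ _ (j' := m); rewrite subnn subn0 wE; apply; lia.
have h2 : im true k m j u w.
  have := im_subT h _ _ (leqnn j) (i' := m); rewrite -wE.
  have -> : (v - (j - i) = u)%N by lia.
  by apply; lia.
by rewrite (s_cat i m j) (s_cat u w v) (br_im h1 h2) br_sym; ring.
Qed.

End Forms.

(** * Yang-Baxter equations between the factors of the twist *)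

Section Kernels.
Context (n : nat) (arr : nat -> nat -> Prop) (arrP : arrows n arr).
Context (K : numFieldType) (s : nat -> nat -> K) (sP : r0_form n arr s).
Context (A : comNzRingType) (qp : K -> A).
Hypotheses (qp0 : qp 0%R = 1%R) (qpD : forall x y, qp (x + y)%R = (qp x * qp y)%R).
Local Notation im := (tau_im n arr).
Local Notation step := (tau_step n arr).
Local Open Scope ring_scope.

(** The exponential x |-> q ^ x enters only as a homomorphism [qp], so that everything applies again
    with q ^ -1 in place of q in the mirror symmetry. *)
Definition qdiff : A := qp 1 - qp (-1).
Local Notation c := qdiff.
Definition neg_qinv : A := - qp (-1).
Local Notation e := neg_qinv.

Lemma qp_inv x : qp x * qp (- x) = 1. Proof. by rewrite -qpD subrr qp0. Qed.

Lemma ce : c * e = e ^+ 2 - 1.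
Proof. by rewrite /c /e -(qp_inv 1); ring. Qed.

(** The series that evaluates the sums over cut points in [qybe_kernel]. *)
Lemma geom m : c * e * \sum_(t < m) e ^+ (2 * t) = e ^+ (2 * m) - 1.
Proof.
rewrite ce exprM [RHS]subrX1; congr (_ * _).
by apply: eq_bigr => t _; rewrite exprM.
Qed.

Definition orient_w (o : bool) (L : nat) : A := if o then e ^+ L.-1 else 1.
Definition hop_w (o : bool) (i a b l : nat) : A := orient_w o (a - i) * qp (s i a + s b l).

(* Theta_k = 1 + qdiff * theta_ker k, where theta_ker k moves the basis vector (a, b) to (i, l). *)
Definition theta_ker (k a b i l : nat) : A :=
  if `[< im false k i a b l >] then hop_w false i a b l
  else if `[< im true k i a b l >] then hop_w true i a b l else 0.
Local Notation X := theta_ker.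

Lemma XE o k a b i l : im o k i a b l -> X k a b i l = hop_w o i a b l.
Proof.
rewrite /theta_ker; case: asboolP => [h1|nh1]; case: o => h2.
- have [ai|ai] := ltnP i.+1 a; first by have := im_or arrP ai h1 h2.
  have [ia _ _] := h1; rewrite /hop_w /orient_w.
  by have -> : (a - i).-1 = 0%N by lia.
- by [].
- by case: asboolP.
- by case: nh1.
Qed.

Lemma X_neq0 k a b i l : X k a b i l != 0 -> exists o, im o k i a b l.
Proof.
rewrite /theta_ker; case: asboolP => [h1|nh1]; first by exists false.
by case: asboolP => [h1|nh2]; [exists true|rewrite eqxx].
Qed.

Lemma X_eq0 k a b i l : (forall o, ~ im o k i a b l) -> X k a b i l = 0.
Proof. by move=> h; apply/eqP; apply: contraT => /X_neq0 [o /h]. Qed.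

(** The image of an interval as a function, needed because the dressing depends on it. In
    [dressed_ker] with k <= p, the default (0, 0) is met only where the factor [theta_ker]
    vanishes. *)
Definition tau_imf (k i j : nat) : nat * nat :=
  if pselect (exists uv : nat * nat, exists o, im o k i j uv.1 uv.2) is left h
  then projT1 (cid h) else (0, 0)%N.

Lemma imfE o k i j u v : im o k i j u v -> tau_imf k i j = (u, v).
Proof.
move=> h; rewrite /tau_imf; case: pselect => [h'|]; last by case; exists (u, v), o.
case: cid => -[u' v'] /= [o' h1].
by have [-> ->] := im_fun arrP h1 h.
Qed.

(** For sg = 1 the exponent is kappa (e_g - e_h, e_b), and for sg = -1 it is - kappa (e_b, e_g -
    e_h). The equation of r0 therefore identifies the dressing with sign 1 at an interval with the
    dressing with sign -1 at its preimage under tau. *)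
Definition dressing (sg : K) (g h b : nat) : A := qp ((s g b - s h b) *+ 2 + sg * ip_root_vec K g h b).

(* The factor of Theta_p on the legs 1 and 3, dressed on the leg 2. *)
Definition dressed_ker (sg : K) (k p a d i l b : nat) : A :=
  X p a d i l * (let gh := tau_imf k i a in dressing sg gh.1 gh.2 b).
Local Notation Z := dressed_ker.

Lemma ZE sg o k p a d i l b g h : im o k i a g h -> Z sg k p a d i l b = X p a d i l * dressing sg g h b.
Proof. by move=> /imfE E; rewrite /dressed_ker E. Qed.

Lemma Z_neq0 sg k l a d i m b : Z sg k (k + l) a d i m b != 0 ->
  exists o o' g h, im o k i a g h /\ im o' l g h d m.
Proof.
move=> Z0; have /X_neq0 [o] : X (k + l) a d i m != 0.
  by apply: contraNneq Z0; rewrite /dressed_ker => ->; rewrite mul0r.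
by move=> /(im_decomp arrP) [o1 [g [h [h1 h2]]]]; exists o1, (o (+) o1), g, h.
Qed.

Lemma mul_neq0 (x y : A) : x * y != 0 -> x != 0 /\ y != 0.
Proof.
by move=> xy; split; apply: contraNneq xy => ->; rewrite ?mul0r ?mulr0.
Qed.

Section Terms.
Context (k l a b d a' b' d' : nat).
Local Notation p := (k + l)%N.
(** The terms at the entry from (a, b, d) to (a', b', d') of a Yang-Baxter equation between 1 + c U,
    1 + c W and 1 + c V: [qybe_T0] is the difference of the two dressed factors divided by c,
    [qybe_T1] to [qybe_T6] are the products of two kernels, [qybe_T7] and [qybe_T8] those of three.
    Since a hop moves both legs by the same amount, intermediate indices are forced, except for b1
    in the triple products. *)
Definition qybe_T0 : A := (b == b')%:R * (X p a d a' d' *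
  (let gh := tau_imf k a' a in
   qp ((s gh.1 b - s gh.2 b) *+ 2) * ((gh.2 == b)%:R - (gh.1 == b)%:R))).
Definition qybe_T1 : A := X k a b a' (b + (a - a')) * X l (b + (a - a')) d b' d'.
Definition qybe_T2 : A := X l b d (b - (d' - d)) d' * X k a (b - (d' - d)) a' b'.
Definition qybe_T3 : A := X k a b (a - (b' - b)) b' * Z (-1) k p (a - (b' - b)) d a' d' b'.
Definition qybe_T4 : A := Z 1 k p a d (a' + (b' - b)) d' b * X k (a' + (b' - b)) b a' b'.
Definition qybe_T5 : A := Z (-1) k p a d a' (d + (a - a')) b * X l b (d + (a - a')) b' d'.
Definition qybe_T6 : A := X l b d b' (d + (b - b')) * Z 1 k p a (d + (b - b')) a' d' b'.
Definition qybe_T7 (b1 : nat) : A := X k a b (a - (b1 - b)) b1 *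
  Z (-1) k p (a - (b1 - b)) d a' (d + (a - (b1 - b) - a')) b1 *
  X l b1 (d + (a - (b1 - b) - a')) b' d'.
Definition qybe_T8 (b1 : nat) : A := X l b d b1 (d + (b - b1)) *
  Z 1 k p a (d + (b - b1)) (a - (d' - (d + (b - b1)))) d' b1 *
  X k (a - (d' - (d + (b - b1)))) b1 a' b'.

(** The situations in which a term can be nonzero. The image under tau ^ k and the interval to which
    tau ^ l applies share their right end in the first, their left end in the second, and both ends
    in the third, where b lies strictly inside. *)
Definition qybe_cfg1 o o' h := im o k a' a b h /\ im o' l b' h d d'.
Definition qybe_cfg2 o o' g := im o k a' a g b' /\ im o' l g b d d'.
Definition qybe_cfg3 g h := [/\ im false k a' a g h, im false l g h d d', (g < b < h)%N & b = b'].

Lemma T0_neq0 : qybe_T0 != 0 -> (exists o o' h, b = b' /\ qybe_cfg1 o o' h) \/ (exists o o' g, b = b' /\ qybe_cfg2 o o' g).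
Proof.
move=> /mul_neq0 [bb /mul_neq0 [/X_neq0 [o /(im_decomp arrP) [o1 [g [h [h1 h2]]]]]]].
have {bb} bb : b = b' by apply/eqP; apply: contraNT bb => /negbTE ->.
rewrite (imfE h1) /= => /mul_neq0 [_ gh].
have [gb|gb] := eqVneq g b.
  by left; exists o1, (o (+) o1), h; split=> //; split; rewrite -?bb -gb.
have [hb|hb] := eqVneq h b.
  by right; exists o1, (o (+) o1), g; split=> //; split; rewrite -?bb -hb.
by move: gh; rewrite (negbTE gb) (negbTE hb) subrr eqxx.
Qed.

Lemma T1_neq0 : qybe_T1 != 0 -> exists o o' h, qybe_cfg1 o o' h.
Proof. by move=> /mul_neq0 [/X_neq0 [o h1] /X_neq0 [o' h2]]; exists o, o', (b + (a - a'))%N. Qed.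

Lemma T2_neq0 : qybe_T2 != 0 -> exists o o' g, qybe_cfg2 o o' g.
Proof. by move=> /mul_neq0 [/X_neq0 [o h1] /X_neq0 [o' h2]]; exists o', o, (b - (d' - d))%N. Qed.

(** The dressed factor belongs to tau ^ (k + l), which factors through an intermediate interval (g,
    h). It is glued to the interval of the other factor by [im_cat], or by [im_cat_inv] in [T5_neq0]
    and [T6_neq0]; the two possible orders of the pieces give the two configurations. *)
Lemma T3_neq0 : qybe_T3 != 0 -> (exists o' h, (b < b')%N /\ qybe_cfg1 true o' h) \/ (exists o' g, (b < b')%N /\ qybe_cfg2 false o' g).
Proof.
move=> /mul_neq0 [/X_neq0 [o h1] /Z_neq0 [o1 [o' [g [h [h2 h3]]]]]].
have [_ _ bb _] := im_lt arrP h1.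
case: (im_cat arrP h2 h1) => -[h4 E]; subst.
- by right; exists o', g; split=> //; split.
- by left; exists o', h; split=> //; split.
Qed.

Lemma T4_neq0 : qybe_T4 != 0 -> (exists o' h, (b < b')%N /\ qybe_cfg1 false o' h) \/ (exists o' g, (b < b')%N /\ qybe_cfg2 true o' g).
Proof.
move=> /mul_neq0 [/Z_neq0 [o1 [o' [g [h [h2 h3]]]]] /X_neq0 [o h1]].
have [_ _ bb _] := im_lt arrP h1.
case: (im_cat arrP h1 h2) => -[h4 E]; subst.
- by left; exists o', h; split=> //; split.
- by right; exists o', g; split=> //; split.
Qed.

Lemma T5_neq0 : qybe_T5 != 0 -> (exists o h, (b' < b)%N /\ qybe_cfg1 o true h) \/ (exists o g, (b' < b)%N /\ qybe_cfg2 o false g).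
Proof.
move=> /mul_neq0 [/Z_neq0 [o1 [o' [g [h [h2 h3]]]]] /X_neq0 [o h1]].
have [bb _ _ _] := im_lt arrP h1.
case: (im_cat_inv arrP h3 h1) => -[h4 E]; subst.
- by right; exists o1, g; split=> //; split.
- by left; exists o1, h; split=> //; split.
Qed.

Lemma T6_neq0 : qybe_T6 != 0 -> (exists o h, (b' < b)%N /\ qybe_cfg1 o false h) \/ (exists o g, (b' < b)%N /\ qybe_cfg2 o true g).
Proof.
move=> /mul_neq0 [/X_neq0 [o h1] /Z_neq0 [o1 [o' [g [h [h2 h3]]]]]].
have [bb _ _ _] := im_lt arrP h1.
case: (im_cat_inv arrP h1 h3) => -[h4 E]; subst.
- by left; exists o1, h; split=> //; split.
- by right; exists o1, g; split=> //; split.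
Qed.

Lemma T7_neq0 b1 : qybe_T7 b1 != 0 -> (exists h, qybe_cfg1 true true h /\ (maxn b b' < b1 < h)%N) \/
  (exists g, qybe_cfg3 g b1).
Proof.
move=> /mul_neq0 [/mul_neq0 [/X_neq0 [o h1] /Z_neq0 [o1 [o' [g [h [h2 h3]]]]]] /X_neq0 [o4 h4]].
have [_ _ bb1 _] := im_lt arrP h1; have [b'b1 _ _ _] := im_lt arrP h4.
have [_ _ gh _] := im_lt arrP h2.
case: (im_cat arrP h2 h1) => -[h5 E]; case: (im_cat_inv arrP h3 h4) => -[h6 E']; subst.
- by right; exists g; split=> //; lia.
- by exfalso; lia.
- by exfalso; lia.
- by left; exists h; split; [split|lia].
Qed.

Lemma T8_neq0 b1 : qybe_T8 b1 != 0 -> (exists g, qybe_cfg2 true true g /\ (g < b1 < minn b b')%N) \/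
  (exists h, qybe_cfg3 b1 h).
Proof.
move=> /mul_neq0 [/mul_neq0 [/X_neq0 [o h1] /Z_neq0 [o1 [o' [g [h [h2 h3]]]]]] /X_neq0 [o4 h4]].
have [b1b _ _ _] := im_lt arrP h1; have [_ _ b1b' _] := im_lt arrP h4.
have [_ _ gh _] := im_lt arrP h2.
case: (im_cat arrP h4 h2) => -[h5 E]; case: (im_cat_inv arrP h1 h3) => -[h6 E']; subst.
- by right; exists h; split=> //; lia.
- by exfalso; lia.
- by exfalso; lia.
- by left; exists g; split; [split|lia].
Qed.

Lemma cfg12 o1 o1' o2 o2' h g : qybe_cfg1 o1 o1' h -> qybe_cfg2 o2 o2' g -> False.
Proof.
move=> [h1 _] [h2 h3]; have [E _] := im_fun arrP h1 h2.
by have [gb _ _ _] := im_lt arrP h3; lia.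
Qed.

Lemma cfg13 o1 o1' h g h' : qybe_cfg1 o1 o1' h -> qybe_cfg3 g h' -> False.
Proof. by move=> [h1 _] [h2 _ gb _]; have [E _] := im_fun arrP h1 h2; lia. Qed.

Lemma cfg23 o1 o1' h g h' : qybe_cfg2 o1 o1' h -> qybe_cfg3 g h' -> False.
Proof. by move=> [h1 _] [h2 _ gb bb]; have [_ E] := im_fun arrP h1 h2; lia. Qed.

End Terms.

Lemma subF q i j u v i' j' u' v' : im false q i j u v -> (i <= i' < j')%N -> (j' <= j)%N ->
  u' = (u + (i' - i))%N -> v' = (u + (j' - i))%N -> im false q i' j' u' v'.
Proof. by move=> h /andP [h1 h2] h3 -> ->; apply: im_subF h _ _ _. Qed.

Lemma subT q i j u v i' j' u' v' : im true q i j u v -> (i <= i' < j')%N -> (j' <= j)%N ->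
  u' = (v - (j' - i))%N -> v' = (v - (i' - i))%N -> im true q i' j' u' v'.
Proof. by move=> h /andP [h1 h2] h3 -> ->; apply: im_subT h _ _ _. Qed.

Lemma compE o o' o'' q r i j u v u' v' : im o q i j u v -> im o' r u v u' v' ->
  o'' = o (+) o' -> im o'' (q + r) i j u' v'.
Proof. by move=> h h' ->; apply: im_comp h h'. Qed.

Lemma ipvE i j v (x y : bool) : (i == v) = x -> (j == v) = y -> ip_root_vec K i j v = x%:R - y%:R.
Proof. by rewrite /ip_root_vec => -> ->. Qed.

Lemma qpN1 : qp (-1) = - e. Proof. by rewrite opprK. Qed.

Section Values1.
Context (k l a b d a' b' d' h : nat) (o o' : bool).
Context (hk : im o k a' a b h) (hl : im o' l b' h d d').
Let Q : K := s a' a + s b h + s b' h + s d d'.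
Local Notation x := (h - b)%N.
Local Notation z := (h - b')%N.
Local Notation D := ((b' - b) + (b - b'))%N.

Let lenk : [/\ (a' < a)%N, (b < h)%N & (h - b = a - a')%N].
Proof. by have [? E _] := hk; split=> //; lia. Qed.
Let lenl : [/\ (b' < h)%N, (d < d')%N & (h - b' = d' - d)%N].
Proof. by have [? E _] := hl; split=> //; lia. Qed.

(** In the first configuration every term is [qp Q] times a signed power of - q ^ -1. That the
    exponents agree in the terms with a cut interval is [s_catF] or [s_catT], according to the
    orientation of the interval that is cut. *)
Lemma T1v : qybe_T1 k l a b d a' b' d' = orient_w o x * orient_w o' z * qp Q.
Proof.
have [k1 k2 k3] := lenk; have [l1 l2 l3] := lenl.
rewrite /qybe_T1 -k3 (subnKC (ltnW k2)) (XE hk) (XE hl) /hop_w -k3.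
have -> : Q = (s a' a + s b h) + (s b' h + s d d') by rewrite /Q; ring.
by rewrite !qpD; ring.
Qed.

Lemma T3v : o = true -> (b < b')%N -> qybe_T3 k l a b d a' b' d' = - (e ^+ D * orient_w (~~ o') z * qp Q).
Proof.
have [k1 k2 k3] := lenk; have [l1 l2 l3] := lenl; move=> oE bb; subst o.
pose a1 := (a - (b' - b))%N.
have h1 : im true k a1 a b b' by apply: (subT hk); rewrite /a1; lia.
have h2 : im true k a' a1 b' h by apply: (subT hk); rewrite /a1; lia.
have h3 : im (~~ o') (k + l) a' a1 d d' by apply: (compE h2 hl).
rewrite /qybe_T3 -/a1 (XE h1) (ZE _ _ _ _ _ h2) (XE h3) /hop_w /dressing (ipvE (x := true) (y := false)); [|lia..].
have cc := s_catT arrP sP hk (m := a1) (w := b') _ _.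
have {}cc : s a' a - s a' a1 - s a1 a = - (s b h - s b b' - s b' h).
  by apply: cc; rewrite /a1; lia.
have -> : Q = (s a1 a + s b b') + (s a' a1 + s d d') + (s b' b' - s h b') *+ 2.
  rewrite (s_diag sP) (s_skew sP h b') /Q.
  by rewrite -[s a' a](subrK (s a' a1)) -[s a' a - _](subrK (s a1 a)) cc; ring.
have -> : orient_w true (a - a1) = e ^+ (b' - b).-1 by rewrite /orient_w /a1; congr (_ ^+ _); lia.
have -> : e ^+ D = e ^+ (b' - b).-1 * e by rewrite -exprSr; congr (_ ^+ _); lia.
have -> : (a1 - a' = h - b')%N by rewrite /a1; lia.
have -> : (s b' b' - s h b') *+ 2 + -1 * (true%:R - false%:R) = (s b' b' - s h b') *+ 2 + -1 by rewrite /= subr0 mulr1.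
by rewrite !qpD qpN1; ring.
Qed.

Lemma T4v : o = false -> (b < b')%N -> qybe_T4 k l a b d a' b' d' = orient_w o' z * qp Q.
Proof.
have [k1 k2 k3] := lenk; have [l1 l2 l3] := lenl; move=> oE bb; subst o.
pose a1 := (a' + (b' - b))%N.
have h1 : im false k a' a1 b b' by apply: (subF hk); rewrite /a1; lia.
have h2 : im false k a1 a b' h by apply: (subF hk); rewrite /a1; lia.
have h3 : im o' (k + l) a1 a d d' by apply: (compE h2 hl).
rewrite /qybe_T4 -/a1 (XE h1) (ZE _ _ _ _ _ h2) (XE h3) /hop_w /dressing (ipvE (x := false) (y := false)); [|lia..].
have cc := s_catF arrP sP hk (m := a1) (w := b') _ _.
have {}cc : s a' a - s a' a1 - s a1 a = (s b h - s b b' - s b' h).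
  by apply: cc; rewrite /a1; lia.
have -> : Q = (s a' a1 + s b b') + (s a1 a + s d d') + (s b' b - s h b) *+ 2.
  rewrite (s_skew sP h b) (s_skew sP b' b) /Q.
  by rewrite -[s a' a](subrK (s a' a1)) -[s a' a - _](subrK (s a1 a)) cc; ring.
have -> : (a - a1 = h - b')%N by rewrite /a1; lia.
by rewrite subrr mulr0 addr0 !qpD /orient_w; ring.
Qed.

Lemma T5v : o' = true -> (b' < b)%N -> qybe_T5 k l a b d a' b' d' = - (e ^+ D * orient_w (~~ o) x * qp Q).
Proof.
have [k1 k2 k3] := lenk; have [l1 l2 l3] := lenl; move=> oE bb; subst o'.
pose d1 := (d + (a - a'))%N.
have h1 : im true l b' b d1 d' by apply: (subT hl); rewrite /d1; lia.
have h2 : im true l b h d d1 by apply: (subT hl); rewrite /d1; lia.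
have h3 : im (~~ o) (k + l) a' a d d1 by apply: (compE hk h2); rewrite addbT.
rewrite /qybe_T5 -/d1 (XE h1) (ZE _ _ _ _ _ hk) (XE h3) /hop_w /dressing (ipvE (x := true) (y := false)); [|lia..].
have cc := s_catT arrP sP hl (m := b) (w := d1) _ _.
have {}cc : s b' h - s b' b - s b h = - (s d d' - s d d1 - s d1 d').
  by apply: cc; rewrite /d1; lia.
have -> : Q = (s b' b + s d1 d') + (s a' a + s d d1) + (s b b - s h b) *+ 2.
  rewrite (s_diag sP) (s_skew sP h b) /Q.
  by rewrite -[s b' h](subrK (s b' b)) -[s b' h - _](subrK (s b h)) cc; ring.
have -> : orient_w true (b - b') = e ^+ (b - b').-1 by [].
have -> : e ^+ D = e ^+ (b - b').-1 * e by rewrite -exprSr; congr (_ ^+ _); lia.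
rewrite -k3.
have -> : (s b b - s h b) *+ 2 + -1 * (true%:R - false%:R) = (s b b - s h b) *+ 2 + -1 by rewrite /= subr0 mulr1.
by rewrite !qpD qpN1; ring.
Qed.

Lemma T6v : o' = false -> (b' < b)%N -> qybe_T6 k l a b d a' b' d' = orient_w o x * qp Q.
Proof.
have [k1 k2 k3] := lenk; have [l1 l2 l3] := lenl; move=> oE bb; subst o'.
pose d1 := (d + (b - b'))%N.
have h1 : im false l b' b d d1 by apply: (subF hl); rewrite /d1; lia.
have h2 : im false l b h d1 d' by apply: (subF hl); rewrite /d1; lia.
have h3 : im o (k + l) a' a d1 d' by apply: (compE hk h2); rewrite addbF.
rewrite /qybe_T6 -/d1 (XE h1) (ZE _ _ _ _ _ hk) (XE h3) /hop_w /dressing (ipvE (x := false) (y := false)); [|lia..].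
have cc := s_catF arrP sP hl (m := b) (w := d1) _ _.
have {}cc : s b' h - s b' b - s b h = (s d d' - s d d1 - s d1 d').
  by apply: cc; rewrite /d1; lia.
have -> : Q = (s b' b + s d d1) + (s a' a + s d1 d') + (s b b' - s h b') *+ 2.
  have -> : s d d1 = s d d' - s d1 d' - (s b' h - s b' b - s b h) by rewrite cc; ring.
  by rewrite (s_skew sP b b') (s_skew sP h b') /Q; ring.
by rewrite subrr mulr0 addr0 -k3 !qpD /orient_w; ring.
Qed.

Lemma T0v : b = b' -> qybe_T0 k l a b d a' b' d' = - (orient_w (o (+) o') x * qp Q).
Proof.
have [k1 k2 k3] := lenk; have [l1 l2 l3] := lenl; move=> bb; subst b'.
have h3 : im (o (+) o') (k + l) a' a d d' by apply: (compE hk hl).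
rewrite /qybe_T0 eqxx (imfE hk) (XE h3) /hop_w /= eqxx.
have -> : (h == b) = false by lia.
have -> : Q = (s a' a + s d d') + (s b b - s h b) *+ 2.
  by rewrite (s_diag sP) (s_skew sP h b) /Q; ring.
by rewrite -k3 mulr1n mulr0n !qpD; ring.
Qed.

(** The exponent of - q ^ -1 increases by 2 with b1, so the sum over b1 is the series of [geom]. *)
Lemma T7v b1 : o = true -> o' = true -> (maxn b b' < b1 < h)%N ->
  qybe_T7 k l a b d a' b' d' b1 = - (e ^+ (2 * (b1 - (maxn b b').+1) + D).+1 * qp Q).
Proof.
have [k1 k2 k3] := lenk; have [l1 l2 l3] := lenl; move=> oE oE' b1h; subst o o'.
pose a1 := (a - (b1 - b))%N; pose d1 := (d + (a1 - a'))%N.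
have h1 : im true k a1 a b b1 by apply: (subT hk); rewrite /a1; lia.
have h2 : im true k a' a1 b1 h by apply: (subT hk); rewrite /a1; lia.
have h3 : im true l b1 h d d1 by apply: (subT hl); rewrite /d1 /a1; lia.
have h4 : im true l b' b1 d1 d' by apply: (subT hl); rewrite /d1 /a1; lia.
have h5 : im false (k + l) a' a1 d d1 by apply: (compE h2 h3).
rewrite /qybe_T7 -/a1 -/d1 (XE h1) (ZE _ _ _ _ _ h2) (XE h5) (XE h4) /hop_w /dressing.
rewrite (ipvE (x := true) (y := false)); [|lia..].
have cc := s_catT arrP sP hk (m := a1) (w := b1) _ _.
have {}cc : s a' a - s a' a1 - s a1 a = - (s b h - s b b1 - s b1 h).
  by apply: cc; rewrite /a1; lia.
have cc' := s_catT arrP sP hl (m := b1) (w := d1) _ _.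
have {}cc' : s b' h - s b' b1 - s b1 h = - (s d d' - s d d1 - s d1 d').
  by apply: cc'; rewrite /d1 /a1; lia.
have -> : Q = (s a1 a + s b b1) + (s a' a1 + s d d1) + (s b1 b1 - s h b1) *+ 2 + (s b' b1 + s d1 d').
  have -> : s d d1 = s d d' - s d1 d' + (s b' h - s b' b1 - s b1 h) by rewrite cc'; ring.
  have -> : s a1 a = s a' a - s a' a1 + (s b h - s b b1 - s b1 h).
    by apply: (addrI (s a' a - s a' a1 - s a1 a)); rewrite {2}cc; ring.
  by rewrite (s_diag sP) (s_skew sP h b1) /Q; ring.
have -> : orient_w true (a - a1) = e ^+ (b1 - b).-1 by rewrite /orient_w /a1; congr (_ ^+ _); lia.
have -> : orient_w true (b1 - b') = e ^+ (b1 - b').-1 by [].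
have -> : e ^+ (2 * (b1 - (maxn b b').+1) + D).+1 = e ^+ (b1 - b).-1 * e ^+ (b1 - b').-1 * e.
  by rewrite -exprD -exprSr; congr (_ ^+ _); lia.
have -> : (s b1 b1 - s h b1) *+ 2 + -1 * (true%:R - false%:R) = (s b1 b1 - s h b1) *+ 2 + -1 by rewrite /= subr0 mulr1.
by rewrite !qpD qpN1 /orient_w; ring.
Qed.

End Values1.

Section Values2.
Context (k l a b d a' b' d' g : nat) (o o' : bool).
Context (hk : im o k a' a g b') (hl : im o' l g b d d').
Let Q : K := s a' a + s g b' + s g b + s d d'.
Local Notation x := (b' - g)%N.
Local Notation z := (b - g)%N.
Local Notation D := ((b' - b) + (b - b'))%N.

Let lenk : [/\ (a' < a)%N, (g < b')%N & (b' - g = a - a')%N].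
Proof. by have [? E _] := hk; split=> //; lia. Qed.
Let lenl : [/\ (g < b)%N, (d < d')%N & (b - g = d' - d)%N].
Proof. by have [? E _] := hl; split=> //; lia. Qed.

Lemma T2v : qybe_T2 k l a b d a' b' d' = orient_w o x * orient_w o' z * qp Q.
Proof.
have [k1 k2 k3] := lenk; have [l1 l2 l3] := lenl.
rewrite /qybe_T2 (_ : b - (d' - d) = g)%N; last by lia.
rewrite (XE hk) (XE hl) /hop_w -k3.
have -> : Q = (s a' a + s g b') + (s g b + s d d') by rewrite /Q; ring.
by rewrite !qpD; ring.
Qed.

Lemma T3w : o = false -> (b < b')%N -> qybe_T3 k l a b d a' b' d' = orient_w o' z * qp Q.
Proof.
have [k1 k2 k3] := lenk; have [l1 l2 l3] := lenl; move=> oE bb; subst o.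
pose a1 := (a - (b' - b))%N.
have h1 : im false k a1 a b b' by apply: (subF hk); rewrite /a1; lia.
have h2 : im false k a' a1 g b by apply: (subF hk); rewrite /a1; lia.
have h3 : im o' (k + l) a' a1 d d' by apply: (compE h2 hl).
rewrite /qybe_T3 -/a1 (XE h1) (ZE _ _ _ _ _ h2) (XE h3) /hop_w /dressing (ipvE (x := false) (y := false)); [|lia..].
have cc := s_catF arrP sP hk (m := a1) (w := b) _ _.
have {}cc : s a' a - s a' a1 - s a1 a = (s g b' - s g b - s b b').
  by apply: cc; rewrite /a1; lia.
have -> : Q = (s a1 a + s b b') + (s a' a1 + s d d') + (s g b' - s b b') *+ 2.
  by rewrite /Q -[s a' a](subrK (s a' a1)) -[s a' a - _](subrK (s a1 a)) cc; ring.
have -> : (a1 - a' = b - g)%N by rewrite /a1; lia.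
by rewrite subrr mulr0 addr0 !qpD /orient_w; ring.
Qed.

Lemma T4w : o = true -> (b < b')%N -> qybe_T4 k l a b d a' b' d' = - (e ^+ D * orient_w (~~ o') z * qp Q).
Proof.
have [k1 k2 k3] := lenk; have [l1 l2 l3] := lenl; move=> oE bb; subst o.
pose a1 := (a' + (b' - b))%N.
have h1 : im true k a' a1 b b' by apply: (subT hk); rewrite /a1; lia.
have h2 : im true k a1 a g b by apply: (subT hk); rewrite /a1; lia.
have h3 : im (~~ o') (k + l) a1 a d d' by apply: (compE h2 hl).
rewrite /qybe_T4 -/a1 (XE h1) (ZE _ _ _ _ _ h2) (XE h3) /hop_w /dressing (ipvE (x := false) (y := true)); [|lia..].
have cc := s_catT arrP sP hk (m := a1) (w := b) _ _.
have {}cc : s a' a - s a' a1 - s a1 a = - (s g b' - s g b - s b b').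
  by apply: cc; rewrite /a1; lia.
have -> : Q = (s a' a1 + s b b') + (s a1 a + s d d') + (s g b - s b b) *+ 2.
  by rewrite (s_diag sP) /Q -[s a' a](subrK (s a' a1)) -[s a' a - _](subrK (s a1 a)) cc; ring.
have -> : orient_w true (a1 - a') = e ^+ (b' - b).-1 by rewrite /orient_w /a1; congr (_ ^+ _); lia.
have -> : e ^+ D = e ^+ (b' - b).-1 * e by rewrite -exprSr; congr (_ ^+ _); lia.
have -> : (a - a1 = b - g)%N by rewrite /a1; lia.
have -> : (s g b - s b b) *+ 2 + 1 * (false%:R - true%:R) = (s g b - s b b) *+ 2 + -1 by rewrite /= sub0r mul1r.
by rewrite !qpD qpN1; ring.
Qed.

Lemma T5w : o' = false -> (b' < b)%N -> qybe_T5 k l a b d a' b' d' = orient_w o x * qp Q.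
Proof.
have [k1 k2 k3] := lenk; have [l1 l2 l3] := lenl; move=> oE bb; subst o'.
pose d1 := (d + (a - a'))%N.
have h1 : im false l b' b d1 d' by apply: (subF hl); rewrite /d1; lia.
have h2 : im false l g b' d d1 by apply: (subF hl); rewrite /d1; lia.
have h3 : im o (k + l) a' a d d1 by apply: (compE hk h2); rewrite addbF.
rewrite /qybe_T5 -/d1 (XE h1) (ZE _ _ _ _ _ hk) (XE h3) /hop_w /dressing (ipvE (x := false) (y := false)); [|lia..].
have cc := s_catF arrP sP hl (m := b') (w := d1) _ _.
have {}cc : s g b - s g b' - s b' b = (s d d' - s d d1 - s d1 d').
  by apply: cc; rewrite /d1; lia.
have -> : Q = (s b' b + s d1 d') + (s a' a + s d d1) + (s g b - s b' b) *+ 2.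
  have -> : s d d1 = s d d' - s d1 d' - (s g b - s g b' - s b' b) by rewrite cc; ring.
  by rewrite /Q; ring.
by rewrite subrr mulr0 addr0 -k3 !qpD /orient_w; ring.
Qed.

Lemma T6w : o' = true -> (b' < b)%N -> qybe_T6 k l a b d a' b' d' = - (e ^+ D * orient_w (~~ o) x * qp Q).
Proof.
have [k1 k2 k3] := lenk; have [l1 l2 l3] := lenl; move=> oE bb; subst o'.
pose d1 := (d + (b - b'))%N.
have h1 : im true l b' b d d1 by apply: (subT hl); rewrite /d1; lia.
have h2 : im true l g b' d1 d' by apply: (subT hl); rewrite /d1; lia.
have h3 : im (~~ o) (k + l) a' a d1 d' by apply: (compE hk h2); rewrite addbT.
rewrite /qybe_T6 -/d1 (XE h1) (ZE _ _ _ _ _ hk) (XE h3) /hop_w /dressing (ipvE (x := false) (y := true)); [|lia..].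
have cc := s_catT arrP sP hl (m := b') (w := d1) _ _.
have {}cc : s g b - s g b' - s b' b = - (s d d' - s d d1 - s d1 d').
  by apply: cc; rewrite /d1; lia.
have -> : Q = (s b' b + s d d1) + (s a' a + s d1 d') + (s g b' - s b' b') *+ 2.
  have -> : s d d1 = s d d' - s d1 d' + (s g b - s g b' - s b' b) by rewrite cc; ring.
  by rewrite (s_diag sP) /Q; ring.
have -> : orient_w true (b - b') = e ^+ (b - b').-1 by [].
have -> : e ^+ D = e ^+ (b - b').-1 * e by rewrite -exprSr; congr (_ ^+ _); lia.
have -> : (s g b' - s b' b') *+ 2 + 1 * (false%:R - true%:R) = (s g b' - s b' b') *+ 2 + -1 by rewrite /= sub0r mul1r.
by rewrite -k3 !qpD qpN1; ring.
Qed.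

Lemma T0w : b = b' -> qybe_T0 k l a b d a' b' d' = orient_w (o (+) o') x * qp Q.
Proof.
have [k1 k2 k3] := lenk; have [l1 l2 l3] := lenl; move=> bb; subst b'.
have h3 : im (o (+) o') (k + l) a' a d d' by apply: (compE hk hl).
rewrite /qybe_T0 eqxx (imfE hk) (XE h3) /hop_w /= eqxx.
have -> : (g == b) = false by lia.
have -> : Q = (s a' a + s d d') + (s g b - s b b) *+ 2.
  by rewrite (s_diag sP) /Q; ring.
by rewrite -k3 mulr1n mulr0n !qpD; ring.
Qed.

Lemma T8v b1 : o = true -> o' = true -> (g < b1 < minn b b')%N ->
  qybe_T8 k l a b d a' b' d' b1 = - (e ^+ (2 * ((minn b b').-1 - b1) + D).+1 * qp Q).
Proof.
have [k1 k2 k3] := lenk; have [l1 l2 l3] := lenl; move=> oE oE' b1h; subst o o'.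
pose d1 := (d + (b - b1))%N; pose a1 := (a - (d' - d1))%N.
have h1 : im true k a' a1 b1 b' by apply: (subT hk); rewrite /a1 /d1; lia.
have h2 : im true k a1 a g b1 by apply: (subT hk); rewrite /a1 /d1; lia.
have h3 : im true l g b1 d1 d' by apply: (subT hl); rewrite /d1 /a1; lia.
have h4 : im true l b1 b d d1 by apply: (subT hl); rewrite /d1 /a1; lia.
have h5 : im false (k + l) a1 a d1 d' by apply: (compE h2 h3).
rewrite /qybe_T8 -/d1 -/a1 (XE h1) (ZE _ _ _ _ _ h2) (XE h5) (XE h4) /hop_w /dressing.
rewrite (ipvE (x := false) (y := true)); [|lia..].
have cc := s_catT arrP sP hk (m := a1) (w := b1) _ _.
have {}cc : s a' a - s a' a1 - s a1 a = - (s g b' - s g b1 - s b1 b').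
  by apply: cc; rewrite /a1 /d1; lia.
have cc' := s_catT arrP sP hl (m := b1) (w := d1) _ _.
have {}cc' : s g b - s g b1 - s b1 b = - (s d d' - s d d1 - s d1 d').
  by apply: cc'; rewrite /d1 /a1; lia.
have -> : Q = (s b1 b + s d d1) + (s a1 a + s d1 d') + (s g b1 - s b1 b1) *+ 2 + (s a' a1 + s b1 b').
  have -> : s d d1 = s d d' - s d1 d' + (s g b - s g b1 - s b1 b) by rewrite cc'; ring.
  have -> : s a1 a = s a' a - s a' a1 + (s g b' - s g b1 - s b1 b').
    by apply: (addrI (s a' a - s a' a1 - s a1 a)); rewrite {2}cc; ring.
  by rewrite (s_diag sP) /Q; ring.
have -> : orient_w true (b - b1) = e ^+ (b - b1).-1 by [].
have -> : orient_w true (a1 - a') = e ^+ (b' - b1).-1 by rewrite /orient_w /a1 /d1; congr (_ ^+ _); lia.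
have -> : e ^+ (2 * ((minn b b').-1 - b1) + D).+1 = e ^+ (b - b1).-1 * e ^+ (b' - b1).-1 * e.
  by rewrite -exprD -exprSr; congr (_ ^+ _); lia.
have -> : (s g b1 - s b1 b1) *+ 2 + 1 * (false%:R - true%:R) = (s g b1 - s b1 b1) *+ 2 + -1 by rewrite /= sub0r mul1r.
by rewrite !qpD qpN1 /orient_w; ring.
Qed.

End Values2.

(** In the third configuration both products cut the two intervals at b and use the same four
    pieces, so they differ only in the distribution of the dressing. *)
Lemma T78v k l a b d a' b' d' g h : qybe_cfg3 k l a b d a' b' d' g h ->
  qybe_T7 k l a b d a' b' d' h = qybe_T8 k l a b d a' b' d' g.
Proof.
case=> hk hl gbh bb; subst b'.
have [k1 k2 _] := hk; have [l1 l2 _] := hl.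
pose a1 := (a - (h - b))%N; pose d1 := (d + (b - g))%N.
have h1 : im false k a1 a b h by apply: (subF hk); rewrite /a1; lia.
have h2 : im false k a' a1 g b by apply: (subF hk); rewrite /a1; lia.
have h3 : im false l g b d d1 by apply: (subF hl); rewrite /d1; lia.
have h4 : im false l b h d1 d' by apply: (subF hl); rewrite /d1; lia.
have h5 : im false (k + l) a' a1 d d1 by apply: (compE h2 h3).
have h6 : im false (k + l) a1 a d1 d' by apply: (compE h1 h4).
rewrite /qybe_T7 /qybe_T8 -/a1 -/d1 (_ : (a - (d' - d1))%N = a1); last by rewrite /d1 /a1; lia.
rewrite (_ : (d + (a1 - a'))%N = d1); last by rewrite /d1 /a1; lia.
rewrite (XE h1) (XE h2) (XE h3) (XE h4) (ZE _ _ _ _ _ h2) (ZE _ _ _ _ _ h1) (XE h5) (XE h6).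
rewrite /hop_w /orient_w /dressing !(ipvE (x := false) (y := false)); [|lia..].
rewrite subrr !mulr0 !addr0 !mul1r -!qpD; congr (qp _).
by rewrite (s_skew sP b g) (s_skew sP h g); ring.
Qed.

Lemma sum_range (F : nat -> A) (lo hi : nat) : (hi <= n)%N ->
  (forall x, F x != 0 -> (lo < x < hi)%N) ->
  \sum_(x < n) F x = \sum_(t < hi - lo.+1) F (lo.+1 + t)%N.
Proof.
move=> hin F0; rewrite -(big_mkord xpredT) /=.
have Z0 x : ~~ (lo < x < hi)%N -> F x = 0.
  by move=> nx; apply/eqP; apply: contraNT nx => /F0.
have [lohi|hilo] := ltnP lo hi; last first.
  have -> : (hi - lo.+1 = 0)%N by lia.
  by rewrite big_ord0 big1 // => x _; apply: Z0; lia.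
rewrite (big_cat_nat (n := hi)) //= [X in _ + X]big_nat_cond [X in _ + X]big1 ?addr0; last first.
  by move=> x /andP [xi _]; apply: Z0; lia.
rewrite (big_cat_nat (n := lo.+1)) //= [X in X + _]big_nat_cond [X in X + _]big1 ?add0r; last first.
  by move=> x /andP [xi _]; apply: Z0; lia.
rewrite -{1}[lo.+1]add0n big_addn big_mkord; apply: eq_bigr => t _.
by rewrite addnC.
Qed.

(** The three configurations exclude each other. In the first two, if both powers reverse, the
    product of two hops is balanced by the geometric sum of triple products together with one
    boundary term, chosen by the sign of b - b'. If not both reverse, the triple products vanish and
    two terms cancel. In the third only one summand of each triple product remains, and they cancel
    by [T78v]. *)
Lemma qybe_kernel k l a b d a' b' d' :
  qybe_T0 k l a b d a' b' d' + qybe_T1 k l a b d a' b' d' - qybe_T2 k l a b d a' b' d'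
  + qybe_T3 k l a b d a' b' d' - qybe_T4 k l a b d a' b' d' + qybe_T5 k l a b d a' b' d'
  - qybe_T6 k l a b d a' b' d'
  + c * (\sum_(b1 < n) qybe_T7 k l a b d a' b' d' b1 - \sum_(b1 < n) qybe_T8 k l a b d a' b' d' b1) = 0.
Proof.
set t0 := qybe_T0 _ _ _ _ _ _ _ _; set t1 := qybe_T1 _ _ _ _ _ _ _ _; set t2 := qybe_T2 _ _ _ _ _ _ _ _.
set t3 := qybe_T3 _ _ _ _ _ _ _ _; set t4 := qybe_T4 _ _ _ _ _ _ _ _; set t5 := qybe_T5 _ _ _ _ _ _ _ _.
set t6 := qybe_T6 _ _ _ _ _ _ _ _.
have [[o [o' [h [hk hl]]]]|n1] := pselect (exists o o' h, qybe_cfg1 k l a b d a' b' d' o o' h).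
  have c1 : qybe_cfg1 k l a b d a' b' d' o o' h by split.
  have no2 : forall o o' g, ~ qybe_cfg2 k l a b d a' b' d' o o' g by move=> ? ? ? /(cfg12 c1).
  have [_ _ bh hn] := im_lt arrP hk; have [b'h _ _ _] := im_lt arrP hl.
  have [aa hE _] := hk; have [_ dE _] := hl.
  have z2 : t2 = 0 by apply/eqP; apply: contraT => /T2_neq0 [? [? [? /no2]]].
  have z8 : \sum_(b1 < n) qybe_T8 k l a b d a' b' d' b1 = 0.
    apply: big1 => b1 _; apply/eqP; apply: contraT => /T8_neq0 [[? [/no2 //]]|[? /(cfg13 c1) //]].
  rewrite z2 z8 !subr0.
  have v1 := T1v hk hl; rewrite -/t1 in v1; rewrite {}v1.
  (* Triple products need both powers to reverse; b1 then runs over the points strictly between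
     [maxn b b'] and h. *)
  have s7 : c * \sum_(b1 < n) qybe_T7 k l a b d a' b' d' b1 =
     - ((o && o')%:R * e ^+ (b' - b + (b - b')) * (e ^+ (2 * (h - (maxn b b').+1)) - 1)
          * qp (s a' a + s b h + s b' h + s d d')).
    case: (boolP (o && o')) => [/andP [oE oE']|noo]; last first.
      rewrite big1 ?mulr0 ?mul0r ?oppr0 // => b1 _; apply/eqP; apply: contraT.
      case/T7_neq0 => [[h1 [[h2 h3] h4]]|[? /(cfg13 c1) //]]; move: noo.
      have [_ hh] := im_fun arrP hk h2; rewrite -hh in h2 h3 h4.
      by rewrite (im_or arrP _ hk h2) ?(im_or arrP _ hl h3) //; lia.
    rewrite (sum_range (lo := maxn b b') (hi := h)) //; first last.
    - move=> b1 /T7_neq0 [[h1 [[h2 _] h4]]|[? /(cfg13 c1) //]].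
      by have [_ <-] := im_fun arrP h2 hk.
    - exact: ltnW.
    rewrite -geom mulr_sumr mulr_sumr mulr_sumr mulr_suml -sumrN.
    apply: eq_bigr => t _; have tl := ltn_ord t.
    rewrite (T7v hk hl oE oE'); last by lia.
    rewrite (_ : ((maxn b b').+1 + t - (maxn b b').+1 = t)%N); last by lia.
    by rewrite -addnS exprD exprS /=; ring.
  rewrite {}s7; have [bb|bb|bb] := ltngtP b b'.
  - have z0 : t0 = 0 by rewrite /t0 /qybe_T0 (_ : (b == b') = false) ?mul0r //; lia.
    have z5 : t5 = 0.
      by apply/eqP; apply: contraT => /T5_neq0 [] [? [? [? _]]]; lia.
    have z6 : t6 = 0.
      by apply/eqP; apply: contraT => /T6_neq0 [] [? [? [? _]]]; lia.
    rewrite z0 z5 z6; have [oE|oE] := boolP o.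
    + have z4 : t4 = 0.
        apply/eqP; apply: contraT => /T4_neq0 [[? [? [? [h1 _]]]]|[? [? [_ /no2 //]]]].
        have aa1 : (a'.+1 < a)%N by lia.
        by have := im_or arrP aa1 hk h1; rewrite oE.
      rewrite z4 /t3 (T3v hk hl) //; case: (o') => /=.
      * rewrite ?oE /orient_w -exprD.
        have -> : ((h - b).-1 + (h - b').-1 = (b' - b + (b - b')) + 2 * (h - b'.+1))%N by lia.
        by rewrite exprD mulr1n; ring.
      * rewrite ?oE /orient_w -exprD.
        have -> : ((b' - b + (b - b')) + (h - b').-1 = (h - b).-1)%N by lia.
        by rewrite /= mulr0n; ring.
    + have {}oE := negbTE oE.
      have z3 : t3 = 0.
        apply/eqP; apply: contraT => /T3_neq0 [[? [? [? [h1 _]]]]|[? [? [_ /no2 //]]]].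
        have aa1 : (a'.+1 < a)%N by lia.
        by have := im_or arrP aa1 hk h1; rewrite oE.
      by rewrite z3 /t4 (T4v hk hl) // ?oE /= mulr0n /orient_w; ring.
  - have z0 : t0 = 0 by rewrite /t0 /qybe_T0 (_ : (b == b') = false) ?mul0r //; lia.
    have z3 : t3 = 0.
      by apply/eqP; apply: contraT => /T3_neq0 [] [? [? [? _]]]; lia.
    have z4 : t4 = 0.
      by apply/eqP; apply: contraT => /T4_neq0 [] [? [? [? _]]]; lia.
    rewrite z0 z3 z4; have [oE|oE] := boolP o'.
    + have z6 : t6 = 0.
        apply/eqP; apply: contraT => /T6_neq0 [[? [? [? [h0 h1]]]]|[? [? [_ /no2 //]]]].
        have [_ hh] := im_fun arrP hk h0; rewrite -hh in h1.
        have aa1 : (b'.+1 < h)%N by lia.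
        by have := im_or arrP aa1 hl h1; rewrite oE.
      rewrite z6 /t5 (T5v hk hl) //; case: (o) => /=.
      * rewrite ?oE /orient_w -exprD.
        have -> : ((h - b).-1 + (h - b').-1 = (b' - b + (b - b')) + 2 * (h - b.+1))%N by lia.
        by rewrite exprD mulr1n; ring.
      * rewrite ?oE /orient_w -exprD.
        have -> : ((b' - b + (b - b')) + (h - b).-1 = (h - b').-1)%N by lia.
        by rewrite /= mulr0n; ring.
    + have {}oE := negbTE oE.
      have z5 : t5 = 0.
        apply/eqP; apply: contraT => /T5_neq0 [[? [? [? [h0 h1]]]]|[? [? [_ /no2 //]]]].
        have [_ hh] := im_fun arrP hk h0; rewrite -hh in h1.
        have aa1 : (b'.+1 < h)%N by lia.
        by have := im_or arrP aa1 hl h1; rewrite oE.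
      by rewrite z5 /t6 (T6v hk hl) // ?oE ?andbF /= mulr0n /orient_w; ring.
  - have z3 : t3 = 0.
      by apply/eqP; apply: contraT => /T3_neq0 [] [? [? [? _]]]; lia.
    have z4 : t4 = 0.
      by apply/eqP; apply: contraT => /T4_neq0 [] [? [? [? _]]]; lia.
    have z5 : t5 = 0.
      by apply/eqP; apply: contraT => /T5_neq0 [] [? [? [? _]]]; lia.
    have z6 : t6 = 0.
      by apply/eqP; apply: contraT => /T6_neq0 [] [? [? [? _]]]; lia.
    rewrite z3 z4 z5 z6 /t0 (T0v hk hl) // -?bb ?maxnn subnn /=.
    case: (o); case: (o') => /=; rewrite /orient_w ?mulr1n ?mulr0n; try ring.
    rewrite -exprD; have -> : ((h - b).-1 + (h - b).-1 = 2 * (h - b.+1))%N by lia.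
    by ring.
have no1 : forall o o' h, ~ qybe_cfg1 k l a b d a' b' d' o o' h by move=> o o' h ?; apply: n1; exists o, o', h.
have z1 : t1 = 0 by apply/eqP; apply: contraT => /T1_neq0 [? [? [? /no1]]].
have [[o [o' [g [hk hl]]]]|n2] := pselect (exists o o' g, qybe_cfg2 k l a b d a' b' d' o o' g).
  have c2 : qybe_cfg2 k l a b d a' b' d' o o' g by split.
  have [_ _ gb' b'n] := im_lt arrP hk; have [gb _ _ _] := im_lt arrP hl.
  have [aa hE _] := hk; have [_ dE _] := hl.
  have z7 : \sum_(b1 < n) qybe_T7 k l a b d a' b' d' b1 = 0.
    apply: big1 => b1 _; apply/eqP; apply: contraT => /T7_neq0 [[? [/no1 //]]|[? /(cfg23 c2) //]].
  rewrite z1 z7 sub0r addr0.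
  have v2 := T2v hk hl; rewrite -/t2 in v2; rewrite {}v2.
  have s8 : c * - \sum_(b1 < n) qybe_T8 k l a b d a' b' d' b1 =
     ((o && o')%:R * e ^+ (b' - b + (b - b')) * (e ^+ (2 * (minn b b' - g.+1)) - 1)
          * qp (s a' a + s g b' + s g b + s d d')).
    case: (boolP (o && o')) => [/andP [oE oE']|noo]; last first.
      rewrite big1 ?oppr0 ?mulr0 ?mul0r ?oppr0 // => b1 _; apply/eqP; apply: contraT.
      case/T8_neq0 => [[h1 [[h2 h3] h4]]|[? /(cfg23 c2) //]]; move: noo.
      have [hh _] := im_fun arrP hk h2; rewrite -hh in h2 h3 h4.
      by rewrite (im_or arrP _ hk h2) ?(im_or arrP _ hl h3) //; lia.
    rewrite (sum_range (lo := g) (hi := minn b b')) //; first last.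
    - move=> b1 /T8_neq0 [[h1 [[h2 _] h4]]|[? /(cfg23 c2) //]].
      by have [<- _] := im_fun arrP h2 hk.
    - by lia.
    rewrite -geom [in RHS](reindex_inj rev_ord_inj) /= mulr_sumr mulr_sumr mulr_suml -sumrN mulr_sumr.
    apply: eq_bigr => t _; have tl := ltn_ord t.
    rewrite (T8v hk hl oE oE'); last by lia.
    rewrite (_ : ((minn b b').-1 - (g.+1 + t) = minn b b' - g.+1 - t.+1)%N); last by lia.
    by rewrite -addnS exprD exprS /=; ring.
  rewrite {}s8; have [bb|bb|bb] := ltngtP b b'.
  - have z0 : t0 = 0 by rewrite /t0 /qybe_T0 (_ : (b == b') = false) ?mul0r //; lia.
    have z5 : t5 = 0.
      by apply/eqP; apply: contraT => /T5_neq0 [] [? [? [? _]]]; lia.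
    have z6 : t6 = 0.
      by apply/eqP; apply: contraT => /T6_neq0 [] [? [? [? _]]]; lia.
    rewrite z0 z5 z6; have [oE|oE] := boolP o.
    + have z3 : t3 = 0.
        apply/eqP; apply: contraT => /T3_neq0 [[? [? [_ /no1 //]]]|[? [? [? [h1 _]]]]].
        have aa1 : (a'.+1 < a)%N by lia.
        by have := im_or arrP aa1 hk h1; rewrite oE.
      rewrite z3 /t4 (T4w hk hl) //; case: (o') => /=.
      * rewrite ?oE /orient_w -exprD.
        have -> : ((b' - g).-1 + (b - g).-1 = (b' - b + (b - b')) + 2 * (b - g.+1))%N by lia.
        by rewrite exprD mulr1n; ring.
      * rewrite ?oE /orient_w -exprD.
        have -> : ((b' - b + (b - b')) + (b - g).-1 = (b' - g).-1)%N by lia.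
        by rewrite /= mulr0n; ring.
    + have {}oE := negbTE oE.
      have z4 : t4 = 0.
        apply/eqP; apply: contraT => /T4_neq0 [[? [? [_ /no1 //]]]|[? [? [? [h1 _]]]]].
        have aa1 : (a'.+1 < a)%N by lia.
        by have := im_or arrP aa1 hk h1; rewrite oE.
      by rewrite z4 /t3 (T3w hk hl) // ?oE /= mulr0n /orient_w; ring.
  - have z0 : t0 = 0 by rewrite /t0 /qybe_T0 (_ : (b == b') = false) ?mul0r //; lia.
    have z3 : t3 = 0.
      by apply/eqP; apply: contraT => /T3_neq0 [] [? [? [? _]]]; lia.
    have z4 : t4 = 0.
      by apply/eqP; apply: contraT => /T4_neq0 [] [? [? [? _]]]; lia.
    rewrite z0 z3 z4; have [oE|oE] := boolP o'.
    + have z5 : t5 = 0.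
        apply/eqP; apply: contraT => /T5_neq0 [[? [? [_ /no1 //]]]|[? [? [? [h0 h1]]]]].
        have [hh _] := im_fun arrP hk h0; rewrite -hh in h1.
        have aa1 : (g.+1 < b)%N by lia.
        by have := im_or arrP aa1 hl h1; rewrite oE.
      rewrite z5 /t6 (T6w hk hl) //; case: (o) => /=.
      * rewrite ?oE /orient_w -exprD.
        have -> : ((b' - g).-1 + (b - g).-1 = (b' - b + (b - b')) + 2 * (b' - g.+1))%N by lia.
        by rewrite exprD mulr1n; ring.
      * rewrite ?oE /orient_w -exprD.
        have -> : ((b' - b + (b - b')) + (b' - g).-1 = (b - g).-1)%N by lia.
        by rewrite /= mulr0n; ring.
    + have {}oE := negbTE oE.
      have z6 : t6 = 0.
        apply/eqP; apply: contraT => /T6_neq0 [[? [? [_ /no1 //]]]|[? [? [? [h0 h1]]]]].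
        have [hh _] := im_fun arrP hk h0; rewrite -hh in h1.
        have aa1 : (g.+1 < b)%N by lia.
        by have := im_or arrP aa1 hl h1; rewrite oE.
      by rewrite z6 /t5 (T5w hk hl) // ?oE ?andbF /= mulr0n /orient_w; ring.
  - have z3 : t3 = 0.
      by apply/eqP; apply: contraT => /T3_neq0 [] [? [? [? _]]]; lia.
    have z4 : t4 = 0.
      by apply/eqP; apply: contraT => /T4_neq0 [] [? [? [? _]]]; lia.
    have z5 : t5 = 0.
      by apply/eqP; apply: contraT => /T5_neq0 [] [? [? [? _]]]; lia.
    have z6 : t6 = 0.
      by apply/eqP; apply: contraT => /T6_neq0 [] [? [? [? _]]]; lia.
    rewrite z3 z4 z5 z6 /t0 (T0w hk hl) // -?bb ?minnn subnn /=.
    case: (o); case: (o') => /=; rewrite /orient_w ?mulr1n ?mulr0n; try ring.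
    rewrite -exprD; have -> : ((b - g).-1 + (b - g).-1 = 2 * (b - g.+1))%N by lia.
    by ring.
have no2 : forall o o' g, ~ qybe_cfg2 k l a b d a' b' d' o o' g by move=> o o' h ?; apply: n2; exists o, o', h.
have -> : t0 = 0.
  by apply/eqP; apply: contraT => /T0_neq0 [] [? [? [? []]]] _; [move/no1|move/no2].
have -> : t2 = 0 by apply/eqP; apply: contraT => /T2_neq0 [? [? [? /no2]]].
have -> : t3 = 0.
  by apply/eqP; apply: contraT => /T3_neq0 [] [? [? []]] _; [move/no1|move/no2].
have -> : t4 = 0.
  by apply/eqP; apply: contraT => /T4_neq0 [] [? [? []]] _; [move/no1|move/no2].
have -> : t5 = 0.
  by apply/eqP; apply: contraT => /T5_neq0 [] [? [? []]] _; [move/no1|move/no2].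
have -> : t6 = 0.
  by apply/eqP; apply: contraT => /T6_neq0 [] [? [? []]] _; [move/no1|move/no2].
rewrite z1 !(subr0, addr0, add0r).
have [[g [h c3]]|n3] := pselect (exists g h, qybe_cfg3 k l a b d a' b' d' g h); last first.
  rewrite !big1 ?subrr ?mulr0 // => b1 _; apply/eqP; apply: contraT.
    by move=> /T8_neq0 [[? [/no2 //]]|[h c3]]; case: n3; exists b1, h.
  by move=> /T7_neq0 [[? [/no1 //]]|[g c3]]; case: n3; exists g, b1.
have [hk _ gbh _] := c3; have [_ _ gh hn] := im_lt arrP hk; have gn := ltn_trans gh hn.
have -> : \sum_(b1 < n) qybe_T7 k l a b d a' b' d' b1 = qybe_T7 k l a b d a' b' d' h.
  rewrite (bigD1 (Ordinal hn)) //= big1 ?addr0 // => b1 nb; apply/eqP; apply: contraT.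
  case/T7_neq0 => [[? [/no1 //]]|[g' [hk' _ _ _]]].
  by have [_ E] := im_fun arrP hk hk'; move: nb; rewrite -val_eqE /= E eqxx.
have -> : \sum_(b1 < n) qybe_T8 k l a b d a' b' d' b1 = qybe_T8 k l a b d a' b' d' g.
  rewrite (bigD1 (Ordinal gn)) //= big1 ?addr0 // => b1 nb; apply/eqP; apply: contraT.
  case/T8_neq0 => [[? [/no2 //]]|[h' [hk' _ _ _]]].
  by have [E _] := im_fun arrP hk hk'; move: nb; rewrite -val_eqE /= E eqxx.
by rewrite (T78v c3) subrr mulr0.
Qed.

End Kernels.

(** * Matrices on two and three legs given by kernels *)

Section KernelMx.
Context (A : comNzRingType) (n : nat).
Local Open Scope ring_scope.
Local Notation ker2 := (nat -> nat -> nat -> nat -> A).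
Local Notation ker3 := (nat -> nat -> nat -> nat -> nat -> nat -> A).

(** Kernels take natural numbers, so that index arithmetic does not carry proofs of bounds; the
    values outside the range do not affect the matrix. *)
Definition mx2 (f : ker2) : 'M[A]_(n * n) :=
  \matrix_(r, t) f (mxtens_unindex r).1 (mxtens_unindex r).2
                   (mxtens_unindex t).1 (mxtens_unindex t).2.

Definition mx3 (f : ker3) : 'M[A]_(n * n * n) :=
  \matrix_(r, t)
    f (mxtens_unindex (mxtens_unindex r).1).1 (mxtens_unindex (mxtens_unindex r).1).2
      (mxtens_unindex r).2
      (mxtens_unindex (mxtens_unindex t).1).1 (mxtens_unindex (mxtens_unindex t).1).2
      (mxtens_unindex t).2.

Lemma mx2E f (i k j l : 'I_n) : mx2 f (mxtens_index (i, k)) (mxtens_index (j, l)) = f i k j l.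
Proof. by rewrite mxE !mxtens_indexK. Qed.

Lemma eq_mx2 f g : (forall a b i l, (a < n)%N -> (b < n)%N -> (i < n)%N -> (l < n)%N ->
  f a b i l = g a b i l) -> mx2 f = mx2 g.
Proof. by move=> fg; apply/matrixP => r t; rewrite !mxE; apply: fg; apply: ltn_ord. Qed.

Lemma eq_mx3 f g : (forall a b d a' b' d', (a < n)%N -> (b < n)%N -> (d < n)%N ->
  (a' < n)%N -> (b' < n)%N -> (d' < n)%N -> f a b d a' b' d' = g a b d a' b' d') -> mx3 f = mx3 g.
Proof. by move=> fg; apply/matrixP => r t; rewrite !mxE; apply: fg; apply: ltn_ord. Qed.

Lemma mx2_inj f g (a b i l : nat) : mx2 f = mx2 g -> (a < n)%N -> (b < n)%N -> (i < n)%N -> (l < n)%N ->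
  f a b i l = g a b i l.
Proof.
move=> fg an bn iN ln; have := mx2E f (Ordinal an) (Ordinal bn) (Ordinal iN) (Ordinal ln).
by rewrite fg mx2E => ->.
Qed.

Lemma sum_tens m p (F : 'I_(m * p) -> A) :
  \sum_r F r = \sum_(i < m) \sum_(j < p) F (mxtens_index (i, j)).
Proof.
rewrite pair_big (reindex (@mxtens_index m p)) /=; first by apply: eq_bigr => -[].
by exists (@mxtens_unindex m p) => r _; rewrite (mxtens_indexK, mxtens_unindexK).
Qed.

Lemma mul_mx2 f g : mx2 f *m mx2 g =
  mx2 (fun a b i l => \sum_(a1 < n) \sum_(b1 < n) f a b a1 b1 * g a1 b1 i l).
Proof.
apply/matrixP => r t; rewrite !mxE sum_tens; apply: eq_bigr => a1 _; apply: eq_bigr => b1 _.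
by rewrite !mxE !mxtens_indexK.
Qed.

Lemma mul_mx3 f g : mx3 f *m mx3 g = mx3 (fun a b d a' b' d' =>
  \sum_(a1 < n) \sum_(b1 < n) \sum_(d1 < n) f a b d a1 b1 d1 * g a1 b1 d1 a' b' d').
Proof.
apply/matrixP => r t; rewrite !mxE sum_tens sum_tens; apply: eq_bigr => a1 _.
apply: eq_bigr => b1 _; apply: eq_bigr => d1 _.
by rewrite !mxE !mxtens_indexK.
Qed.

Lemma mx2_surj (z : 'M[A]_(n * n)) : exists f, z = mx2 f.
Proof.
exists (fun a b i l => if insub a is Some a' then if insub b is Some b' then
  if insub i is Some i' then if insub l is Some l' then tcoef z a' b' i' l' else 0 else 0 else 0 else 0).
apply/matrixP => r t; case: (mxtens_indexP r) => a b; case: (mxtens_indexP t) => i l.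
by rewrite mx2E !valK.
Qed.

Lemma mx2_1 : 1%:M = mx2 (fun a b i l => ((a == i) && (b == l))%:R).
Proof.
apply/matrixP => r t; case: (mxtens_indexP r) => a b; case: (mxtens_indexP t) => i l.
rewrite mx2E mxE (inj_eq (can_inj (@mxtens_indexK n n))).
by rewrite xpair_eqE.
Qed.

Lemma mx3_1 : 1%:M = mx3 (fun a b d i l m => ((a == i) && (b == l) && (d == m))%:R).
Proof.
apply/matrixP => r t; case: (mxtens_indexP r) => ab d; case: (mxtens_indexP t) => il m.
case: (mxtens_indexP ab) => a b; case: (mxtens_indexP il) => i l.
rewrite !mxE !mxtens_indexK (inj_eq (can_inj (@mxtens_indexK _ _))) xpair_eqE.
by rewrite (inj_eq (can_inj (@mxtens_indexK _ _))) xpair_eqE.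
Qed.

Lemma sum_delta (F : nat -> A) (x : nat) : (x < n)%N -> \sum_(i < n) (x == i)%:R * F i = F x.
Proof.
move=> xn; rewrite (bigD1 (Ordinal xn)) //= eqxx mul1r big1 ?addr0 // => i nx.
have -> : (x == i) = false by apply/negbTE; rewrite eq_sym; exact: nx.
by rewrite mul0r.
Qed.

Lemma sum_delta' (F : nat -> A) (x : nat) : (x < n)%N -> \sum_(i < n) (i == x :> nat)%:R * F i = F x.
Proof. by move=> xn; rewrite -[RHS]sum_delta //; apply: eq_bigr => i _; rewrite eq_sym. Qed.

Lemma sum_at (F : nat -> A) (x : nat) : (forall i, F i != 0 -> i = x) ->
  ((n <= x)%N -> F x = 0) -> \sum_(i < n) F i = F x.
Proof.
move=> F0 Fx; have Z i : i != x -> F i = 0.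
  by move=> ix; apply/eqP; apply: contraNT ix => /F0 ->.
have [xn|nx] := ltnP x n; last first.
  by rewrite Fx // big1 // => i _; apply: Z; have := ltn_ord i; lia.
by rewrite (bigD1 (Ordinal xn)) //= big1 ?addr0 // => i ix; apply: Z.
Qed.

Definition ker12 (x : ker2) := mx3 (fun a b d a' b' d' => x a b a' b' * (d == d')%:R).
Local Notation M12 := ker12.
Definition ker23 (x : ker2) := mx3 (fun a b d a' b' d' => (a == a')%:R * x b d b' d').
Local Notation M23 := ker23.
(* The last argument of z is the basis vector of the leg 2. *)
Definition ker13 (z : nat -> nat -> nat -> nat -> nat -> A) :=
  mx3 (fun a b d a' b' d' => z a d a' d' b * (b == b')%:R).
Local Notation M13 := ker13.

Lemma tens3E (x y z : 'M[A]_n) (r1 r2 r3 t1 t2 t3 : 'I_n) :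
  (x *t y *t z) (mxtens_index (mxtens_index (r1, r2), r3)) (mxtens_index (mxtens_index (t1, t2), t3))
  = x r1 t1 * y r2 t2 * z r3 t3.
Proof. by rewrite !mxE !mxtens_indexK. Qed.

Lemma sum4_delta (F : 'I_n -> 'I_n -> 'I_n -> 'I_n -> A) (a b i l : 'I_n) :
  \sum_i0 \sum_j0 \sum_k0 \sum_l0 F i0 j0 k0 l0 *
     ((i0 == a)%:R * (j0 == i)%:R * (k0 == b)%:R * (l0 == l)%:R) = F a i b l.
Proof.
rewrite (bigD1 a) //= [X in _ + X]big1 ?addr0; last first.
  move=> x /negbTE ->; apply: big1 => j _; apply: big1 => k _; apply: big1 => m _.
  by rewrite !mul0r mulr0.
rewrite (bigD1 i) //= [X in _ + X]big1 ?addr0; last first.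
  move=> x /negbTE ->; apply: big1 => k _; apply: big1 => m _.
  by rewrite mulr0 !mul0r mulr0.
rewrite (bigD1 b) //= [X in _ + X]big1 ?addr0; last first.
  move=> x /negbTE ->; apply: big1 => m _.
  by rewrite mulr0 !mul0r mulr0.
rewrite (bigD1 l) //= [X in _ + X]big1 ?addr0; last first.
  by move=> x /negbTE ->; rewrite mulr0 mulr0.
by rewrite !eqxx !mulr1.
Qed.

Lemma leg12E f : leg12 (mx2 f) = M12 f.
Proof.
apply/matrixP => r t; case: (mxtens_indexP r) => ab d; case: (mxtens_indexP t) => il m.
case: (mxtens_indexP ab) => a b; case: (mxtens_indexP il) => i l.
rewrite [RHS]mxE !mxtens_indexK /= -(sum4_delta (fun a i b l => f a b i l * (d == m)%:R) a b i l).
rewrite summxE; apply: eq_bigr => i0 _; rewrite summxE; apply: eq_bigr => j0 _.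
rewrite summxE; apply: eq_bigr => k0 _; rewrite summxE; apply: eq_bigr => l0 _.
rewrite mxE tens3E /tcoef mx2E !mxE.
rewrite (eq_sym a) (eq_sym b) (eq_sym i) (eq_sym l) -mulnb -mulnb !natrM.
by ring.
Qed.

Lemma leg23E f : leg23 (mx2 f) = M23 f.
Proof.
apply/matrixP => r t; case: (mxtens_indexP r) => ab d; case: (mxtens_indexP t) => il m.
case: (mxtens_indexP ab) => a b; case: (mxtens_indexP il) => i l.
rewrite [RHS]mxE !mxtens_indexK /= -(sum4_delta (fun b l d m => (a == i)%:R * f b d l m) b d l m).
rewrite summxE; apply: eq_bigr => i0 _; rewrite summxE; apply: eq_bigr => j0 _.
rewrite summxE; apply: eq_bigr => k0 _; rewrite summxE; apply: eq_bigr => l0 _.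
rewrite mxE tens3E /tcoef mx2E !mxE.
rewrite (eq_sym b) (eq_sym d) (eq_sym m) (eq_sym l) -mulnb -mulnb !natrM.
by ring.
Qed.

Lemma leg13E f : leg13 (mx2 f) = M13 (fun a d a' d' _ => f a d a' d').
Proof.
apply/matrixP => r t; case: (mxtens_indexP r) => ab d; case: (mxtens_indexP t) => il m.
case: (mxtens_indexP ab) => a b; case: (mxtens_indexP il) => i l.
rewrite [RHS]mxE !mxtens_indexK /= -(sum4_delta (fun a i d m => f a d i m * (b == l)%:R) a d i m).
rewrite summxE; apply: eq_bigr => i0 _; rewrite summxE; apply: eq_bigr => j0 _.
rewrite summxE; apply: eq_bigr => k0 _; rewrite summxE; apply: eq_bigr => l0 _.
rewrite mxE tens3E /tcoef mx2E !mxE.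
rewrite (eq_sym a) (eq_sym d) (eq_sym m) (eq_sym i) -mulnb -mulnb !natrM.
by ring.
Qed.

Lemma M12_mul f g : M12 f *m M12 g =
  M12 (fun a b i l => \sum_(a1 < n) \sum_(b1 < n) f a b a1 b1 * g a1 b1 i l).
Proof.
rewrite mul_mx3; apply: eq_mx3 => a b d a' b' d' _ _ dn _ _ _.
rewrite mulr_suml; apply: eq_bigr => a1 _; rewrite mulr_suml; apply: eq_bigr => b1 _.
rewrite -(sum_delta (fun d1 => f a b a1 b1 * g a1 b1 a' b' * (d1 == d')%:R)) //.
by apply: eq_bigr => d1 _; ring.
Qed.

Lemma M23_mul f g : M23 f *m M23 g =
  M23 (fun a b i l => \sum_(a1 < n) \sum_(b1 < n) f a b a1 b1 * g a1 b1 i l).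
Proof.
rewrite mul_mx3; apply: eq_mx3 => a b d a' b' d' an _ _ _ _ _.
rewrite -(sum_delta (fun a1 => (a1 == a')%:R * \sum_(b1 < n) \sum_(d1 < n) f b d b1 d1 * g b1 d1 b' d')) //.
apply: eq_bigr => a1 _; rewrite !mulr_sumr; apply: eq_bigr => b1 _.
by rewrite !mulr_sumr; apply: eq_bigr => d1 _; ring.
Qed.

Lemma leg12M (x y : 'M[A]_(n * n)) : leg12 (x *m y) = leg12 x *m leg12 y.
Proof.
have [f ->] := mx2_surj x; have [g ->] := mx2_surj y.
by rewrite mul_mx2 !leg12E M12_mul.
Qed.

Lemma leg23M (x y : 'M[A]_(n * n)) : leg23 (x *m y) = leg23 x *m leg23 y.
Proof.
have [f ->] := mx2_surj x; have [g ->] := mx2_surj y.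
by rewrite mul_mx2 !leg23E M23_mul.
Qed.

Lemma leg12_1 : leg12 (1%:M : 'M[A]_(n * n)) = 1%:M.
Proof.
rewrite mx2_1 leg12E mx3_1; apply: eq_mx3 => a b d a' b' d' _ _ _ _ _ _.
by rewrite -natrM mulnb.
Qed.

Lemma leg23_1 : leg23 (1%:M : 'M[A]_(n * n)) = 1%:M.
Proof.
rewrite mx2_1 leg23E mx3_1; apply: eq_mx3 => a b d a' b' d' _ _ _ _ _ _.
by rewrite -natrM mulnb andbA.
Qed.

End KernelMx.

Section LegProducts.
Context (A : comNzRingType) (n : nat).
Local Open Scope ring_scope.
Local Notation ker2 := (nat -> nat -> nat -> nat -> A).
Implicit Types (f g : ker2) (z : nat -> nat -> nat -> nat -> nat -> A).
Local Notation M12 := (ker12 n).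
Local Notation M23 := (ker23 n).
Local Notation M13 := (ker13 n).
Local Notation mx3 := (mx3 n).

Lemma M12_23 f g : M12 f *m M23 g = mx3 (fun a b d a' b' d' =>
  \sum_(b1 < n) f a b a' b1 * g b1 d b' d').
Proof.
rewrite mul_mx3; apply: eq_mx3 => a b d a' b' d' _ _ dn a'n _ _.
rewrite exchange_big; apply: eq_bigr => b1 _ /=.
under eq_bigr => a1 _.
  rewrite (_ : \sum_(d1 < n) _ = (nat_of_ord a1 == a')%:R * (f a b a1 b1 * g b1 d b' d')); first by over.
  rewrite -(sum_delta (fun d1 => (nat_of_ord a1 == a')%:R * (f a b a1 b1 * g b1 d1 b' d')) dn).
  by apply: eq_bigr => d1 _; ring.
by rewrite (sum_delta' (fun a1 => f a b a1 b1 * g b1 d b' d')).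
Qed.

Lemma M23_12 f g : M23 g *m M12 f = mx3 (fun a b d a' b' d' =>
  \sum_(b1 < n) g b d b1 d' * f a b1 a' b').
Proof.
rewrite mul_mx3; apply: eq_mx3 => a b d a' b' d' an _ _ _ _ d'n.
rewrite exchange_big; apply: eq_bigr => b1 _ /=.
under eq_bigr => a1 _.
  rewrite (_ : \sum_(d1 < n) _ = (a == a1)%:R * (g b d b1 d' * f a1 b1 a' b')); first by over.
  rewrite -(sum_delta' (fun d1 => (a == a1)%:R * (g b d b1 d1 * f a1 b1 a' b')) d'n).
  by apply: eq_bigr => d1 _; ring.
by rewrite (sum_delta (fun a1 => g b d b1 d' * f a1 b1 a' b')).
Qed.

Lemma M12_13 f z : M12 f *m M13 z = mx3 (fun a b d a' b' d' =>
  \sum_(a1 < n) f a b a1 b' * z a1 d a' d' b').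
Proof.
rewrite mul_mx3; apply: eq_mx3 => a b d a' b' d' _ _ dn _ b'n _.
apply: eq_bigr => a1 _ /=.
under eq_bigr => b1 _.
  rewrite (_ : \sum_(d1 < n) _ = (nat_of_ord b1 == b')%:R * (f a b a1 b1 * z a1 d a' d' b1)); first by over.
  rewrite -(sum_delta (fun d1 => (nat_of_ord b1 == b')%:R * (f a b a1 b1 * z a1 d1 a' d' b1)) dn).
  by apply: eq_bigr => d1 _; ring.
by rewrite (sum_delta' (fun b1 => f a b a1 b1 * z a1 d a' d' b1)).
Qed.

Lemma M13_12 f z : M13 z *m M12 f = mx3 (fun a b d a' b' d' =>
  \sum_(a1 < n) z a d a1 d' b * f a1 b a' b').
Proof.
rewrite mul_mx3; apply: eq_mx3 => a b d a' b' d' _ bn _ _ _ d'n.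
apply: eq_bigr => a1 _ /=.
under eq_bigr => b1 _.
  rewrite (_ : \sum_(d1 < n) _ = (b == b1)%:R * (z a d a1 d' b * f a1 b1 a' b')); first by over.
  rewrite -(sum_delta' (fun d1 => (b == b1)%:R * (z a d a1 d1 b * f a1 b1 a' b')) d'n).
  by apply: eq_bigr => d1 _; ring.
by rewrite (sum_delta (fun b1 => z a d a1 d' b * f a1 b1 a' b')).
Qed.

Lemma M13_23 g z : M13 z *m M23 g = mx3 (fun a b d a' b' d' =>
  \sum_(d1 < n) z a d a' d1 b * g b d1 b' d').
Proof.
rewrite mul_mx3; apply: eq_mx3 => a b d a' b' d' _ bn _ a'n _ _.
rewrite -(sum_delta' (fun a1 => \sum_(d1 < n) z a d a1 d1 b * g b d1 b' d') a'n).
apply: eq_bigr => a1 _ /=.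
rewrite -(sum_delta (fun b1 => (nat_of_ord a1 == a')%:R * \sum_(d1 < n) z a d a1 d1 b * g b1 d1 b' d') bn).
apply: eq_bigr => b1 _; rewrite !mulr_sumr; apply: eq_bigr => d1 _; ring.
Qed.

Lemma M23_13 g z : M23 g *m M13 z = mx3 (fun a b d a' b' d' =>
  \sum_(d1 < n) g b d b' d1 * z a d1 a' d' b').
Proof.
rewrite mul_mx3; apply: eq_mx3 => a b d a' b' d' an _ _ _ b'n _.
rewrite -(sum_delta (fun a1 => \sum_(d1 < n) g b d b' d1 * z a1 d1 a' d' b') an).
apply: eq_bigr => a1 _ /=.
rewrite -(sum_delta' (fun b1 => (a == a1)%:R * \sum_(d1 < n) g b d b1 d1 * z a1 d1 a' d' b1) b'n).
apply: eq_bigr => b1 _; rewrite !mulr_sumr; apply: eq_bigr => d1 _; ring.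
Qed.

Lemma M12_13_23 f g z : M12 f *m M13 z *m M23 g = mx3 (fun a b d a' b' d' =>
  \sum_(b1 < n) \sum_(a1 < n) \sum_(d1 < n) f a b a1 b1 * z a1 d a' d1 b1 * g b1 d1 b' d').
Proof.
rewrite M12_13 mul_mx3; apply: eq_mx3 => a b d a' b' d' _ _ _ a'n _ _.
rewrite -(sum_delta' (fun a2 => \sum_(b1 < n) \sum_(a1 < n) \sum_(d1 < n)
   f a b a1 b1 * z a1 d a2 d1 b1 * g b1 d1 b' d') a'n).
apply: eq_bigr => a2 _; rewrite mulr_sumr; apply: eq_bigr => b1 _.
rewrite mulr_sumr [RHS](eq_bigr (fun a1 : 'I_n => \sum_(d1 < n)
   (nat_of_ord a2 == a')%:R * (f a b a1 b1 * z a1 d a2 d1 b1 * g b1 d1 b' d'))); last first.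
  by move=> a1 _; rewrite mulr_sumr.
rewrite exchange_big; apply: eq_bigr => d1 _; rewrite mulr_suml; apply: eq_bigr => a1 _; ring.
Qed.

Lemma M23_13_12 f g z : M23 g *m M13 z *m M12 f = mx3 (fun a b d a' b' d' =>
  \sum_(b1 < n) \sum_(a1 < n) \sum_(d1 < n) g b d b1 d1 * z a d1 a1 d' b1 * f a1 b1 a' b').
Proof.
rewrite M23_13 mul_mx3; apply: eq_mx3 => a b d a' b' d' _ _ _ _ _ d'n.
rewrite exchange_big; apply: eq_bigr => b1 _; apply: eq_bigr => a1 _ /=.
rewrite -(sum_delta' (fun d2 => \sum_(d1 < n) g b d b1 d1 * z a d1 a1 d2 b1 * f a1 b1 a' b') d'n).
apply: eq_bigr => d2 _; rewrite mulr_suml mulr_sumr; apply: eq_bigr => d1 _; ring.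
Qed.

End LegProducts.

(** * The dressed Yang-Baxter equation *)

Section QuasiYBE.
Context (n : nat) (arr : nat -> nat -> Prop) (arrP : arrows n arr).
Context (K : numFieldType) (s : nat -> nat -> K) (sP : r0_form n arr s).
Context (A : comNzRingType) (qp : K -> A).
Hypotheses (qp0 : qp 0%R = 1%R) (qpD : forall x y, qp (x + y)%R = (qp x * qp y)%R).
Local Notation im := (tau_im n arr).
Local Notation X := (theta_ker n arr s qp).
Local Notation Z := (dressed_ker n arr s qp).
Local Notation c := (qdiff qp).
Local Notation mx3 := (mx3 n).
Local Notation M12 := (ker12 n).
Local Notation M23 := (ker23 n).
Local Notation M13 := (ker13 n).
Local Open Scope ring_scope.

Definition theta12 (k : nat) : 'M[A]_(n * n * n) := 1%:M + c *: M12 (X k).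
Local Notation tu := theta12.
Definition theta23 (k : nat) : 'M[A]_(n * n * n) := 1%:M + c *: M23 (X k).
Local Notation tv := theta23.
Definition theta13 (sg : K) (k p : nat) : 'M[A]_(n * n * n) := 1%:M + c *: M13 (Z sg k p).
Local Notation tw := theta13.

Lemma X_cons k a b i l : X k a b i l != 0 ->
  [/\ (i < a)%N, (a < n)%N, (b < l)%N, (l < n)%N & (l = b + (a - i))%N].
Proof. by move=> /X_neq0 [o h]; have [? ? ? ?] := im_lt arrP h; case: h => _ E _; split. Qed.

Lemma Z_cons sg k p a d i l b : Z sg k p a d i l b != 0 ->
  [/\ (i < a)%N, (a < n)%N, (d < l)%N, (l < n)%N & (l = d + (a - i))%N].
Proof. by move=> /mul_neq0 [/X_cons]. Qed.

(** The two dressings differ only in the sign of [ip_root_vec], which is 1, -1 or 0; their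
    difference is thus a multiple of q - q ^ -1 and has the same order as the products of two
    kernels. *)
Lemma Z_diff k l a b d a' b' d' :
  (Z (-1) k (k + l) a d a' d' b - Z 1 k (k + l) a d a' d' b) * (b == b')%:R
  = c * qybe_T0 n arr s qp k l a b d a' b' d'.
Proof.
rewrite /qybe_T0 /dressed_ker; case: (b == b') => /=; last by rewrite !mul0r !mulr0.
rewrite mulr1 mul1r -mulrBr; have [->|/X_neq0 [o h]] := eqVneq (X (k + l) a d a' d') 0.
  by rewrite !mul0r mulr0.
have [o1 [g [h' [h1 _]]]] := im_decomp arrP h.
rewrite (imfE arrP h1) /= mulrCA; congr (_ * _).
have [_ _ gh _] := im_lt arrP h1.
rewrite /dressing /ip_root_vec !(qpD (_ *+ 2)) -mulrBr mulrCA; congr (_ * _).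
have [gb|gb] := eqVneq g b; have [hb|hb] := eqVneq h' b; first by lia.
- by rewrite /= mulr1n mulr0n !(subr0, sub0r, mulr1, mul1r) /qdiff; ring.
- by rewrite /= mulr1n mulr0n !(subr0, sub0r, mulr1, mul1r, mulrN1) opprK /qdiff; ring.
- by rewrite !subrr !mulr0 subrr.
Qed.

Lemma cubic (U V Wm Wp : 'M[A]_(n * n * n)) :
  Wm - Wp + c *: (U *m V - V *m U + U *m Wm - Wp *m U + Wm *m V - V *m Wp)
    + c ^+ 2 *: (U *m Wm *m V - V *m Wp *m U) = 0 ->
  (1%:M + c *: U) *m (1%:M + c *: Wm) *m (1%:M + c *: V)
  = (1%:M + c *: V) *m (1%:M + c *: Wp) *m (1%:M + c *: U).
Proof.
move=> H; apply/eqP; rewrite -subr_eq0; apply/eqP.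
rewrite -[RHS](scaler0 _ c) -H.
rewrite !(mulmxDl, mulmxDr, mul1mx, mulmx1) -!(scalemxAl, scalemxAr) !scalerA.
apply/matrixP => r t.
set UV := U *m V; set VU := V *m U; set UWm := U *m Wm; set WpU := Wp *m U.
set WmV := Wm *m V; set VWp := V *m Wp; set UWV := _ *m V; set VWU := _ *m U.
by rewrite !mxE; ring.
Qed.

(** Going from leg 1 to leg 3 by tau ^ (k + l) passes leg 2 at the stage tau ^ k, and the factor on
    the legs 1 and 3 is dressed at this stage. Expanded by [cubic], the entries are those of
    [qybe_kernel]. *)
Lemma qybe k l : tu k *m tw (-1) k (k + l) *m tv l = tv l *m tw 1 k (k + l) *m tu k.
Proof.
apply: cubic.
rewrite M12_13_23 M23_13_12 M12_23 M23_12 M12_13 M13_12 M13_23 M23_13.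
apply/matrixP => r t; rewrite !mxE.
move: (ltn_ord (mxtens_unindex (mxtens_unindex r).1).1) (ltn_ord (mxtens_unindex (mxtens_unindex r).1).2)
  (ltn_ord (mxtens_unindex r).2) (ltn_ord (mxtens_unindex (mxtens_unindex t).1).1)
  (ltn_ord (mxtens_unindex (mxtens_unindex t).1).2) (ltn_ord (mxtens_unindex t).2).
move: (nat_of_ord (mxtens_unindex (mxtens_unindex r).1).1) (nat_of_ord (mxtens_unindex (mxtens_unindex r).1).2)
  (nat_of_ord (mxtens_unindex r).2) (nat_of_ord (mxtens_unindex (mxtens_unindex t).1).1)
  (nat_of_ord (mxtens_unindex (mxtens_unindex t).1).2) (nat_of_ord (mxtens_unindex t).2).
move=> a b d a' b' d' an bn dn a'n b'n d'n.
have -> : \sum_(b1 < n) X k a b a' b1 * X l b1 d b' d' = qybe_T1 n arr s qp k l a b d a' b' d'.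
  apply: (sum_at (F := fun b1 => X k a b a' b1 * X l b1 d b' d')).
    by move=> i /mul_neq0 [/X_cons [? ? ? ? E] _].
  by move=> nb; apply/eqP; apply: contraT => /mul_neq0 [/X_cons [? ? ? ? E] _]; lia.
have -> : \sum_(b1 < n) X l b d b1 d' * X k a b1 a' b' = qybe_T2 n arr s qp k l a b d a' b' d'.
  apply: (sum_at (F := fun b1 => X l b d b1 d' * X k a b1 a' b')).
    by move=> i /mul_neq0 [/X_cons [? ? ? ? E] _]; lia.
  by move=> nb; apply/eqP; apply: contraT => /mul_neq0 [/X_cons [? ? ? ? E] _]; lia.
have -> : \sum_(a1 < n) X k a b a1 b' * Z (-1) k (k + l) a1 d a' d' b' = qybe_T3 n arr s qp k l a b d a' b' d'.
  apply: (sum_at (F := fun a1 => X k a b a1 b' * Z (-1) k (k + l) a1 d a' d' b')).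
    by move=> i /mul_neq0 [/X_cons [? ? ? ? E] _]; lia.
  by move=> nb; apply/eqP; apply: contraT => /mul_neq0 [/X_cons [? ? ? ? E] _]; lia.
have -> : \sum_(a1 < n) Z 1 k (k + l) a d a1 d' b * X k a1 b a' b' = qybe_T4 n arr s qp k l a b d a' b' d'.
  apply: (sum_at (F := fun a1 => Z 1 k (k + l) a d a1 d' b * X k a1 b a' b')).
    by move=> i /mul_neq0 [_ /X_cons [? ? ? ? E]]; lia.
  by move=> nb; apply/eqP; apply: contraT => /mul_neq0 [_ /X_cons [? ? ? ? E]]; lia.
have -> : \sum_(d1 < n) Z (-1) k (k + l) a d a' d1 b * X l b d1 b' d' = qybe_T5 n arr s qp k l a b d a' b' d'.
  apply: (sum_at (F := fun d1 => Z (-1) k (k + l) a d a' d1 b * X l b d1 b' d')).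
    by move=> i /mul_neq0 [/Z_cons [? ? ? ? E] _]; lia.
  by move=> nb; apply/eqP; apply: contraT => /mul_neq0 [/Z_cons [? ? ? ? E] _]; lia.
have -> : \sum_(d1 < n) X l b d b' d1 * Z 1 k (k + l) a d1 a' d' b' = qybe_T6 n arr s qp k l a b d a' b' d'.
  apply: (sum_at (F := fun d1 => X l b d b' d1 * Z 1 k (k + l) a d1 a' d' b')).
    by move=> i /mul_neq0 [/X_cons [? ? ? ? E] _]; lia.
  by move=> nb; apply/eqP; apply: contraT => /mul_neq0 [/X_cons [? ? ? ? E] _]; lia.
have -> : \sum_(b1 < n) \sum_(a1 < n) \sum_(d1 < n) X k a b a1 b1 * Z (-1) k (k + l) a1 d a' d1 b1 * X l b1 d1 b' d'
    = \sum_(b1 < n) qybe_T7 n arr s qp k l a b d a' b' d' b1.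
  apply: eq_bigr => b1 _.
  rewrite (sum_at (F := fun a1 => \sum_(d1 < n) X k a b a1 b1 * Z (-1) k (k + l) a1 d a' d1 b1 * X l b1 d1 b' d')
    (x := a - (b1 - b))).
  - apply: (sum_at (F := fun d1 => X k a b (a - (b1 - b)) b1 * Z (-1) k (k + l) (a - (b1 - b)) d a' d1 b1 * X l b1 d1 b' d')).
      by move=> i /mul_neq0 [/mul_neq0 [_ /Z_cons [? ? ? ? E]] _]; lia.
    by move=> nb; apply/eqP; apply: contraT => /mul_neq0 [/mul_neq0 [_ /Z_cons [? ? ? ? E]] _]; lia.
  - move=> i; have [->|/X_cons [? ? ? ? E] _] := eqVneq (X k a b i b1) 0; last by lia.
    by rewrite big1 ?eqxx // => d1 _; rewrite !mul0r.
  - move=> nb; have [->|/X_cons [? ? ? ? E]] := eqVneq (X k a b (a - (b1 - b)) b1) 0; last by lia.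
    by rewrite big1 // => d1 _; rewrite !mul0r.
have -> : \sum_(b1 < n) \sum_(a1 < n) \sum_(d1 < n) X l b d b1 d1 * Z 1 k (k + l) a d1 a1 d' b1 * X k a1 b1 a' b'
    = \sum_(b1 < n) qybe_T8 n arr s qp k l a b d a' b' d' b1.
  apply: eq_bigr => b1 _; rewrite exchange_big /=.
  rewrite (sum_at (F := fun d1 => \sum_(a1 < n) X l b d b1 d1 * Z 1 k (k + l) a d1 a1 d' b1 * X k a1 b1 a' b')
    (x := d + (b - b1))).
  - apply: (sum_at (F := fun a1 => X l b d b1 (d + (b - b1)) * Z 1 k (k + l) a (d + (b - b1)) a1 d' b1 * X k a1 b1 a' b')).
      by move=> i /mul_neq0 [/mul_neq0 [_ /Z_cons [? ? ? ? E]] _]; lia.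
    by move=> nb; apply/eqP; apply: contraT => /mul_neq0 [/mul_neq0 [_ /Z_cons [? ? ? ? E]] _]; lia.
  - move=> i; have [->|/X_cons [? ? ? ? E] _] := eqVneq (X l b d b1 i) 0; last by lia.
    by rewrite big1 ?eqxx // => d1 _; rewrite !mul0r.
  - move=> nb; have [->|/X_cons [? ? ? ? E]] := eqVneq (X l b d b1 (d + (b - b1))) 0; last by lia.
    by rewrite big1 // => d1 _; rewrite !mul0r.
have -> : Z (-1) k (k + l) a d a' d' b * (b == b')%:R - Z 1 k (k + l) a d a' d' b * (b == b')%:R
    = c * qybe_T0 n arr s qp k l a b d a' b' d' by rewrite -mulrBl Z_diff.
have := qybe_kernel arrP sP qp0 qpD k l a b d a' b' d'.
set x7 := \sum_(b1 < n) qybe_T7 _ _ _ _ _ _ _ _ _ _ _ _ _.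
set x8 := \sum_(b1 < n) qybe_T8 _ _ _ _ _ _ _ _ _ _ _ _ _ => H.
by rewrite -[RHS](mulr0 c) -H; ring.
Qed.

End QuasiYBE.

(** * The twist and its cocycle identity *)

Section OrderedProducts.
Context (A : comNzRingType) (m : nat).
Local Open Scope ring_scope.
Local Notation T := 'M[A]_m.

Fixpoint oprod (F : nat -> T) (i L : nat) : T :=
  if L is L'.+1 then F i *m oprod F i.+1 L' else 1%:M.

Lemma eq_oprod F G i L : (forall j, (i <= j < i + L)%N -> F j = G j) -> oprod F i L = oprod G i L.
Proof.
elim: L i => [//|L IH] i FG /=; rewrite FG; last by lia.
by congr (_ *m _); apply: IH => j ij; apply: FG; lia.
Qed.

Lemma oprod_comm (B : T) F i L : (forall j, (i <= j < i + L)%N -> B *m F j = F j *m B) ->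
  B *m oprod F i L = oprod F i L *m B.
Proof.
elim: L i => [|L IH] i BF /=; first by rewrite mulmx1 mul1mx.
rewrite mulmxA BF; last by lia.
by rewrite -!mulmxA IH // => j ij; apply: BF; lia.
Qed.

Section Cocycle.
Context (u v : nat -> T) (w : nat -> nat -> T) (N : nat).
Hypothesis (uwv : forall j i, (0 < j)%N -> u j *m w j.+1 (j + i)%N *m v i = v i *m w j (j + i)%N *m u j).
Hypothesis (w1 : forall j p, (N <= p)%N -> w j p = 1%:M).

Lemma slide j i L : (0 < j)%N ->
  oprod (fun i => v i *m w j (j + i)%N) i L *m u j
  = u j *m oprod (fun i => w j.+1 (j + i)%N *m v i) i L.
Proof.
move=> j0; elim: L i => [|L IH] i /=; first by rewrite mulmx1 mul1mx.
by rewrite -mulmxA IH !mulmxA uwv.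
Qed.

Lemma shift j i L : (0 < j)%N ->
  oprod (fun i => w j (j.-1 + i)%N *m v i) i L *m w j (j.-1 + (i + L))%N
  = w j (j.-1 + i)%N *m oprod (fun i => v i *m w j (j + i)%N) i L.
Proof.
move=> j0; elim: L i => [|L IH] i /=; first by rewrite mulmx1 mul1mx addn0.
rewrite -mulmxA -addSnnS IH !mulmxA.
by rewrite (_ : (j.-1 + i.+1)%N = (j + i)%N) //; lia.
Qed.

Lemma cocycle_step j : (0 < j)%N ->
  oprod (fun i => w j (j.-1 + i)%N *m v i) 1 N *m u j
  = w j j *m u j *m oprod (fun i => w j.+1 (j + i)%N *m v i) 1 N.
Proof.
move=> j0; have := shift 1 N j0; rewrite w1 ?mulmx1; last by lia.
rewrite (_ : (j.-1 + 1)%N = j); last by lia.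
by move=> ->; rewrite -mulmxA slide // mulmxA.
Qed.

(** Each u_j travels to the left through the product of the w_j v_i: [uwv] raises the first index of
    the w it meets, and w_j j is left in front of it ([cocycle_step]). After N steps the second
    index of every remaining w is at least N, so these are 1. *)
Lemma cocycle :
  oprod (fun i => w 1 i *m v i) 1 N *m oprod u 1 N
  = oprod (fun j => w j j *m u j) 1 N *m oprod v 1 N.
Proof.
have -> : oprod (fun i => w 1 i *m v i) 1 N = oprod (fun i => w 1 (1.-1 + i)%N *m v i) 1 N by [].
have gen j L : (0 < j)%N -> oprod (fun i => w j (j.-1 + i)%N *m v i) 1 N *m oprod u j L
    = oprod (fun j => w j j *m u j) j L *m oprod (fun i => w (j + L)%N ((j + L).-1 + i)%N *m v i) 1 N.
  elim: L j => [|L IH] j j0; first by rewrite /= mulmx1 mul1mx addn0.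
  rewrite /= mulmxA cocycle_step // -!mulmxA; congr (_ *m (_ *m _)).
  by rewrite -addSnnS; exact: (IH j.+1).
rewrite gen //; congr (_ *m _); apply: eq_oprod => i iN.
by rewrite w1 ?mul1mx //; lia.
Qed.

End Cocycle.
End OrderedProducts.

Section Braid.
Context (n : nat) (arr : nat -> nat -> Prop) (arrP : arrows n arr).
Context (K : numFieldType) (s : nat -> nat -> K) (sP : r0_form n arr s).
Context (A : comNzRingType) (qp : K -> A).
Hypotheses (qp0 : qp 0%R = 1%R) (qpD : forall x y, qp (x + y)%R = (qp x * qp y)%R).
Local Notation im := (tau_im n arr).
Local Notation X := (theta_ker n arr s qp).
Local Notation Z := (dressed_ker n arr s qp).
Local Notation c := (qdiff qp).
Local Notation mx2 := (mx2 n).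
Local Notation mx3 := (mx3 n).
Local Notation M12 := (ker12 n).
Local Notation M23 := (ker23 n).
Local Notation M13 := (ker13 n).
Local Notation tu := (theta12 n arr s qp).
Local Notation tv := (theta23 n arr s qp).
Local Notation tw := (theta13 n arr s qp).
Local Open Scope ring_scope.

(* [theta_mx 0] is the unipotent factor of R_0 = q ^ r0 R_s q ^ r0, [twist] is the
   twist J, and [braid0] is the braid form P R_0 of R_0. *)
Definition theta_mx (k : nat) : 'M[A]_(n * n) := 1%:M + c *: mx2 (X k).
Local Notation Theta := theta_mx.
(** The flip P times q ^ (2 r0 + P0). *)
Definition diag_ker (a b i l : nat) : A := (a == l)%:R * ((b == i)%:R * qp (kappa s b a)).
Definition braid0 : 'M[A]_(n * n) := mx2 diag_ker *m Theta 0.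
Local Notation B0 := braid0.
Definition twist (N : nat) : 'M[A]_(n * n) := oprod Theta 1 N.
Local Notation J := twist.

Lemma im0 i j : (i < j < n)%N -> im false 0 i j i j.
Proof. by move=> ij; split; [lia|lia|] => x xi; split=> //; lia. Qed.

Lemma im0E o i j u v : im o 0 i j u v -> u = i /\ v = j.
Proof.
move=> h; have [ij jn _ _] := im_lt arrP h.
by apply: (im_fun arrP h); apply: im0; lia.
Qed.

Lemma kap_im1 o i j u v w : im o 1 i j u v -> (w < n)%N ->
  kappa s u w - kappa s v w = - (kappa s w i - kappa s w j).
Proof.
move=> h wn; have [ij jn uv vn] := im_lt arrP h.
rewrite (tele (fun x => kappa s x w)) ?(tele (fun x => kappa s w x)); [|lia..].
rewrite -sumrN; apply/esym; apply: (im_sum h) => x y _ /(step1 arrP) xy.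
by rewrite (r0_arr sP xy wn).
Qed.

(** The equation of r0, in the form kappa (tau a, b) = - kappa (b, a), turns the dressing with sign
    1 at the stage k + 1 into the one with sign -1 at the stage k. This lets the dressed equations
    [qybe] be chained. *)
Lemma tw_shift k p : (k < p)%N -> tw 1 k.+1 p = tw (-1) k p.
Proof.
move=> kp; congr (_ + _ *: _); apply: eq_mx3 => a b d a' b' d' _ bn _ _ _ _.
congr (_ * _); rewrite /dressed_ker; have [->|/X_neq0 [o h]] := eqVneq (X p a d a' d') 0; first by rewrite !mul0r.
congr (_ * _).
have [o1 [g [h1 hk]]] := im_dom arrP h (ltnW kp).
have [o2 [g' [h1' hk']]] := im_dom arrP h kp.
rewrite (imfE arrP hk) (imfE arrP hk') /= /dressing; congr (qp _).
move: hk'; rewrite -addn1 => /(im_decomp arrP) [o3 [g2 [h2 [hk2 h1st]]]].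
have [eg eh] := im_fun arrP hk hk2; subst g2 h2.
have := kap_im1 h1st bn.
rewrite /kappa /ip_root_vec (s_skew sP b g) (s_skew sP b h1) ![(b == _)]eq_sym => E.
have -> : (s g' b - s h1' b) *+ 2 + 1 * ((g' == b)%:R - (h1' == b)%:R)
  = s g' b *+ 2 + (g' == b)%:R - (s h1' b *+ 2 + (h1' == b)%:R) by ring.
by rewrite E; ring.
Qed.

Lemma leg12_Theta k : leg12 (Theta k) = tu k.
Proof.
have -> : Theta k = mx2 (fun a b i l => ((a == i) && (b == l))%:R + c * X k a b i l).
  by rewrite /theta_mx mx2_1; apply/matrixP => r t; rewrite !mxE.
rewrite leg12E /theta12 mx3_1; apply/matrixP => r t; rewrite !mxE mulrDl -natrM mulnb.
by rewrite mulrA.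
Qed.

Lemma leg23_Theta k : leg23 (Theta k) = tv k.
Proof.
have -> : Theta k = mx2 (fun a b i l => ((a == i) && (b == l))%:R + c * X k a b i l).
  by rewrite /theta_mx mx2_1; apply/matrixP => r t; rewrite !mxE.
rewrite leg23E /theta23 mx3_1; apply/matrixP => r t; rewrite !mxE mulrDr -natrM mulnb andbA.
by rewrite mulrCA.
Qed.

Lemma D_intertwine (D U V : 'M[A]_(n * n * n)) : D *m U = V *m D ->
  D *m (1%:M + c *: U) = (1%:M + c *: V) *m D.
Proof. by move=> H; rewrite mulmxDr mulmxDl mulmx1 mul1mx -scalemxAl -scalemxAr H. Qed.

Lemma dker_sum12 (F : nat -> A) a b a' : (a < n)%N ->
  \sum_(b1 < n) diag_ker a b a' b1 * F b1 = (b == a')%:R * qp (kappa s b a) * F a.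
Proof.
move=> an; rewrite -[RHS](sum_delta (fun b1 => (b == a')%:R * qp (kappa s b a) * F b1) an).
by apply: eq_bigr => b1 _; rewrite /diag_ker; ring.
Qed.

Lemma dker_sum1 (F : nat -> A) b a' b' : (b' < n)%N ->
  \sum_(a1 < n) F a1 * diag_ker a1 b a' b' = (b == a')%:R * (F b' * qp (kappa s b b')).
Proof.
move=> bn; rewrite -[RHS](sum_delta' (fun a1 => (b == a')%:R * (F a1 * qp (kappa s b a1))) bn).
by apply: eq_bigr => b1 _; rewrite /diag_ker; ring.
Qed.

Lemma dker_sum2 (F : nat -> A) a b l : (b < n)%N ->
  \sum_(i1 < n) diag_ker a b i1 l * F i1 = (a == l)%:R * qp (kappa s b a) * F b.
Proof.
move=> an; rewrite -[RHS](sum_delta (fun b1 => (a == l)%:R * qp (kappa s b a) * F b1) an).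
by apply: eq_bigr => b1 _; rewrite /diag_ker; ring.
Qed.

Lemma dker_sum3 (F : nat -> A) a i l : (i < n)%N ->
  \sum_(b1 < n) F b1 * diag_ker a b1 i l = (a == l)%:R * (F i * qp (kappa s i a)).
Proof.
move=> bn; rewrite -[RHS](sum_delta' (fun b1 => (a == l)%:R * (F b1 * qp (kappa s b1 a))) bn).
by apply: eq_bigr => b1 _; rewrite /diag_ker; ring.
Qed.

Local Notation D12 := (M12 diag_ker).
Local Notation D23 := (M23 diag_ker).

Lemma kapD sg g h b x y : x = y + (s g b - s h b) *+ 2 + sg * ip_root_vec K g h b ->
  qp x = qp y * dressing s qp sg g h b.
Proof. by move=> ->; rewrite -addrA qpD. Qed.

(** Conjugation by the diagonal part of the braid form moves a factor from the legs 2 and 3 to the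
    legs 1 and 3, and the exponents it picks up are the dressing. Thus [qybe] with k = 0 or l = 0
    becomes a relation with [braid0]. *)
Lemma D12_v k : D12 *m tv k = tw (-1) 0 k *m D12.
Proof.
apply: D_intertwine; rewrite M12_23 M13_12; apply: eq_mx3 => a b d a' b' d' an bn dn a'n b'n d'n.
rewrite (dker_sum12 (fun b1 => X k b1 d b' d')) //.
rewrite (dker_sum1 (fun a1 => Z (-1) 0 k a d a1 d' b)) //.
rewrite -mulrA; congr (_ * _); rewrite /dressed_ker.
have [->|X0] := eqVneq (X k a d b' d') 0; first by rewrite !(mul0r, mulr0).
have [b'a _ _ _ _] := X_cons arrP X0.
rewrite (imfE arrP (@im0 b' a _)) /=; last by lia.
rewrite mulrC -mulrA; congr (_ * _); rewrite mulrC; apply: kapD.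
by rewrite /kappa /ip_root_vec (s_skew sP b a) (s_skew sP b b') ![(b == _)]eq_sym; ring.
Qed.

Lemma D12_w k : D12 *m tw 1 0 k = tv k *m D12.
Proof.
apply: D_intertwine; rewrite M12_13 M23_12; apply: eq_mx3 => a b d a' b' d' an bn dn a'n b'n d'n.
rewrite (dker_sum2 (fun a1 => Z 1 0 k a1 d a' d' b')) //.
rewrite (dker_sum3 (fun b1 => X k b d b1 d')) //.
have [<-|_] := eqVneq a b'; last by rewrite !mul0r.
rewrite !mul1r /dressed_ker; have [->|X0] := eqVneq (X k b d a' d') 0; first by rewrite !(mul0r, mulr0).
have [ab _ _ _ _] := X_cons arrP X0.
rewrite (imfE arrP (@im0 a' b _)) /=; last by lia.
rewrite mulrCA; congr (_ * _); apply/esym/kapD.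
by rewrite /kappa /ip_root_vec; ring.
Qed.

Lemma D23_u k : D23 *m tu k = tw 1 k k *m D23.
Proof.
apply: D_intertwine; rewrite M23_12 M13_23; apply: eq_mx3 => a b d a' b' d' an bn dn a'n b'n d'n.
rewrite (dker_sum2 (fun b1 => X k a b1 a' b')) //.
rewrite (dker_sum3 (fun d1 => Z 1 k k a d a' d1 b)) //.
rewrite -mulrA; congr (_ * _); rewrite /dressed_ker.
have [->|/X_neq0 [o h]] := eqVneq (X k a d a' b') 0; first by rewrite !(mul0r, mulr0).
rewrite (imfE arrP h) /= mulrC -mulrA; congr (_ * _); rewrite mulrC; apply: kapD.
by rewrite /kappa /ip_root_vec; ring.
Qed.

Lemma D23_w k : D23 *m tw (-1) k k = tu k *m D23.
Proof.
apply: D_intertwine; rewrite M23_13 M12_23; apply: eq_mx3 => a b d a' b' d' an bn dn a'n b'n d'n.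
rewrite (dker_sum12 (fun d1 => Z (-1) k k a d1 a' d' b')) //.
rewrite (dker_sum1 (fun b1 => X k a b a' b1)) //.
have [<-|_] := eqVneq d b'; last by rewrite !mul0r.
rewrite !mul1r /dressed_ker; have [->|/X_neq0 [o h]] := eqVneq (X k a b a' d') 0; first by rewrite !(mul0r, mulr0).
rewrite (imfE arrP h) /= mulrCA; congr (_ * _); apply/esym/kapD.
by rewrite /kappa /ip_root_vec (s_skew sP d b) (s_skew sP d d') ![(d == _)]eq_sym; ring.
Qed.

Lemma D_braid : D12 *m D23 *m D12 = D23 *m D12 *m D23.
Proof.
have E12 (f : nat -> nat -> nat -> nat -> nat -> nat -> A) : D12 *m mx3 f =
    mx3 (fun a b d a' b' d' => qp (kappa s b a) * f b a d a' b' d').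
  rewrite mul_mx3; apply: eq_mx3 => a b d a' b' d' an bn dn a'n b'n d'n.
  rewrite -(sum_delta (fun a1 => qp (kappa s a1 a) * f a1 a d a' b' d') bn); apply: eq_bigr => a1 _.
  rewrite -(sum_delta (fun b1 => (b == a1)%:R * (qp (kappa s a1 b1) * f a1 b1 d a' b' d')) an).
  apply: eq_bigr => b1 _.
  rewrite -(sum_delta (fun d1 => (a == b1)%:R * ((b == a1)%:R * (qp (kappa s a1 b1) * f a1 b1 d1 a' b' d'))) dn).
  apply: eq_bigr => d1 _; rewrite /diag_ker.
  have [<-|_] := eqVneq b a1; last by rewrite !(mul0r, mulr0).
  by have [<-|_] := eqVneq a b1; rewrite ?(mul0r, mulr0) //; ring.
have E23 (f : nat -> nat -> nat -> nat -> nat -> nat -> A) : D23 *m mx3 f =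
    mx3 (fun a b d a' b' d' => qp (kappa s d b) * f a d b a' b' d').
  rewrite mul_mx3; apply: eq_mx3 => a b d a' b' d' an bn dn a'n b'n d'n.
  rewrite -(sum_delta (fun a1 => qp (kappa s d b) * f a1 d b a' b' d') an); apply: eq_bigr => a1 _.
  rewrite -(sum_delta (fun b1 => (a == a1)%:R * (qp (kappa s b1 b) * f a1 b1 b a' b' d')) dn).
  apply: eq_bigr => b1 _.
  rewrite -(sum_delta (fun d1 => (d == b1)%:R * ((a == a1)%:R * (qp (kappa s b1 d1) * f a1 b1 d1 a' b' d'))) bn).
  apply: eq_bigr => d1 _; rewrite /diag_ker.
  have [<-|_] := eqVneq d b1; last by rewrite !(mul0r, mulr0).
  by have [<-|_] := eqVneq b d1; rewrite ?(mul0r, mulr0) //; ring.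
rewrite -(mulmx1 (D12 *m D23 *m D12)) -(mulmx1 (D23 *m D12 *m D23)) mx3_1 -!mulmxA !(E12, E23).
by apply: eq_mx3 => *; ring.
Qed.

Lemma B0_braid : leg12 B0 *m leg23 B0 *m leg12 B0 = leg23 B0 *m leg12 B0 *m leg23 B0.
Proof.
rewrite !leg12M !leg23M leg12_Theta leg23_Theta leg12E leg23E.
have q00 := qybe arrP sP qp0 qpD 0 0.
have -> : D12 *m tu 0 *m (D23 *m tv 0) *m (D12 *m tu 0)
    = D12 *m D23 *m D12 *m (tv 0 *m tw 1 0 0 *m tu 0).
  rewrite !mulmxA -(mulmxA D12 (tu 0)) -D23_w !mulmxA -(mulmxA _ (tv 0) D12) -D12_w.
  by rewrite !mulmxA -(mulmxA (D12 *m D23) _ D12) -D12_v !mulmxA.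
have -> : D23 *m tv 0 *m (D12 *m tu 0) *m (D23 *m tv 0)
    = D23 *m D12 *m D23 *m (tu 0 *m tw (-1) 0 0 *m tv 0).
  rewrite !mulmxA -(mulmxA D23 (tv 0)) -D12_w !mulmxA -(mulmxA _ (tu 0) D23) -D23_w.
  by rewrite !mulmxA -(mulmxA (D23 *m D12) _ D23) -D23_u !mulmxA.
by rewrite D_braid q00.
Qed.

(** The twist on three legs. It has two factorizations, one ending in the twist on the legs 1 and 2
    ([leg12_J]), one ending in the twist on the legs 2 and 3 ([Psi_alt]). *)
Definition Psi N : 'M[A]_(n * n * n) := oprod (fun i => tw (-1) 0 i *m tv i) 1 N *m oprod tu 1 N.

Lemma leg12_J N : leg12 (J N) = oprod tu 1 N.
Proof.
rewrite /twist; elim: N 1%N => [|N IH] i /=; first exact: leg12_1.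
by rewrite leg12M IH leg12_Theta.
Qed.

Lemma leg23_J N : leg23 (J N) = oprod tv 1 N.
Proof.
rewrite /twist; elim: N 1%N => [|N IH] i /=; first exact: leg23_1.
by rewrite leg23M IH leg23_Theta.
Qed.

Section Twist.
Context (N : nat) (XN : forall k a b i l, (N <= k)%N -> X k a b i l = 0).

Lemma Psi_alt : Psi N = oprod (fun i => tw (-1) i.-1 i *m tu i) 1 N *m oprod tv 1 N.
Proof.
(* The dressing is taken with sign -1 at the stage j - 1; by [tw_shift] this is sign 1 at the stage
   j, as the right side of [qybe] requires. *)
rewrite /Psi -(cocycle (w := fun j p => tw (-1) j.-1 p)) //.
  move=> j i j0 /=; have := qybe arrP sP qp0 qpD j i; rewrite /= => ->.
  by congr (_ *m _ *m _); rewrite -(prednK j0) tw_shift // prednK; lia.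
move=> j p Np; rewrite /theta13.
have -> : M13 (Z (-1) j.-1 p) = 0; last by rewrite scaler0 addr0.
by apply/matrixP => r t; rewrite !mxE /dressed_ker XN // !mul0r.
Qed.

(** In each factor [qybe 0 k] reverses the order of the two unipotent matrices, and [D12_v] and
    [D12_w] restore it. *)
Lemma B0_comm12 : leg12 B0 *m oprod (fun i => tw (-1) 0 i *m tv i) 1 N
  = oprod (fun i => tw (-1) 0 i *m tv i) 1 N *m leg12 B0.
Proof.
apply: oprod_comm => k _; rewrite leg12M leg12_Theta leg12E.
have q0k := qybe arrP sP qp0 qpD 0 k; rewrite add0n in q0k.
by rewrite -!mulmxA (mulmxA (tu 0)) q0k !mulmxA D12_v -!mulmxA (mulmxA D12) D12_w !mulmxA.
Qed.

Lemma B0_comm23 : leg23 B0 *m oprod (fun i => tw (-1) i.-1 i *m tu i) 1 N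
  = oprod (fun i => tw (-1) i.-1 i *m tu i) 1 N *m leg23 B0.
Proof.
apply: oprod_comm => k k1; rewrite leg23M leg23_Theta leg23E.
have qk0 := qybe arrP sP qp0 qpD k 0; rewrite addn0 in qk0.
have wE : tw (-1) k.-1 k = tw 1 k k.
  by have := @tw_shift k.-1 k; rewrite prednK; [move=> -> //|]; lia.
rewrite wE -!mulmxA (mulmxA (tv 0)) -qk0 !mulmxA D23_u -!mulmxA (mulmxA D23) D23_w !mulmxA.
by [].
Qed.

End Twist.
End Braid.

(** * Entries of the twist *)

Section Chains.
Context (n : nat) (arr : nat -> nat -> Prop) (arrP : arrows n arr).
Context (K : numFieldType) (s : nat -> nat -> K) (sP : r0_form n arr s).
Context (A : comNzRingType) (qp : K -> A).
Hypotheses (qp0 : qp 0%R = 1%R) (qpD : forall x y, qp (x + y)%R = (qp x * qp y)%R).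
Local Notation im := (tau_im n arr).
Local Notation step := (tau_step n arr).
Local Notation X := (theta_ker n arr s qp).
Local Notation c := (qdiff qp).
Local Notation Theta := (theta_mx n arr s qp).
Local Open Scope ring_scope.

(** The entries of the product of the Theta_r for k <= r < k + L. Expanded, an entry is a sum over
    chains: (i, a) is cut into pieces starting at its right end, and strictly increasing powers of
    tau carry them onto consecutive intervals from b to l. *)
Fixpoint twist_ker (L k a b i l : nat) : A :=
  if L is L'.+1 then twist_ker L' k.+1 a b i l
    + c * \sum_(a1 < n) \sum_(b1 < n) X k a b a1 b1 * twist_ker L' k.+1 a1 b1 i l
  else ((a == i) && (b == l))%:R.

Lemma oprod_Theta L k : oprod Theta k L = mx2 n (twist_ker L k).
Proof.
elim: L k => [|L IH] k /=; first by rewrite mx2_1.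
rewrite IH mulmxDl mul1mx -scalemxAl mul_mx2.
by apply/matrixP => r t; rewrite !mxE.
Qed.

Lemma sum_neq0 (I : Type) (r : seq I) (P : pred I) (F : I -> A) :
  \sum_(x <- r | P x) F x != 0 -> exists2 x, P x & F x != 0.
Proof.
move=> sF; apply: contrapT => h; case/eqP: sF; apply: big1 => x Px; apply/eqP.
by apply: contraT => Fx; case: h; exists x.
Qed.

Lemma Jk_supp L k a b i l : twist_ker L k a b i l != 0 -> (a = i /\ b = l) \/
  exists r L' a1 b1, [/\ (k <= r)%N, (exists o, im o r a1 a b b1) & twist_ker L' r.+1 a1 b1 i l != 0].
Proof.
elim: L k => [|L IH] k /=.
  by case: (a =P i) => [->|_]; [case: (b =P l) => [->|_]; [left|rewrite eqxx]|rewrite eqxx].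
have [->|/IH + _] := eqVneq (twist_ker L k.+1 a b i l) 0; last first.
  case=> [|[r [L' [a1 [b1 [kr h1 h2]]]]]]; [by left|right].
  by exists r, L', a1, b1; split=> //; apply: ltnW.
rewrite add0r => /mul_neq0 [_ /sum_neq0 [a1 _ /sum_neq0 [b1 _ /mul_neq0 [/X_neq0 h1 h2]]]].
by right; exists k, L, a1, b1.
Qed.

Lemma Jk_ind (P : nat -> nat -> Prop) i l : P i l ->
  (forall r a1 a b b1 o, im o r a1 a b b1 -> P a1 b1 -> P a b) ->
  forall L k a b, twist_ker L k a b i l != 0 -> P a b.
Proof.
move=> P0 PS L k a; elim/ltn_ind: a L k => a IH L k b.
case/Jk_supp=> [[-> ->] //|[r [L' [a1 [b1 [_ [o h] J1]]]]]].
have [a1a _ _ _] := im_lt arrP h.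
by apply: PS h _; apply: IH J1.
Qed.

Lemma Jk_cons L k a b i l : twist_ker L k a b i l != 0 -> (i <= a)%N /\ l = (b + (a - i))%N.
Proof.
apply: (Jk_ind (P := fun a b => (i <= a)%N /\ l = (b + (a - i))%N)); first by split; lia.
by move=> r a1 a' b' b1 o [? ? _] [? ?]; split; lia.
Qed.

Lemma Jk_bound L k a b i l : twist_ker L k a b i l != 0 -> (i < a)%N -> (a < n)%N /\ (l < n)%N.
Proof.
move=> J0; suff: (a = i /\ b = l) \/ (a < n)%N /\ (l < n)%N by case: J0 => ? [[-> _]|//]; lia.
apply: (Jk_ind (P := fun a b => (a = i /\ b = l) \/ (a < n)%N /\ (l < n)%N)) J0; first by left.
move=> r a1 a' b' b1 o h [[e1 e2]|[_ ln]]; right; have [? ? ? ?] := im_lt arrP h; split=> //.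
by rewrite -e2.
Qed.

(** Along a chain the interval (b, l) is a rearrangement of images of the pieces of (i, a), so
    functions constant along the arrows used have equal sums. *)
Lemma Jk_sum (V : zmodType) (F : nat -> V) L k a b i l : twist_ker L k a b i l != 0 ->
  (forall r x y, (k <= r)%N -> (i <= x < a)%N -> (b <= y < l)%N -> step r x y -> F x = F y) ->
  \sum_(i <= x < a) F x = \sum_(b <= y < l) F y.
Proof.
elim/ltn_ind: a L k b => a IH L k b J0.
have [ia lE] := Jk_cons J0; case: (Jk_supp J0) => [[<- <-] _|]; first by rewrite !big_geq.
move=> [r [L' [a1 [b1 [kr [o h] J1]]]]] FF.
have [a1a an bb1 b1n] := im_lt arrP h; have [ia1 lE1] := Jk_cons J1.
rewrite (big_cat_nat ia1 (ltnW a1a)) /= [RHS](@big_cat_nat _ _ _ b1) /=; [|lia..].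
rewrite addrC; congr (_ + _).
  apply: (im_sum h) => x y xa xy; apply: (FF r _ _ _ _ _ xy) => //; first by lia.
  have [y' xy' yb] := im_root h xa; rewrite (step_fun arrP xy xy').
  by lia.
by apply: IH a1a _ _ _ J1 _ => r' x y rr xa yb; apply: FF; lia.
Qed.

Lemma Jk_dom L k a b i l x : twist_ker L k a b i l != 0 -> (i <= x < a)%N ->
  exists r y, [/\ (k <= r)%N, step r x y & (b <= y < l)%N].
Proof.
elim/ltn_ind: a L k b => a IH L k b J0 xa.
case: (Jk_supp J0) => [[]|]; first by lia.
move=> [r [L' [a1 [b1 [kr [o h] J1]]]]].
have [a1a an bb1 b1n] := im_lt arrP h; have [ia1 lE1] := Jk_cons J1.
have [xa1|a1x] := ltnP x a1.
  have [|r' [y [rr xy yb]]] := IH _ a1a _ _ _ J1 _; first by lia.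
  by exists r', y; split=> //; lia.
have [|y xy yb] := im_root h (x := x); first by lia.
by exists r, y; split=> //; lia.
Qed.

Lemma Jk_cod L k a b i l y : twist_ker L k a b i l != 0 -> (b <= y < l)%N ->
  exists r x, [/\ (k <= r)%N, step r x y & (i <= x < a)%N].
Proof.
elim/ltn_ind: a L k b => a IH L k b J0 yl.
case: (Jk_supp J0) => [[]|]; first by lia.
move=> [r [L' [a1 [b1 [kr [o h] J1]]]]].
have [a1a an bb1 b1n] := im_lt arrP h; have [ia1 lE1] := Jk_cons J1.
have [yb1|b1y] := ltnP y b1.
  move/(im_cnv arrP): h => /(im_root (x := y)) [|x /(step_cnv arrP) xy xa]; first by lia.
  by exists r, x; split=> //; lia.
have [|r' [x [rr xy xa]]] := IH _ a1a _ _ _ J1 _; first by lia.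
by exists r', x; split=> //; lia.
Qed.

Lemma Jk_id L k a b : twist_ker L k a b a b = 1.
Proof.
elim: L k => [|L IH] k /=; first by rewrite !eqxx.
rewrite IH big1 ?mulr0 ?addr0 // => a1 _; rewrite big1 // => b1 _; apply/eqP.
by apply: contraT => /mul_neq0 [/(X_cons arrP) [? _ _ _ _] /Jk_cons [? _]]; lia.
Qed.

Lemma Jk_eq0 L k a b i l : (a <= i)%N -> (a, b) <> (i, l) -> twist_ker L k a b i l = 0.
Proof.
move=> ai ne; apply/eqP; apply: contraT => /Jk_cons [ia lE]; case: ne; congr (_, _); lia.
Qed.

Lemma Jk_rec L k a b i l : twist_ker L.+1 k a b i l = twist_ker L k.+1 a b i l
  + c * \sum_(t < a - i) X k a b (i + t) (b + (a - (i + t)))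
                        * twist_ker L k.+1 (i + t) (b + (a - (i + t))) i l.
Proof.
rewrite /=; congr (_ + _ * _).
pose F a1 := X k a b a1 (b + (a - a1)) * twist_ker L k.+1 a1 (b + (a - a1)) i l.
have FE (a1 : nat) : \sum_(b1 < n) X k a b a1 b1 * twist_ker L k.+1 a1 b1 i l = F a1.
  apply: (sum_at (F := fun b1 => X k a b a1 b1 * twist_ker L k.+1 a1 b1 i l)).
    by move=> b1 /mul_neq0 [/(X_cons arrP) [_ _ _ _ ->]].
  by move=> nb; apply/eqP; apply: contraT => /mul_neq0 [/(X_cons arrP) [_ _ _ ? _]]; lia.
rewrite (eq_bigr (fun a1 : 'I_n => F a1)); last by move=> a1 _; apply: FE.
have F0 a1 : F a1 != 0 -> (i <= a1 < a)%N /\ (a < n)%N.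
  by move=> /mul_neq0 [/(X_cons arrP) [? ? _ _ _] /Jk_cons [? _]]; split=> //; lia.
have [na|an] := leqP n a.
  have F00 a1 : F a1 = 0 by apply/eqP; apply: contraT => /F0 [_]; lia.
  by rewrite [LHS]big1 ?[RHS]big1 // => t _; rewrite -?[LHS]/(F (i + t)%N) F00.
have F1 (m1 m2 : nat) : (m2 <= i)%N || (a <= m1)%N -> \sum_(m1 <= x < m2) F x = 0.
  move=> h; rewrite big_nat_cond big1 // => x xm; apply/eqP; apply: contraT => /F0 [ia _].
  by move: xm h; lia.
rewrite -(big_mkord xpredT F) -(big_mkord xpredT (fun t => F (i + t)%N)).
have [ai|ia] := leqP a i.
  rewrite [RHS]big_geq; last by lia.
  rewrite (@big_cat_nat _ _ _ a 0%N n) /= ?(ltnW an) //.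
  by rewrite (F1 0%N a) ?ai // (F1 a n) ?leqnn ?orbT // addr0.
have -> : \sum_(0 <= x < n) F x = \sum_(i <= x < a) F x.
  rewrite (@big_cat_nat _ _ _ i 0%N n) /= ?(ltnW (ltn_trans ia an)) //.
  rewrite (@big_cat_nat _ _ _ a i n) /= ?(ltnW an) ?(ltnW ia) //.
  by rewrite (F1 0%N i) ?leqnn // (F1 a n) ?leqnn ?orbT // addr0 add0r.
by rewrite -{1}(add0n i) big_addn; apply: eq_bigr => t _; rewrite addnC.
Qed.

End Chains.

(** * Transport of the entries of the twist by an orientation preserving power *)

Section Shifts.
Context (n : nat) (arr : nat -> nat -> Prop) (arrP : arrows n arr).
Context (K : numFieldType) (s : nat -> nat -> K) (sP : r0_form n arr s).
Context (A : comNzRingType) (qp : K -> A).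
Hypotheses (qp0 : qp 0%R = 1%R) (qpD : forall x y, qp (x + y)%R = (qp x * qp y)%R).
Context (N : nat) (nil : forall k x y, N <= k -> ~ tau_step n arr k x y).
Local Notation im := (tau_im n arr).
Local Notation step := (tau_step n arr).
Local Notation X := (theta_ker n arr s qp).
Local Notation c := (qdiff qp).
Local Notation Xcons := (X_cons arrP).
Local Open Scope ring_scope.

Lemma im_nil o k i j u v : (N <= k)%N -> ~ im o k i j u v.
Proof. by move=> Nk [ij _ /(_ i)] h; apply: (nil Nk (h _)); lia. Qed.

Lemma X_nil k a b i l : (N <= k)%N -> X k a b i l = 0.
Proof. by move=> Nk; apply: X_eq0 => o /(im_nil Nk). Qed.

Lemma Jk_ext L k a b i l : (N <= k + L)%N -> twist_ker n arr s qp L.+1 k a b i l = twist_ker n arr s qp L k a b i l.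
Proof.
elim: L k a b => [|L IH] k a b kL.
  rewrite /= big1 ?mulr0 ?addr0 // => a1 _; rewrite big1 // => b1 _.
  by rewrite X_nil ?mul0r //; lia.
have E M : twist_ker n arr s qp M.+1 k a b i l = twist_ker n arr s qp M k.+1 a b i l
    + c * \sum_(a1 < n) \sum_(b1 < n) X k a b a1 b1 * twist_ker n arr s qp M k.+1 a1 b1 i l by [].
rewrite [LHS]E [RHS]E IH; last by lia.
congr (_ + _ * _); apply: eq_bigr => a1 _; apply: eq_bigr => b1 _.
by rewrite IH //; lia.
Qed.

(* Locked: unification would otherwise unfold the fixpoint. *)
Definition twist_tail : nat -> nat -> nat -> nat -> nat -> A := locked (twist_ker n arr s qp N.+1).
Local Notation JJ := twist_tail.

Lemma JJE k a b i l : JJ k a b i l = twist_ker n arr s qp N.+1 k a b i l.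
Proof. by rewrite /twist_tail -lock. Qed.

Lemma JJ_nil k a b i l : (N <= k)%N -> JJ k a b i l = ((a == i) && (b == l))%:R.
Proof. by move=> Nk; rewrite JJE; elim: N => [|M IH]; rewrite Jk_ext //; lia. Qed.

Lemma JJ_rec k a b i l : JJ k a b i l = JJ k.+1 a b i l
  + c * \sum_(t < a - i) X k a b (i + t) (b + (a - (i + t)))
                        * JJ k.+1 (i + t) (b + (a - (i + t))) i l.
Proof.
rewrite !JJE (Jk_rec arrP) -Jk_ext; last by lia.
by congr (_ + _ * _); apply: eq_bigr => t _; rewrite JJE -Jk_ext //; lia.
Qed.

Lemma Jcons k a b i l : JJ k a b i l != 0 -> (i <= a)%N /\ l = (b + (a - i))%N.
Proof. by rewrite JJE => /(Jk_cons arrP). Qed.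

Lemma JJ_bound k a b i l : JJ k a b i l != 0 -> (i < a)%N -> (a < n)%N /\ (l < n)%N.
Proof. by rewrite JJE => /(Jk_bound arrP) h /h. Qed.

Lemma JJ_supp k a b i l : JJ k a b i l != 0 -> (a = i /\ b = l) \/
  exists r a1 b1, (k <= r)%N /\ exists o, im o r a1 a b b1 /\ (i <= a1)%N.
Proof.
rewrite JJE => /Jk_supp [|[r [L' [a1 [b1 [kr [o h] /(Jk_cons arrP) [ia _]]]]]]]; first by left.
by right; exists r, a1, b1; split=> //; exists o.
Qed.

Lemma JJ_sum (V : zmodType) (F : nat -> V) k a b i l : JJ k a b i l != 0 ->
  (forall r x y, (k <= r)%N -> (i <= x < a)%N -> (b <= y < l)%N -> step r x y -> F x = F y) ->
  \sum_(i <= x < a) F x = \sum_(b <= y < l) F y.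
Proof. by rewrite JJE; apply: (Jk_sum arrP). Qed.

Lemma JJ_dom k a b i l x : JJ k a b i l != 0 -> (i <= x < a)%N ->
  exists r y, [/\ (k <= r)%N, step r x y & (b <= y < l)%N].
Proof. by rewrite JJE; apply: (Jk_dom arrP). Qed.

Lemma JJ_cod k a b i l y : JJ k a b i l != 0 -> (b <= y < l)%N ->
  exists r x, [/\ (k <= r)%N, step r x y & (i <= x < a)%N].
Proof. by rewrite JJE; apply: (Jk_cod arrP). Qed.

Lemma JJ_diag k a b l : JJ k a b a l = (b == l)%:R.
Proof.
rewrite JJE; have [<-|bl] := eqVneq b l; first by rewrite (Jk_id arrP).
by rewrite (Jk_eq0 arrP) // => -[e]; rewrite e eqxx in bl.
Qed.

Lemma xw_shift o i a b l u v : (a - i = v - u)%N ->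
  hop_w s qp o i a b l = qp (s i a - s u v) * hop_w s qp o u v b l.
Proof. by move=> E; rewrite /hop_w E mulrCA -qpD; congr (_ * qp _); ring. Qed.

Lemma xw_shift2 o i a b l u v : hop_w s qp o i a b l = qp (s b l - s u v) * hop_w s qp o i a u v.
Proof. by rewrite /hop_w mulrCA -qpD; congr (_ * qp _); ring. Qed.

Lemma X_shift g i a u v k b l : im false g i a u v ->
  X (g + k) a b i l = qp (s i a - s u v) * X k v b u l.
Proof.
move=> h; have [ia vE _] := h.
have [[o h1]|nh] := pselect (exists o, im o k u v b l).
  by rewrite (XE arrP s qp h1) (XE arrP s qp (im_comp arrP h h1)) /=; apply: xw_shift; lia.
rewrite !X_eq0 ?mulr0 // => o h1; first by apply: nh; exists o.
move: h1 => /(im_decomp arrP) [o1 [u1 [v1 [h1 h2]]]].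
by have [e1 e2] := im_fun arrP h h1; subst u1 v1; apply: nh; eexists; exact: h2.
Qed.

Lemma X_shift2 g i a u v k b l : im false g b l u v ->
  X (k + g) a u i v = qp (s u v - s b l) * X k a b i l.
Proof.
move=> h; have [ia vE _] := h.
have [[o h1]|nh] := pselect (exists o, im o k i a b l).
  have h2 := im_comp arrP h1 h; rewrite addbF in h2.
  by rewrite (XE arrP s qp h1) (XE arrP s qp h2) (xw_shift2 _ _ _ _ _ b l).
rewrite !X_eq0 ?mulr0 // => o h1; first by apply: nh; exists o.
move: h1 => /(im_decomp arrP) [o1 [u1 [v1 [h1 h2]]]].
by have [e1 e2] := im_inj arrP h h2; subst u1 v1; apply: nh; eexists; exact: h1.
Qed.

Lemma s_split g i j u v t : im false g i j u v -> (t <= j - i)%N ->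
  s i j - s u v = (s i (i + t) - s u (u + t)) + (s (i + t) j - s (u + t) v).
Proof.
move=> h tj; have [ij vE _] := h.
have [t0|t0] := eqVneq t 0%N; first by rewrite t0 !addn0 !(s_diag sP) subrr add0r.
have [te|te] := eqVneq t (j - i)%N.
  have [-> ->] : (i + t = j /\ u + t = v)%N by lia.
  by rewrite !(s_diag sP) subrr addr0.
have : s i j - s i (i + t) - s (i + t) j = s u v - s u (u + t) - s (u + t) v.
  by apply: (s_catF arrP sP h); lia.
move=> H.
have -> : s i j = (s i j - s i (i + t) - s (i + t) j) + s i (i + t) + s (i + t) j by ring.
by rewrite H; ring.
Qed.

Lemma im_subt g i j u v t1 t2 : im false g i j u v -> (t1 < t2)%N -> (t2 <= j - i)%N ->
  im false g (i + t1) (i + t2) (u + t1) (u + t2).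
Proof.
move=> h t12 t2j; have [ij vE _] := h.
have := im_subF h (i' := (i + t1)%N) (j' := (i + t2)%N).
by rewrite !(addnC i) !addnK !(addnC u); apply; lia.
Qed.

(** A power tau ^ g that preserves the orientation of (i, a) can be stripped from every hop of a
    chain; the exponents lost at the successive cuts add up by [s_split]. The induction descends
    from the trivial level N and treats all initial segments (i, i + t), since the rest of a chain
    starts from one of them. *)
Lemma JJ_shift g i a u v b l : im false g i a u v -> forall k, 
  JJ (g + k) a b i l = qp (s i a - s u v) * JJ k v b u l.
Proof.
move=> h; have [ia vE _] := h.
suff gen d : forall k t b, (N <= k + d)%N -> (t <= a - i)%N ->
    JJ (g + k) (i + t) b i l = qp (s i (i + t) - s u (u + t)) * JJ k (u + t) b u l.
  move=> k; have := gen N k (a - i)%N b; rewrite leq_addl leqnn => /(_ isT isT).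
  have [-> ->] : (i + (a - i) = a /\ u + (a - i) = v)%N by lia.
  by apply.
elim: d => [|d IH] k t {}b Nk ta.
  rewrite !JJ_nil; [|lia..].
  case: t ta => [|t] ta; first by rewrite !addn0 !eqxx !(s_diag sP) subrr qp0 mul1r.
  have -> : (i + t.+1 == i)%N = false by lia.
  have -> : (u + t.+1 == u)%N = false by lia.
  by rewrite /= mulr0.
rewrite JJ_rec [X in _ = _ * X]JJ_rec -addnS IH; [|lia..].
rewrite mulrDr mulrCA; congr (_ + _ * _).
rewrite (_ : i + t - i = u + t - u)%N; last by lia.
rewrite mulr_sumr; apply: eq_bigr => -[t1 /= t1t] _.
rewrite (_ : i + t - (i + t1) = u + t - (u + t1))%N; last by lia.
have h1 : im false g (i + t1) (i + t) (u + t1) (u + t) by apply: (im_subt h); lia.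
rewrite (X_shift _ _ _ h1) IH; [|lia..].
have [t0|t0] := posnP t; first by lia.
have h2 : im false g i (i + t) u (u + t) by have := im_subt h t0 ta; rewrite !addn0.
rewrite (s_split h2 (t := t1)); last by lia.
by rewrite [X in _ = X * _]qpD; ring.
Qed.

Lemma JJ_shift2 g a f a' f' k b i : im false g a f a' f' ->
  JJ (g + k) b a' i f' = qp (s a' f' - s a f) * JJ k b a i f.
Proof.
move=> h; have [af fE _] := h.
have [ib|bi] := leqP i b; last first.
  have JJ0 k' y y' : JJ k' b y i y' = 0.
    by apply/eqP; apply: contraT => /Jcons [? _]; lia.
  by rewrite !JJ0 mulr0.
suff gen d : forall k t b, (N <= k + d)%N -> (t <= f - a)%N -> (i <= b)%N ->
    JJ (g + k) b (a' + t) i f' = qp (s (a' + t) f' - s (a + t) f) * JJ k b (a + t) i f.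
  by have := gen N k 0%N b; rewrite !addn0; apply; lia.
elim: d => [|d IH] {ib}{}k t {}b Nk ta ib; have [te|te] := eqVneq t (f - a)%N.
- have [-> ->] : (a + t = f /\ a' + t = f')%N by lia.
  by rewrite !(s_diag sP) subrr qp0 mul1r !JJ_nil ?eqxx; [|lia..].
- rewrite !JJ_nil; [|lia..].
  have -> : (a' + t == f')%N = false by lia.
  have -> : (a + t == f)%N = false by lia.
  by rewrite !andbF mulr0.
- have [-> ->] : (a + t = f /\ a' + t = f')%N by lia.
  rewrite !(s_diag sP) subrr qp0 mul1r; have [->|ne] := eqVneq b i; first by rewrite !JJ_diag !eqxx.
  have Z k' y : JJ k' b y i y = 0 by apply/eqP; apply: contraT => /Jcons [_ ?]; lia.
  by rewrite !Z.
rewrite JJ_rec [X in _ = _ * X]JJ_rec -addnS IH; [|lia..].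
rewrite mulrDr mulrCA; congr (_ + _ * _).
rewrite mulr_sumr; apply: eq_bigr => -[t1 /= t1t] _.
set m := (b - (i + t1))%N; rewrite -!addnA.
have [tf|ft] := leqP (t + m) (f - a); last first.
  have Z y z : (z < y)%N -> JJ k.+1 (i + t1) y i z = 0 /\ JJ (g + k.+1) (i + t1) y i z = 0.
    by move=> zy; split; apply/eqP; apply: contraT => /Jcons [? ?]; lia.
  have [|-> _] := Z (a + (t + m))%N f; first by lia.
  have [|_ ->] := Z (a' + (t + m))%N f'; first by lia.
  by rewrite !mulr0.
have h1 : im false g (a + t) (a + (t + m)) (a' + t) (a' + (t + m)) by apply: (im_subt h); lia.
rewrite (addnC g) (X_shift2 _ _ _ h1) IH; [|lia..].
have h2 : im false g (a + t) f (a' + t) f'.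
  have := im_subt h (t1 := t) (t2 := (f - a)%N).
  have [-> ->] : (a + (f - a) = f /\ a' + (f - a) = f')%N by lia.
  by apply; lia.
have E := s_split h2 (t := m); rewrite -!addnA in E.
rewrite -[s (a' + t)%N f' - _]opprB E; last by lia.
by rewrite opprD !opprB [X in _ = X * _]qpD; ring.
Qed.

(** Since tau ^ 0 carries an interval only to itself, Theta_0 does no more than exchange the two
    legs when a < b. *)
Lemma JJ0 b a i f : (b < n)%N ->
  JJ 0 b a i f = JJ 1 b a i f + (a < b)%:R * (c * qp (s a b *+ 2) * JJ 1 a b i f).
Proof.
move=> bn; rewrite JJ_rec; congr (_ + _).
have X0 t w : (X 0 b a (i + t) w != 0) -> i + t = a /\ w = b.
  by move=> /X_neq0 [o /(im0E arrP)] [-> ->].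
have [ab|ba] := ltnP a b; last first.
  rewrite mul0r big1 ?mulr0 // => -[t /= tb] _; apply/eqP; apply: contraT => /mul_neq0 [/X0].
  by lia.
rewrite mul1r -mulrA; congr (_ * _); have [ia|ai] := leqP i a; last first.
  rewrite big1; last first.
    by move=> -[t /= tb] _; apply/eqP; apply: contraT => /mul_neq0 [/X0]; lia.
  have -> : JJ 1 a b i f = 0 by apply/eqP; apply: contraT => /Jcons [? _]; lia.
  by rewrite mulr0.
have tb : (a - i < b - i)%N by lia.
rewrite (bigD1 (Ordinal tb)) //= big1 ?addr0; last first.
  move=> -[t /= tb'] ne; apply/eqP; apply: contraT => /mul_neq0 [/X0 [e _] _].
  by case/eqP: ne; apply: val_inj => /=; lia.
rewrite (_ : i + (a - i) = a)%N; last by lia.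
rewrite (_ : a + (b - a) = b)%N; last by lia.
rewrite (XE arrP s qp (@im0 n arr a b _)); last by lia.
by rewrite /hop_w /= mul1r mulr2n.
Qed.

End Shifts.

(** * Entries of the twisted matrix *)

Section Hops.
Context (n : nat) (arr : nat -> nat -> Prop) (arrP : arrows n arr).
Local Notation im := (tau_im n arr).
Local Notation step := (tau_step n arr).

Definition tau_imx (p i j u v : nat) : Prop := exists o, im o p i j u v.
Local Notation imx := tau_imx.

(* A root of length 1 has no orientation, so (i, i + 1) is tested on (i, i + 2). *)
Definition reverses (g i a : nat) : Prop :=
  forall r u v, 0 < r < g -> ~ im false r i (maxn a i.+2) u v.
Local Notation low := reverses.

Lemma low_rev g i a o r f u v : low g i a -> 0 < r < g -> maxn a i.+2 <= f ->
  im o r i f u v -> o = true.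
Proof.
move=> lw rg jf h; case: o h => // h.
by have := im_subF h (leqnn i) _ jf => /(_ _)/(lw _ _ _ rg) []; lia.
Qed.

Lemma pres_ext g i j u v o f u1 v1 : im false g i j u v -> i.+1 < j <= f ->
  im o g i f u1 v1 -> o = false /\ u1 = u.
Proof.
move=> h /andP[ij jf] h1; have h2 := im_sub h1 (leqnn i) (ltnW ij) jf.
have oE := im_or arrP ij h2 h; rewrite oE in h2 *.
by have [e _] := im_fun arrP h2 h; split=> //; rewrite -e subnn addn0.
Qed.

Lemma imx_shift o g i f u v r x y : im o g i f u v ->
  imx (g + r) i f x y <-> imx r u v x y.
Proof.
move=> h; split=> -[o1 h1].
  have [o2 [u2 [v2 [h2 h3]]]] := im_decomp arrP h1.
  by have [e1 e2] := im_fun arrP h h2; subst u2 v2; eexists; exact: h3.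
by eexists; exact: im_comp h h1.
Qed.

Lemma imx_pre o g i f u v r x y : im o g x y u v ->
  imx (r + g) i f u v <-> imx r i f x y.
Proof.
move=> h; split=> -[o1 h1].
  have [o2 [u2 [v2 [h2 h3]]]] := im_decomp arrP h1.
  by have [e1 e2] := im_inj arrP h h3; subst u2 v2; eexists; exact: h2.
by eexists; exact: im_comp h1 h.
Qed.

End Hops.

(** * Stages at which an orbit touches its ends *)

Section Passes.
Context (n : nat) (arr : nat -> nat -> Prop) (arrP : arrows n arr).
Local Notation im := (tau_im n arr).
Local Notation step := (tau_step n arr).
Local Notation imx := (tau_imx n arr).
Local Notation low := (reverses n arr).

(** For (k, l) the image of (i, f) under tau ^ p, the stage r of the orbit lies directly to the left
    of its last interval, and the stage p - r directly to the right of its first. Each such r lowers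
    the exponent of a hop by 2. *)
Definition passes_through (p r f k i : nat) : bool :=
  `[< imx r i f (k - (f - i)) k /\ imx (p - r) i f f (f + (f - i)) >].
Local Notation passes := passes_through.

(** The interval (i, f) and the one of equal length that begins at f would have neighbouring images
    under tau ^ r in the same order, so tau ^ r would preserve the orientation although r < g. *)
Lemma passes_low g i a o p r f k l : low g i a -> a <= f -> im o p i f k l -> 0 < r < g -> r < p ->
  ~~ passes p r f k i.
Proof.
move=> lw af h rg rp; apply/asboolP => -[[o1 h1] [o2 h2]].
have := h; rewrite -{1}(subnK (ltnW rp)) => /(im_decomp arrP) [o3 [u3 [v3 [h3 h4]]]].
have [e1 e2] := im_fun arrP h2 h3; subst u3 v3.
have [i_f _ _ _] := im_lt arrP h; have [_ _ kl _] := im_lt arrP h.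
case: (im_cat arrP h1 h4) => -[h5 e].
  have := im_subF h5 (leqnn i) (j' := maxn a i.+2) _ _.
  by move=> h6; apply: lw (rg) (h6 _ _); lia.
by have [? _ ? _] := im_lt arrP h5; lia.
Qed.

(** Only the stage g itself is new: the orbit is then at (i', f'), which ends at k exactly if f' =
    k. For later stages the preservation of orientation at i transfers the condition at f to the
    condition at f'. *)
Lemma passes_shift g i a o p f k l i' f' r j0 j0' : low g i a -> i < a <= f ->
  j0 = maxn a i.+2 -> im false g i j0 i' j0' ->
  im false g i f i' f' -> im o p i' f' k l -> r < p ->
  passes (g + p) (g + r) f k i = if r is 0 then f' == k else passes p r f' k i'.
Proof.
move=> lw af jE hj h hp rp; have [i_f f'E _] := h; have [i_f' lE _] := hp.
have L : f' - i' = f - i by lia.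
have eqv t : t <= p -> imx (p - t) i f f (f + (f - i)) <-> imx (g + (p - t)) i f f' (f' + (f - i)).
  move=> tp; split=> -[o1 h1].
    have := im_comp arrP h hp; rewrite (_ : g + p = p - t + (g + t)); last by lia.
    move=> /(im_decomp arrP) [o2 [u2 [v2 [h2 h3]]]].
    have [e1 e2] := im_fun arrP h1 h2; subst u2 v2.
    have [o4 [u4 [v4 [h4 _]]]] := im_decomp arrP h3.
    case: (im_cat arrP h h4) => -[h5 e].
      have [_ v4E _] := h5; move: h4; rewrite -e => h4.
      have := im_comp arrP h1 h4; rewrite addnC => h6; eexists.
      by rewrite (_ : f' + (f - i) = v4); [exact: h6|lia].
    by have [] := pres_ext arrP hj _ h5; lia.
  move: h1; rewrite addnC => /(im_decomp arrP) [o2 [u2 [v2 [h2 h3]]]].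
  case: (im_cat_inv arrP h h3) => -[h5 e].
    subst u2; exists o2; have [_ v2E _] := h2.
    by rewrite (_ : f + (f - i) = v2); [exact: h2|lia].
  move: hj => /(im_cnv arrP) hj; move: h5 => /(im_cnv arrP) h5.
  have [hj1 hj2 _] := hj.
  by have [] := pres_ext (arrows_cnv arrP) hj _ h5; lia.
rewrite /passes_through; case: r rp => [|r] rp; last first.
  rewrite L; apply/asbool_equiv_eq; rewrite (imx_shift arrP _ _ _ h).
  rewrite subnDl; have := eqv r.+1 (ltnW rp); rewrite (imx_shift arrP _ _ _ h).
  by move=> E; split=> -[h1 h2]; split=> //; apply/E.
rewrite addn0 (addnC g) addnK.
have := eqv 0 (leq0n _); rewrite subn0 => E.
apply/asboolP/eqP => [[[o1 h1] _]|e]; first by have [] := im_fun arrP h h1.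
split; first by exists false; rewrite (_ : k - (f - i) = i') -?e //; lia.
apply/E; exists (false (+) o); rewrite e (_ : k + (f - i) = l); last by lia.
exact: im_comp h hp.
Qed.

End Passes.

(** * Chains excluded by orientation and nilpotency *)

Section Vanishing.
Context (n : nat) (arr : nat -> nat -> Prop) (arrP : arrows n arr).
Context (K : numFieldType) (s : nat -> nat -> K) (sP : r0_form n arr s).
Context (A : comNzRingType) (qp : K -> A).
Hypotheses (qp0 : qp 0%R = 1%R) (qpD : forall x y, qp (x + y)%R = (qp x * qp y)%R).
Context (N : nat) (nil : forall k x y, N <= k -> ~ tau_step n arr k x y).
Local Notation im := (tau_im n arr).
Local Notation step := (tau_step n arr).
Local Notation low := (reverses n arr).
Local Notation X := (theta_ker n arr s qp).
Local Notation c := (qdiff qp).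
Local Notation JJ := (twist_tail n arr s qp N).
Local Notation Jcons := (Jcons arrP).
Local Notation Xcons := (X_cons arrP).
Local Notation kap := (kappa s).
Local Open Scope ring_scope.

(** Below g a chain is a single hop. Suppose that its first hop, of power k, covers only a right
    part of (i, a). Then tau ^ k is defined on all of (i, a), since the later hops have larger
    powers, and it reverses the interval. So the next piece has the same image under tau ^ k as
    under the power of its own hop, against [im_self]. *)
Lemma JJ_low g i a b l k : low g i a -> (i < a)%N -> (0 < k <= g)%N ->
  JJ k a b i l = \sum_(k <= r < g) c * X r a b i l + JJ g a b i l.
Proof.
move=> lw ia.
suff gen d : forall k, (0 < k)%N -> (k + d = g)%N ->
    JJ k a b i l = \sum_(k <= r < g) c * X r a b i l + JJ g a b i l.
  by case/andP=> k0 kg; apply: (gen (g - k)%N); lia.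
elim: d => [|d IH] {}k k0 kg; first by rewrite big_geq ?add0r -?kg ?addn0.
rewrite (JJ_rec arrP s qp nil) big_ltn; last by lia.
rewrite -addrA IH; [|lia..]; rewrite [RHS]addrC; congr (_ + _ * _).
have t0 : (0 < a - i)%N by lia.
rewrite (bigD1 (Ordinal t0)) //= big1 ?addr0.
  rewrite !addn0 (JJ_diag arrP); have [<-|ne] := eqVneq; first by rewrite mulr1.
  rewrite mulr0; apply/esym/eqP; apply: contraT => /Xcons [_ _ _ _ E].
  by rewrite E eqxx in ne.
move=> -[t /= ta] ne; apply/eqP; apply: contraT => /mul_neq0 [/X_neq0 [o h] J1].
have {ne} t1 : (0 < t)%N.
  by rewrite lt0n; apply: contraNneq ne => e; apply/eqP; apply: val_inj.
case: (im_lt arrP h) => _ an _ ln; have [it lE] := Jcons J1.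
have [x xia|o' [u [v h']]] := @im_of_dom n arr arrP k i a ia.
  have [xt|tx] := ltnP x (i + t)%N; last by have [|y xy _] := im_root h (x := x); [lia|exists y].
  have [|r [y [kr xy _]]] := JJ_dom arrP J1 (x := x); first by lia.
  by move: xy; rewrite -(subnKC (ltnW kr)) => /(stepD arrP) [z xz _]; exists z.
have oT : o' = true by apply: (low_rev lw _ _ h'); lia.
rewrite oT in h'; have h1 := im_subT h' (i' := (i + t)%N) (j' := a).
have {}h1 : im true k (i + t) a (v - (a - i)) (v - t).
  by have := h1 _ _ _; rewrite addnC addnK; apply; lia.
have [e1 e2] := im_fun arrP h h1.
case: (JJ_supp arrP J1) => [[e _]|[r [a1 [b1 [kr [o1 [h2 ia1]]]]]]]; first by lia.
have [a1t _ _ _] := im_lt arrP h2.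
have h3 := im_subT h' ia1 a1t.
have {}h3 : im true k a1 (i + t) (v - t) (v - (a1 - i)).
  by have := h3 _; rewrite addnC addnK; apply; lia.
have [_ b1E _] := h2; have [_ b1E' _] := h3; have [_ vE _] := h'.
have bE : (b + (a - (i + t)) = v - t)%N by lia.
rewrite bE in h2 b1E.
have := im_self arrP h3 _; rewrite b1E' -b1E => /(_ _ _ h2).
by lia.
Qed.

(* The interval (a, f) would be carried by a power of tau onto (i, b), which is covered
   by pieces that powers of tau carry into (a, f), against the nilpotency of tau. *)
Lemma no_cycle k p o a b f i : JJ k b a i f != 0 -> (i < b)%N -> im o p a f i b ->
  (0 < k + p)%N -> False.
Proof.
move=> J0 ib h kp; apply: (step_stable arrP (W := fun x => (i <= x < b)%N) (x0 := i)); first by lia.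
move=> x xi; have [r [y [kr xy ya]]] := JJ_dom arrP J0 xi.
have [z yz zi] := im_root h ya.
by exists (r + p)%N, z; split=> //; [lia|apply/(stepD arrP); exists y].
Qed.

(** The hop of power r has an image that touches (i', a') at a'. As tau ^ g is composed of two
    reversals with middle stage g - r, [im_cat_inv] places (b1, b) directly to the left of the
    middle image of (i, a). Then (k, l) is covered by (k, b1), (b1, b) and this middle image, and
    positive powers carry all their roots into (i', f'); since tau ^ p carries (i', f') onto (k, l),
    nilpotency is violated. *)
Lemma levels_vanish g i a i' j0 j0' r b b1 a1 k l p o o1 a' f' :
  low g i a -> (i < a)%N -> j0 = maxn a i.+2 -> im false g i j0 i' j0' ->
  (0 < r < g)%N -> a' = (i' + (a - i))%N -> f' = (a' + (b - k))%N -> (k < b)%N ->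
  im o1 r b1 b a' a1 -> JJ r.+1 b1 a1 k f' != 0 -> im o p i' f' k l -> False.
Proof.
move=> lw ia jE hj rg a'E f'E kb h1 J1 hp.
have [ij j0'E _] := hj; have [b1b bn a'a1 _] := im_lt arrP h1; have [kb1 f'E1] := Jcons J1.
have [_ a1E _] := h1; have [_ lE _] := hp.
move: (hj); rewrite -(subnK (ltnW (proj2 (andP rg)))) => /(im_decomp arrP) [o2 [u [v [h2 h3]]]].
have o2T : o2 = true by apply: (low_rev lw _ _ h2); lia.
rewrite o2T /= in h2 h3; have [_ vE _] := h2.
have hS : im true (g - r) i a (v - (a - i)) v.
  by have := im_subT h2 (leqnn i) ia; rewrite subnn subn0; apply; lia.
have hS' : im true r (v - (a - i)) v i' a'.
  have := im_subT h3 (i' := (v - (a - i))%N) (j' := v) _ _ (leqnn _).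
  have -> : (j0' - (v - u) = i')%N by lia.
  have -> : (j0' - (v - (a - i) - u) = a')%N by lia.
  by apply; lia.
case: (im_cat_inv arrP hS' h1) => -[h4 e].
  have h5 := im_subF h4 (leqnn _) (j' := (v - (a - i) + (j0 - i))%N).
  have {}h5 : im false r (v - (a - i)) (v - (a - i) + (j0 - i)) i' j0'.
    have := h5 _ _; rewrite subnn addn0 addnC addnK (_ : i' + (j0 - i) = j0')%N; last by lia.
    by have [? ? _ _] := im_lt arrP h4; apply; lia.
  have [e1 e2] := im_inj arrP h3 h5; rewrite e2 e1 in h3.
  have e3 : ((v - (a - i)).+1 < v - (a - i) + (j0 - i))%N by lia.
  by have := im_or arrP e3 h3 h5.
rewrite -e in hS hS'.
apply: (step_stable arrP (W := fun x => (k <= x < l)%N) (x0 := k)); first by lia.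
suff sub x : (k <= x < l)%N -> exists t y, [/\ (0 < t)%N, step t x y & (i' <= y < f')%N].
  move=> x /sub [t [y [t0 xy yi]]]; have [z yz zk] := im_root hp yi.
  by exists (t + p)%N, z; split=> //; [lia|apply/(stepD arrP); exists y].
move=> xk; have [xb1|b1x] := ltnP x b1.
  have [|t [y [rt xy ya]]] := JJ_dom arrP J1 (x := x); first by lia.
  by exists t, y; split=> //; lia.
have [xb|bx] := ltnP x b.
  have [|y xy ya] := im_root h1 (x := x); first by lia.
  by exists r, y; split=> //; lia.
have [|y xy ya] := im_root hS' (x := x); first by lia.
by exists r, y; split=> //; lia.
Qed.

Lemma JJ_skip g b a' k f' : (0 < g)%N ->
  (forall r o1 b1 a1, (0 < r < g)%N -> im o1 r b1 b a' a1 -> JJ r.+1 b1 a1 k f' != 0 -> False) ->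
  JJ 1 b a' k f' = JJ g b a' k f'.
Proof.
move=> g0 H; suff gen d : (d < g)%N -> JJ 1 b a' k f' = JJ d.+1 b a' k f'.
  by rewrite -(prednK g0); apply: gen; rewrite prednK.
elim: d => [//|d IH] dg; rewrite IH ?(ltnW dg) // (JJ_rec arrP s qp nil).
rewrite big1 ?mulr0 ?addr0 // => t _; apply/eqP.
by apply: contraT => /mul_neq0 [/X_neq0 [o h] J1]; case: (H _ _ _ _ _ h J1).
Qed.

(** The interval (a', f') is covered by images under powers at least g, so the inverse of tau ^ g is
    defined on all of (i', f'). At the left end it preserves the orientation, hence everywhere by
    [pres_ext]. *)
Lemma preimage_ext g i a i' j0 j0' b k a' f' :
  (i < a)%N -> j0 = maxn a i.+2 -> im false g i j0 i' j0' ->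
  a' = (i' + (a - i))%N -> f' = (a' + (b - k))%N -> (k < b)%N ->
  JJ g b a' k f' != 0 -> im false g i (i + (f' - i')) i' f'.
Proof.
move=> ia jE hj a'E f'E kb J0; have [ij j0'E _] := hj.
have hc : tau_im n (fun x y => arr y x) false g i' j0' i j0 by apply/im_cnv.
have [ij' j0E' _] := hc.
have [|x xi|o [u [v h]]] := @im_of_dom n _ (arrows_cnv arrP) g i' f'; first by lia.
  have [xj|jx] := ltnP x j0'.
    have [|y xy _] := im_root hc (x := x); first by lia.
    by exists y.
  have [|r [y [gr yx _]]] := JJ_cod arrP J0 (y := x); first by lia.
  move: yx; rewrite -(subnK gr) => /(stepD arrP) [z _ zx].
  by exists z; apply/(step_cnv arrP).
have [|oE uE] := pres_ext (arrows_cnv arrP) hc _ h; first by lia.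
have [_ vE _] := h; rewrite oE uE in h vE; rewrite -vE.
by move/(im_cnv arrP): h.
Qed.

(** Iterating the equation of r0 requires exchanging the arguments of kappa at each intermediate
    stage, which costs a term exactly when w is an endpoint of the interval at that stage. The
    version that keeps these terms is [kap_im_sum]. *)
Lemma kap_im g o i j u v w : (w < n)%N -> (0 < g)%N -> im o g i j u v ->
  (forall r o' x y, (0 < r < g)%N -> im o' r i j x y -> x <> w /\ y <> w) ->
  kap u w - kap v w = - (kap w i - kap w j).
Proof.
move=> wn; case: g => // g _; elim: g o u v => [|g IH] o u v h H.
  exact: (kap_im1 arrP sP h wn).
move: h; rewrite -addn1 => /(im_decomp arrP) [o1 [u1 [v1 [h1 h2]]]].
rewrite (kap_im1 arrP sP h2 wn) -(IH _ _ _ h1); last first.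
  by move=> r o' x y rg; apply: H; lia.
have [|uw vw] := H g.+1 _ _ _ _ h1; first by lia.
rewrite (kapC sP w u1) (kapC sP w v1).
by rewrite (introF eqP (nesym uw)) (introF eqP (nesym vw)) mul0rn; ring.
Qed.

End Vanishing.

(** * Comparison of the exponents of a hop and of its shift *)

Section Exponents.
Context (n : nat) (arr : nat -> nat -> Prop) (arrP : arrows n arr).
Context (K : numFieldType) (s : nat -> nat -> K) (sP : r0_form n arr s).
Context (A : comNzRingType) (qp : K -> A).
Hypotheses (qp0 : qp 0%R = 1%R) (qpD : forall x y, qp (x + y)%R = (qp x * qp y)%R).
Context (N : nat) (nil : forall k x y, N <= k -> ~ tau_step n arr k x y).
Local Notation im := (tau_im n arr).
Local Notation step := (tau_step n arr).
Local Notation low := (reverses n arr).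
Local Notation X := (theta_ker n arr s qp).
Local Notation c := (qdiff qp).
Local Notation JJ := (twist_tail n arr s qp N).
Local Notation Jcons := (Jcons arrP).
Local Notation Xcons := (X_cons arrP).
Local Notation kap := (kappa s).
Local Open Scope ring_scope.

Section Exponent.
Context (g i a b k l f i' a' f' p : nat) (o : bool).
Hypotheses (lw : low g i a) (ia : (i < a)%N) (ja : (maxn a i.+2 <= f)%N) (h : im false g i f i' f')
  (g0 : (0 < g)%N) (gp : (g <= p)%N) (hp : im o p i f k l) (J0 : JJ 0 b a k f != 0) (kb : (k < b)%N)
  (fE : f = (a + (b - k))%N) (a'E : a' = (i' + (a - i))%N).

Fact a_lt_f : (a < f)%N. Proof. by lia. Qed.

Fact hA : im false g a f a' f'.
Proof.
have [_ f'E _] := h; have := im_subF h (ltnW ia) a_lt_f (leqnn _).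
by rewrite -a'E (_ : i' + (f - i) = f')%N.
Qed.

(** A reversing tau ^ p would carry (a, f) onto (k, b), the situation excluded by [no_cycle]. *)
Fact o_pres : o = false.
Proof.
case: (o) hp => // hpT; exfalso; have [_ lE _] := hp.
have := im_subT hpT (ltnW ia) a_lt_f (leqnn _).
have [-> ->] : (l - (f - i) = k /\ l - (a - i) = b)%N by lia.
by move=> h1; apply: (no_cycle arrP J0 kb h1); lia.
Qed.

Fact hS : im false p i a k (k + (a - i)).
Proof.
by move: hp; rewrite o_pres => h1; have := im_subF h1 (leqnn _) ia (ltnW a_lt_f); rewrite subnn addn0.
Qed.

Fact mid r : (0 < r < g)%N -> exists u v, im true r i f u v /\ im true (g - r) u v i' f'.
Proof.
move=> rg; move: h; rewrite -{1}(subnKC (ltnW (proj2 (andP rg)))) => /(im_decomp arrP).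
case=> o1 [u [v [h1 h2]]]; exists u, v.
by have oT := low_rev lw rg ja h1; rewrite oT in h1 h2.
Qed.

(** An intermediate image of (a, f) with endpoint k would give (i, f) or (i, a) the same image at
    that stage as under tau ^ p, against [im_self]. *)
Fact expA : kap a' k - kap f' k = - (kap k a - kap k f).
Proof.
have [if_ fn kl ln] := im_lt arrP hp; have [_ lE _] := hp.
apply: (kap_im arrP sP _ g0 hA); first by lia.
move=> r o' x y rg h1; have [u [v [h2 _]]] := mid rg; have [_ vE _] := h2.
have := im_subT h2 (ltnW ia) a_lt_f (leqnn _).
rewrite (_ : v - (f - i) = u)%N; last by lia.
move=> h3; have [ex ey] := im_fun arrP h1 h3; split=> e.
  rewrite -ex e in h2 vE; rewrite -lE in vE; rewrite vE in h2.
  by have := im_self arrP h2 hp; lia.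
have := im_subT h2 (leqnn i) ia (ltnW a_lt_f).
rewrite subnn subn0 -ey e => h4.
have vE' : (v = k + (a - i))%N by lia.
rewrite vE' in h4.
by have := im_self arrP h4 hS; lia.
Qed.

Fact imB : exists oB u v, im oB g k b u v.
Proof.
apply: (im_of_dom arrP kb) => x xk; have [r [y [_ xy yf]]] := JJ_dom arrP J0 xk.
have [z yz _] := im_root hA yf.
have : step (r + g) x z by apply/(stepD arrP); exists y.
by rewrite addnC => /(stepD arrP) [w hop_w _]; exists w.
Qed.

(** An intermediate image of (k, b) beginning at a' would be (a', f'), so that (a, f) would be
    carried onto (k, b), against [no_cycle]. An image ending at a' is excluded by following the two
    roots next to a'. *)
Fact expB oB u v : im oB g k b u v -> kap u a' - kap v a' = - (kap a' k - kap a' b).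
Proof.
move=> hB; have [a'f' f'n _ _] := im_lt arrP (hA); have [_ f'E _] := hA; have [_ _ _ f'n'] := im_lt arrP hA.
apply: (kap_im arrP sP _ g0 hB); first by lia.
move=> t o' x y tg h1; have [_ yE _] := h1; split=> e.
  have yf' : y = f' by lia.
  rewrite e yf' in h1.
  have := hA; rewrite -{1}(subnK (ltnW (proj2 (andP tg)))) => /(im_decomp arrP).
  case=> o1 [u1 [v1 [h2 h3]]]; have [e1 e2] := im_inj arrP h1 h3; subst u1 v1.
  by apply: (no_cycle arrP J0 kb h2); lia.
have [|w [z [h2 h3]]] := @mid (g - t); first by lia.
rewrite (_ : g - (g - t) = t)%N in h3; last by lia.
have [_ zE _] := h2.
have hS1 := im_subT h2 (leqnn i) ia (ltnW a_lt_f); rewrite subnn subn0 in hS1.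
(* Since tau ^ t reverses the middle interval (w, z), the roots on the two sides of z - (a - i) go
   to the roots a' - 1 and a'. *)
have st1 : step t (z - (a - i)) (a'.-1).
  have [_ f'E' _] := h; have [_ _ H] := h3; have := H (z - (a - i))%N _.
  by rewrite (_ : f' - (z - (a - i) - w).+1 = a'.-1)%N; [apply|]; lia.
have st2 : step t (z - (a - i)).-1 a'.
  have [_ f'E' _] := h; have [_ _ H] := h3; have := H (z - (a - i)).-1 _.
  by rewrite (_ : f' - ((z - (a - i)).-1 - w).+1 = a')%N; [apply|]; lia.
have {hS1} hSk : (z - (a - i) <> k)%N.
  move=> ek; rewrite ek in hS1; rewrite (_ : z = k + (a - i))%N in hS1; last by lia.
  by have := im_self arrP hS1 hS; lia.
have [_ _ H] := h1; case: o' h1 H => h1 H.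
  have := H k; rewrite subnn e subn1 leqnn kb => /(_ isT) H1.
  by apply: hSk; apply: step_inj arrP _ _ _ _ st1 H1.
(* If tau ^ t preserves the orientation of (k, b), the root a' - 1 comes from b - 1, and then b - 2
   goes to a' - 2; by the reversal of (w, z) it also goes to a'. *)
have := H b.-1; rewrite (_ : x + (b.-1 - k) = a'.-1)%N; last by lia.
rewrite (_ : (k <= b.-1 < b)%N); last by lia.
move=> /(_ isT) H1; have zE1 := step_inj arrP st1 H1.
have bk : (k < b.-1)%N by lia.
have := H b.-2; rewrite (_ : (k <= b.-2 < b)%N); last by lia.
move=> /(_ isT) H2; rewrite zE1 in st2.
by have := step_fun arrP st2 H2; lia.
Qed.

(* The function F below is constant along the arrows between roots on which tau ^ g is
   defined, so its sums over (k, b) and (a, f) agree. *)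
Fact expC u v oB : im oB g k b u v ->
  kap k a - kap b a - (kap u a' - kap v a') = kap a a - kap f a - (kap a' a' - kap f' a').
Proof.
move=> hB; have [af fn _ f'n] := im_lt arrP hA.
have [if_ _ kl ln] := im_lt arrP hp; have [_ lE _] := hp.
pose t x := (tau_imf n arr g x x.+1).1.
have tE x y : step g x y -> t x = y.
  move=> xy; rewrite /t (imfE arrP (_ : im false g x x.+1 y y.+1)) //.
  split=> // [|x1 xx]; first by lia.
  by rewrite (_ : x1 = x) ?subnn ?addn0 //; lia.
pose F x := kap x a - kap x.+1 a - (kap (t x) a' - kap (t x).+1 a').
have aa : step g a a' by have [_ _ /(_ a)] := hA; rewrite subnn addn0; apply; lia.
have aa1 : step g a.-1 a'.-1.
  by have [_ _ /(_ a.-1)] := h; rewrite (_ : i' + (a.-1 - i) = a'.-1)%N; [apply|]; lia.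
have F1 x y x1 y1 : arr x y -> step g x x1 -> step g y y1 -> F x = F y.
  move=> xy xx1 yy1; rewrite /F (tE _ _ xx1) (tE _ _ yy1).
  have x1y1 : arr x1 y1.
    have : step (1 + g) x y1 by apply/(stepD arrP); exists y => //; apply/(step1 arrP).
    by rewrite addnC => /(stepD arrP) [z /(step_fun arrP xx1) <- /(step1 arrP)].
  rewrite (r0_arr sP xy (ltn_trans af fn)) (r0_arr sP x1y1); last by have [] := im_lt arrP hA; lia.
  rewrite (kapC sP a x) (kapC sP a x.+1) (kapC sP a' x1) (kapC sP a' x1.+1).
  have -> : (a == x) = (a' == x1).
    by apply/eqP/eqP => e; subst; [exact: step_fun arrP _ _ _ _ aa xx1|exact: step_inj arrP _ _ _ _ aa xx1].
  have -> : (a == x.+1) = (a' == x1.+1).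
    apply/eqP/eqP => e.
      by rewrite e in aa1; have := step_fun arrP aa1 xx1; lia.
    by rewrite e in aa1; have := step_inj arrP aa1 xx1; lia.
  by ring.
have Fr r x y y1 : step r x y -> step g y y1 -> F x = F y.
  elim: r x => [|r IH] x /=; first by case=> ->.
  case=> z xz zy yy1; rewrite -(IH _ zy yy1).
  have dom w m : step m w y -> exists w1, step g w w1.
    move=> wy; have : step (m + g) w y1 by apply/(stepD arrP); exists y.
    by rewrite addnC => /(stepD arrP) [w1]; exists w1.
  have [z1 zz1] := dom z r zy; have [|x1 xx1] := dom x r.+1; first by exists z.
  exact: F1 xz xx1 zz1.
have := JJ_sum arrP (F := F) J0.
have sumF j j' x y o1 : im o1 g j j' x y ->
    \sum_(j <= z < j') F z = kap j a - kap j' a - (kap x a' - kap y a').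
  move=> h1; have [j12 _ xy _] := im_lt arrP h1.
  rewrite big_split /= sumrN -(tele (fun z => kap z a)) ?(ltnW j12) //; congr (_ - _).
  rewrite (tele (fun z => kap z a')) ?(ltnW xy) //; apply: (im_sum h1).
  by move=> z z1 _ /tE ->.
rewrite (sumF _ _ _ _ _ hB) (sumF _ _ _ _ _ hA); apply=> r x y _ _ yf xy.
by have [y1 yy1 _] := im_root hA yf; exact: Fr xy yy1.
Qed.

(** The identity of exponents behind [mid_terms]. The facts [expA], [expB] and [expC] express all
    the values of kappa involved through those on (a, f) and (a', f'). *)
Lemma exponent :
  (s f k *+ 2 - s f' k *+ 2 - (f == k)%:R - (f' == k)%:R)
  - (s a b *+ 2 - s a' b *+ 2 - (a == b)%:R - (a' == b)%:R) = - (s a f - s a' f') *+ 2.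
Proof.
have [oB [u [v hB]]] := imB; have EB := expB hB; have EA := expA; have EC := expC hB.
rewrite EB in EC; have [af _ a'f' _] := im_lt arrP hA.
have -> : (s f k *+ 2 - s f' k *+ 2 - (f == k)%:R - (f' == k)%:R)
  - (s a b *+ 2 - s a' b *+ 2 - (a == b)%:R - (a' == b)%:R)
  = kap b a + kap a' b - (kap k f + kap f' k).
  rewrite /kappa (s_skew sP f k) (s_skew sP a b) (eq_sym f k) (eq_sym a b); ring.
have -> : kap f' k = kap a' k + (kap k a - kap k f) by rewrite -[_ - _ in RHS]opprK -EA; ring.
transitivity (- (kap k a - kap b a - - (kap a' k - kap a' b))); first by ring.
rewrite EC /kappa !eqxx (s_diag sP) (s_diag sP) (s_skew sP f a) (s_skew sP f' a').
by rewrite (gtn_eqF af) (gtn_eqF a'f'); ring.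
Qed.

End Exponent.
End Exponents.

(** * The equation J21 R = R_0 J for sums of hops *)

Section HopEquation.
Context (n : nat) (arr : nat -> nat -> Prop) (arrP : arrows n arr).
Context (K : numFieldType) (s : nat -> nat -> K) (sP : r0_form n arr s).
Context (A : comNzRingType) (qp : K -> A).
Hypotheses (qp0 : qp 0%R = 1%R) (qpD : forall x y, qp (x + y)%R = (qp x * qp y)%R).
Context (N : nat) (nil : forall k x y, N <= k -> ~ tau_step n arr k x y).
Local Notation im := (tau_im n arr).
Local Notation step := (tau_step n arr).
Local Notation low := (reverses n arr).
Local Notation X := (theta_ker n arr s qp).
Local Notation c := (qdiff qp).
Local Notation JJ := (twist_tail n arr s qp N).
Local Notation Jcons := (Jcons arrP).
Local Notation Xcons := (X_cons arrP).
Local Notation kap := (kappa s).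
Local Notation passes := (passes_through n arr).
Local Open Scope ring_scope.

Definition pass_count (p f k i : nat) : K := \sum_(1 <= r < p) (passes p r f k i)%:R.
Local Notation NN := pass_count.

(* For p > 0, the entry of R_GGS from (f, k) to (i, l) if tau ^ p carries (i, f) to (k, l). *)
Definition hop (p f k i l : nat) : A :=
  c * (X p f k i l * qp (s f k *+ 2 - (f == k)%:R - NN p f k i *+ 2)).
Local Notation Hp := hop.

Definition hop_sum (f k i l : nat) : A := \sum_(1 <= p < N) Hp p f k i l.
Local Notation SH := hop_sum.

Lemma SHE M f k i l : (N <= M)%N -> SH f k i l = \sum_(1 <= p < M) Hp p f k i l.
Proof.
move=> NM; rewrite /hop_sum; have [N0|N0] := posnP N.
  rewrite N0 big_geq // big1 // => p _; rewrite /hop (X_nil s qp nil) ?N0 // !(mul0r, mulr0) //.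
rewrite [RHS](@big_cat_nat _ _ _ N) //= [X in _ = _ + X]big1_seq ?addr0 // => p.
by rewrite mem_index_iota => /andP[_ /andP[Np _]]; rewrite /hop (X_nil s qp nil) // mul0r mulr0.
Qed.

Lemma Hp_neq0 p f k i l : Hp p f k i l != 0 -> exists o, im o p i f k l.
Proof. by move=> /mul_neq0 [_ /mul_neq0 [/X_neq0]]. Qed.

Lemma NN_low g i a o p k l : low g i a -> (i < a)%N -> (p <= g)%N -> im o p i a k l -> NN p a k i = 0.
Proof.
move=> lw ia pg h; rewrite /pass_count big1_seq // => r; rewrite mem_index_iota => /andP[_ /andP[r0 rp]].
by rewrite (negbTE (passes_low arrP lw (leqnn a) h _ rp)) //; lia.
Qed.

(** For k < b the power p, being below g, would reverse the interval and carry (a, f) with f = a +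
    (b - k) onto (k, b); [no_cycle] leaves only k = b. *)
Lemma low_terms g i a b k l p : low g i a -> (i < a)%N -> (0 < p < g)%N ->
  JJ 0 b a k (a + (b - k)) * Hp p (a + (b - k)) k i l
  = (b == k)%:R * (qp (s a b *+ 2 - (a == b)%:R) * (c * X p a b i l)).
Proof.
move=> lw ia pg; have [<-|ne] := eqVneq b k.
  rewrite subnn addn0 (JJ_diag arrP) eqxx !mul1r /hop.
  have [->|/X_neq0 [o h]] := eqVneq (X p a b i l) 0; first by rewrite !(mul0r, mulr0).
  by rewrite (NN_low lw ia _ h) ?mul0rn ?subr0; [ring|lia].
rewrite mul0r; apply/eqP; apply: contraT => /mul_neq0 [J0 /Hp_neq0 [o h]].
have [kb _] := Jcons J0; have kb' : (k < b)%N by lia.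
have oT : o = true by apply: (low_rev lw pg _ h); lia.
rewrite oT in h; have [_ lE _] := h.
have := im_subT h (ltnW ia) _ (leqnn _).
rewrite (_ : l - (a - i) = b)%N; last by lia.
rewrite (_ : l - (a + (b - k) - i) = k)%N; last by lia.
by move=> h1; case: (no_cycle arrP J0 kb' (h1 _)); lia.
Qed.

Lemma NN_shift g i a o p f k l i' f' j0 j0' : low g i a -> (0 < g)%N -> (i < a <= f)%N ->
  j0 = maxn a i.+2 -> im false g i j0 i' j0' ->
  im false g i f i' f' -> im o p i' f' k l ->
  NN (g + p) f k i = NN p f' k i' + (f' == k)%:R.
Proof.
move=> lw g0 af jE hj h hp; have hgp := im_comp arrP h hp.
have sh r := passes_shift arrP (r := r) lw af jE hj h hp.
rewrite /pass_count (@big_cat_nat _ _ _ g) ?leq_addr //=.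
rewrite big1_seq ?add0r; last first.
  move=> r; rewrite mem_index_iota => /andP[_ rg].
  have [p0|p0] := posnP p; rewrite (negbTE (passes_low arrP lw (proj2 (andP af)) hgp _ _)) //; lia.
rewrite -{1}(add0n g) big_addn addnC addnK.
case: p hp hgp sh => [|p] hp hgp sh.
  rewrite !big_geq // add0r; have [-> _] := im0E arrP hp.
  by have [lt _ _ _] := im_lt arrP hp; rewrite gtn_eqF.
rewrite big_ltn // addrC; congr (_ + _); last by rewrite add0n -[X in passes _ X]addn0 addnC sh.
rewrite big_add1 /= big_add1 /=; apply: eq_big_nat => r rp.
by rewrite addnC (addnC _ g) sh //; lia.
Qed.

(** The terms of the equation at i' = tau ^ g i correspond one to one to the terms at i whose power
    is at least g. For k < b, [levels_vanish] and [JJ_skip] remove the factors Theta_r with 0 < r <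
    g, [JJ_shift2] strips tau ^ g from the target, and [NN_shift] and [exponent] match the
    exponents. *)
Lemma mid_terms g i a b k l p f f' i' a' j0 j0' : low g i a -> (0 < g)%N -> (i < a)%N ->
  j0 = maxn a i.+2 -> im false g i j0 i' j0' -> a' = (i' + (a - i))%N ->
  f = (a + (b - k))%N -> f' = (a' + (b - k))%N ->
  qp (s a b *+ 2 - (a == b)%:R + (s i a - s i' a') - kap a' b) * (JJ 1 b a' k f' * Hp p f' k i' l)
  = JJ 0 b a k f * Hp (g + p) f k i l.
Proof.
move=> lw g0 ia jE hj a'E fE f'E.
have hS : im false g i a i' a'.
  have := im_subF hj (leqnn i) ia _; rewrite subnn addn0 -a'E; apply; lia.
have XS := X_shift arrP s qpD p k l.
have [bk|kb] := leqP b k.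
  have e : (b - k = 0)%N by lia.
  have -> : f = a by lia.
  have -> : f' = a' by lia.
  have [<-|ne] := eqVneq b k; last first.
    have Z t y y' : JJ t b y k y' = 0 by apply/eqP; apply: contraT => /Jcons [? _]; lia.
    by rewrite !Z !mul0r mulr0.
  rewrite !(JJ_diag arrP) !eqxx !mul1r /hop (X_shift arrP s qpD _ _ _ hS).
  have [->|/X_neq0 [o h]] := eqVneq (X p a' b i' l) 0; first by rewrite !(mul0r, mulr0).
  rewrite (NN_shift lw g0 _ jE hj hS h); last by lia.
  set x := X _ _ _ _ _; rewrite !mulrA -!(mulrC c) -!mulrA; congr (_ * _).
  rewrite mulrCA !(mulrCA _ x); congr (_ * _); rewrite -!qpD; congr (qp _).
  by rewrite /kappa; ring.
have aff : (a < f)%N by lia.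
have jf : (maxn a i.+2 <= f)%N by lia.
have [[f1 h]|nf] := pselect (exists f1, im false g i f i' f1); last first.
  have -> : Hp (g + p) f k i l = 0.
    rewrite /hop X_eq0 ?mul0r ?mulr0 // => o /(im_decomp arrP) [o1 [u [v [h1 _]]]].
    have [|oE uE] := pres_ext arrP hj _ h1; first by lia.
    by apply: nf; exists v; rewrite -uE -oE.
  rewrite mulr0; apply/eqP; apply: contraT => /mul_neq0 [_ /mul_neq0 [J1 /Hp_neq0 [o hp]]].
  case: nf; exists f'; have := preimage_ext arrP (s := s) (qp := qp) (N := N) ia jE hj a'E f'E kb.
  rewrite (_ : i + (f' - i') = f)%N; last by lia.
  apply; rewrite -(JJ_skip arrP nil g0) // => r o1 b1 a1 rg h1 J2.
  exact: (levels_vanish arrP lw ia jE hj rg a'E f'E kb h1 J2 hp).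
have f1E : f1 = f' by have [_ ? _] := h; lia.
rewrite f1E in h; have hA : im false g a f a' f'.
  by have := im_subF h (ltnW ia) aff (leqnn _); rewrite -a'E (_ : i' + (f - i) = f')%N //; lia.
have [[o hp]|np] := pselect (exists o, im o p i' f' k l); last first.
  have -> : Hp p f' k i' l = 0 by rewrite /hop X_eq0 ?mul0r ?mulr0 // => o h1; apply: np; exists o.
  have -> : Hp (g + p) f k i l = 0; last by rewrite !mulr0.
  rewrite /hop X_eq0 ?mul0r ?mulr0 // => o h1; apply: np; apply/(imx_shift arrP p _ _ h).
  by exists o.
have hgp := im_comp arrP h hp; rewrite /= in hgp.
have -> : JJ 1 b a' k f' = JJ g b a' k f'.
  apply: (JJ_skip arrP nil g0) => r o1 b1 a1 rg h1 J2.
  exact: (levels_vanish arrP lw ia jE hj rg a'E f'E kb h1 J2 hp).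
have := JJ_shift2 arrP sP qp0 qpD nil 0 b k hA; rewrite addn0 => ->.
have [->|J0] := eqVneq (JJ 0 b a k f) 0; first by rewrite !(mul0r, mulr0).
have EX := exponent arrP sP lw ia jf h g0 (leq_addr p g) hgp J0 kb fE a'E.
rewrite /hop (X_shift arrP s qpD _ _ _ h) (NN_shift lw g0 _ jE hj h hp); last by lia.
set x := X _ _ _ _ _; set y := JJ _ _ _ _ _.
have R1 (u v w : A) : u * (v * y * (c * (x * w))) = y * (c * x) * (u * v * w) by ring.
have R2 (u w : A) : y * (c * (u * x * w)) = y * (c * x) * (u * w) by ring.
rewrite R1 R2 -!qpD; congr (_ * qp _).
rewrite (s_split arrP sP h (t := (a - i)%N)); last by lia.
rewrite (_ : i + (a - i) = a)%N; last by lia.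
rewrite -a'E; move: EX; rewrite /kappa mulrnDl => EX.
set d := (s a f - s a' f') in EX *.
have {EX} EX : (s f k *+ 2 - s f' k *+ 2 - (f == k)%:R - (f' == k)%:R)
  = (s a b *+ 2 - s a' b *+ 2 - (a == b)%:R - (a' == b)%:R) - d *+ 2.
  by rewrite -[LHS](subrK (s a b *+ 2 - s a' b *+ 2 - (a == b)%:R - (a' == b)%:R)) EX; ring.
transitivity ((s a b *+ 2 - s a' b *+ 2 - (a == b)%:R - (a' == b)%:R) - d *+ 2
   + (s i a - s i' a') + d + s f' k *+ 2 - (f' == k)%:R - NN p f' k i' *+ 2).
  by rewrite /d; ring.
by rewrite -EX; ring.
Qed.

End HopEquation.

Section HopEquationAll.
Context (n : nat) (arr : nat -> nat -> Prop) (arrP : arrows n arr).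
Context (K : numFieldType) (s : nat -> nat -> K) (sP : r0_form n arr s).
Context (A : comNzRingType) (qp : K -> A).
Hypotheses (qp0 : qp 0%R = 1%R) (qpD : forall x y, qp (x + y)%R = (qp x * qp y)%R).
Context (N : nat) (nil : forall k x y, N <= k -> ~ tau_step n arr k x y) (N0 : 0 < N).
Local Notation im := (tau_im n arr).
Local Notation step := (tau_step n arr).
Local Notation low := (reverses n arr).
Local Notation X := (theta_ker n arr s qp).
Local Notation c := (qdiff qp).
Local Notation JJ := (twist_tail n arr s qp N).
Local Notation Jcons := (Jcons arrP).
Local Notation Xcons := (X_cons arrP).
Local Notation kap := (kappa s).
Local Notation Hp := (hop n arr s qp).
Local Notation SH := (hop_sum n arr s qp N).
Local Open Scope ring_scope.

(** The entry in row (b, a) and column (i, l) of the equation J B = B_0 J between braid forms, with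
    the sums of hops as the entries of B. *)
Definition hop_eq (i : nat) : Prop := forall a b l, (i < a)%N -> (a < n)%N -> (b < n)%N ->
  qp (kap a b) * JJ 0 a b i l
  = \sum_(k < n) JJ 1 b a k (a + (b - k)) * \sum_(0 <= p < N) Hp p (a + (b - k)) k i l.

Lemma low_sum g i a b l : low g i a -> (i < a)%N -> (b < n)%N ->
  \sum_(k < n) JJ 0 b a k (a + (b - k)) * \sum_(1 <= p < g) Hp p (a + (b - k)) k i l
  = qp (s a b *+ 2 - (a == b)%:R) * \sum_(1 <= p < g) c * X p a b i l.
Proof.
move=> lw ia bn; rewrite -[RHS](sum_delta (fun k => qp (s a b *+ 2 - (a == b)%:R)
  * \sum_(1 <= p < g) c * X p a b i l) bn).
apply: eq_bigr => k _; rewrite !mulr_sumr; apply: eq_big_nat => p pg.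
by rewrite (low_terms arrP s qp N _ _ _ lw).
Qed.

Lemma sum_shift (V : nmodType) (F : nat -> V) g M :
  \sum_(g <= p < g + M) F p = \sum_(0 <= p < M) F (g + p)%N.
Proof.
rewrite -{1}(add0n g) big_addn addKn.
by apply: eq_bigr => p _; rewrite addnC.
Qed.

(** A variant in which the hops of power 0 are absent and Theta_0 stands on the right. Let g be the
    least positive power that preserves the orientation of (i, max a (i + 2)). The powers below g
    contribute single hops, equal on both sides by [JJ_low] and [low_sum], and what remains is
    [hop_eq] at tau ^ g i. If there is no g, only the single hops remain. *)
Lemma hop_eq_pos i a b l : (forall g i', (0 < g)%N -> step g i i' -> hop_eq i') ->
  (i < a)%N -> (a < n)%N -> (b < n)%N ->
  qp (s a b *+ 2 - (a == b)%:R) * JJ 1 a b i l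
  = \sum_(k < n) JJ 0 b a k (a + (b - k)) * SH (a + (b - k)) k i l.
Proof.
move=> IH ia an bn; pose P g := `[< (0 < g)%N /\ exists u v, im false g i (maxn a i.+2) u v >].
have [exP|nP] := pselect (exists g, P g); last first.
  have lw : low N i a.
    move=> r u v rN h; apply: nP; exists r; apply/asboolP; split; first by lia.
    by exists u, v.
  rewrite (JJ_low arrP s qp nil b l lw ia) ?N0 //= (JJ_nil s qp nil) //.
  by rewrite (gtn_eqF ia) addr0 -low_sum.
case: (ex_minnP exP) => g /asboolP [g0 [i' [j0' hj]]] gmin.
have lw : low g i a.
  move=> r u v rg h; have : P r by apply/asboolP; split; [lia|exists u, v].
  by move/gmin; lia.
pose a' := (i' + (a - i))%N; have [ij j0'E _] := hj; have [_ _ _ j0'n] := im_lt arrP hj.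
have hS : im false g i a i' a'.
  by have := im_subF hj (leqnn i) ia _; rewrite subnn addn0; apply; lia.
have st : step g i i' by have [_ _ /(_ i)] := hj; rewrite subnn addn0; apply; lia.
rewrite (JJ_low arrP s qp nil b l lw ia) ?g0 //=.
have := JJ_shift arrP sP qp0 qpD nil b l hS 0; rewrite addn0 => ->.
rewrite mulrDr -low_sum //.
have -> (x y : A) : x + qp (s a b *+ 2 - (a == b)%:R) * (qp (s i a - s i' a') * y)
    = x + qp (s a b *+ 2 - (a == b)%:R + (s i a - s i' a') - kap a' b) * (qp (kap a' b) * y).
  by congr (_ + _); rewrite !mulrA -!qpD; congr (qp _ * _); ring.
rewrite (IH g i' g0 st) //; [|by rewrite /a'; lia..].
rewrite mulr_sumr -big_split /=; apply: eq_bigr => k _.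
rewrite (SHE s qp nil _ _ _ _ (leq_addl g N)) [X in _ = _ * X](@big_cat_nat _ _ _ g) ?leq_addr //= mulrDr.
congr (_ + _); rewrite (sum_shift _ g) !mulr_sumr. apply: eq_bigr => p _.
by rewrite (mid_terms arrP sP qp0 qpD nil _ _ lw g0 ia erefl hj erefl erefl erefl).
Qed.

Lemma Hp0 f k i l : (i < f)%N -> (f < n)%N -> Hp 0 f k i l = (k == i)%:R * (l == f)%:R * c.
Proof.
move=> i_f fn; rewrite /hop; have [X0|/X_neq0 [o h]] := eqVneq (X 0 f k i l) 0.
  rewrite X0 mul0r mulr0; have [e|_] := eqVneq k i; last by rewrite !mul0r.
  have [e'|_] := eqVneq l f; last by rewrite mulr0 mul0r.
  move: X0; rewrite e e' (XE arrP s qp (@im0 n arr i f _)) ?i_f // /hop_w /= mul1r => X0.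
  by have := qp_inv qp0 qpD (s i f + s i f); rewrite X0 mul0r => /esym/eqP; rewrite oner_eq0.
have [e e'] := im0E arrP h; subst k l; rewrite !eqxx !mul1r.
rewrite (XE arrP s qp (@im0 n arr i f _)) ?i_f // /hop_w /= mul1r.
rewrite -qpD /pass_count big_geq // (gtn_eqF i_f) (s_skew sP f i) /= mul0rn !subr0.
by rewrite [X in qp X](_ : _ = 0) ?qp0 ?mulr1 //; ring.
Qed.

(** Induction on a bound for the number of powers of tau defined at i, since [hop_eq_pos] leads from
    tau ^ g i to i. To bring Theta_0 back to the left side, [JJ0] is applied; it relates the rows
    (a, b) and (b, a), whence the cases on the order of a and b. *)
Lemma hop_eq_all i : hop_eq i.
Proof.
suff gen m : forall i, (forall y, ~ step m i y) -> hop_eq i by apply: (gen N) => y /(nil (leqnn N)).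
elim/ltn_ind: m => m IH {}i im_nil.
have {IH} E0 a b l : (i < a)%N -> (a < n)%N -> (b < n)%N ->
  qp (s a b *+ 2 - (a == b)%:R) * JJ 1 a b i l
  = \sum_(k < n) JJ 0 b a k (a + (b - k)) * SH (a + (b - k)) k i l.
  move=> ia an bn; apply: hop_eq_pos => // g i' g0 st.
  have [mg|gm] := leqP m g.
    by move: st; rewrite -(subnKC mg) => /(stepD arrP) [z /im_nil].
  apply: (IH (m - g)%N); first by lia.
  by move=> y yy; apply: (im_nil y); rewrite -(subnKC (ltnW gm)); apply/(stepD arrP); exists i'.
move=> a b l ia an bn.
have p0 : \sum_(k < n) JJ 1 b a k (a + (b - k)) * Hp 0 (a + (b - k)) k i l = c * JJ 1 b a i l.
  rewrite -[RHS](sum_delta' (fun k => c * JJ 1 b a k l) (ltn_trans ia an)); apply: eq_bigr => k _.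
  have [J0|J0] := eqVneq (JJ 1 b a k (a + (b - k))) 0.
    rewrite J0 mul0r; have [e|_] := eqVneq (k : nat) i; last by rewrite mul0r.
    rewrite e in J0 *; have [->|/Jcons [_ lE]] := eqVneq (JJ 1 b a i l) 0; first by rewrite !mulr0.
    by rewrite lE J0 !mulr0.
  have [af fn] : (i < a + (b - k))%N /\ (a + (b - k) < n)%N.
    have [kb _] := Jcons J0; have [bk|kb'] := leqP b k; first by lia.
    by have [_ fn] := JJ_bound arrP J0 kb'; lia.
  rewrite Hp0 //; have [e|_] := eqVneq (k : nat) i; last by rewrite !mul0r mulr0.
  have [->|ne] := eqVneq; first by rewrite e !mul1r mulrC.
  rewrite mulr0 !mul0r mulr0 mul1r; have [->|/Jcons [_ lE]] := eqVneq (JJ 1 b a k l) 0; first by rewrite mulr0.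
  by case/eqP: ne.
have split_SH : \sum_(k < n) JJ 1 b a k (a + (b - k)) * \sum_(0 <= p < N) Hp p (a + (b - k)) k i l
   = c * JJ 1 b a i l + \sum_(k < n) JJ 1 b a k (a + (b - k)) * SH (a + (b - k)) k i l.
  by rewrite -p0 -big_split; apply: eq_bigr => k _; rewrite big_ltn // mulrDr.
rewrite split_SH.
have [ab|ba|ab] := ltngtP a b.
- have -> : JJ 0 a b i l = JJ 1 a b i l by rewrite (JJ0 arrP s qp nil) // ltnNge ltnW // mul0r addr0.
  have := E0 a b l ia an bn; rewrite (ltn_eqF ab) subr0 /kappa (ltn_eqF ab) addr0 => ->.
  have := E0 b a l (ltn_trans ia ab) bn an; rewrite (gtn_eqF ab) subr0 => Eb.
  have -> : \sum_(k < n) JJ 0 b a k (a + (b - k)) * SH (a + (b - k)) k i l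
    = \sum_(k < n) JJ 1 b a k (a + (b - k)) * SH (a + (b - k)) k i l
    + c * qp (s a b *+ 2) * \sum_(k < n) JJ 0 a b k (b + (a - k)) * SH (b + (a - k)) k i l.
    rewrite mulr_sumr -big_split; apply: eq_bigr => k _ /=.
    rewrite (JJ0 arrP s qp nil) // ab mul1r mulrDl; congr (_ + _).
    rewrite (JJ0 arrP s qp nil b) // ltnNge ltnW //= mul0r addr0 -!mulrA; congr (_ * (_ * _)).
    have [ka|ak] := leqP k a; first by rewrite (_ : a + (b - k) = b + (a - k))%N //; lia.
    have Z y : JJ 1 a b k y = 0 by apply/eqP; apply: contraT => /Jcons [? _]; lia.
    by rewrite !Z !mul0r.
  rewrite -Eb addrC -!mulrA (mulrA (qp (s a b *+ 2))) -qpD (s_skew sP b a).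
  by rewrite mulNrn subrr qp0 mul1r.
- have := E0 a b l ia an bn; rewrite (gtn_eqF ba) subr0 (JJ0 arrP s qp nil b) // ba mul1r.
  rewrite /kappa (gtn_eqF ba) addr0 mulrDr => ->; rewrite addrC; congr (_ + _).
    by rewrite -!mulrA mulrCA [qp _ * (qp _ * _)]mulrA -qpD (s_skew sP b a) mulNrn subrr qp0 mul1r.
  apply: eq_bigr => k _; rewrite (JJ0 arrP s qp nil a) // ltnNge ltnW //= mul0r addr0 //.
- subst b; have := E0 a a l ia an bn; rewrite (s_diag sP) mul0rn eqxx sub0r.
  have J0E y z : JJ 0 a a y z = JJ 1 a a y z by rewrite (JJ0 arrP s qp nil) // ltnn mul0r addr0.
  rewrite J0E => E; under eq_bigr do rewrite -J0E.
  rewrite -E /kappa (s_diag sP) mul0rn add0r eqxx /qdiff; ring.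
Qed.

End HopEquationAll.

Section Flip.
Context (A : comNzRingType) (n : nat).
Local Notation mx2 := (mx2 n).
Local Open Scope ring_scope.

Definition flip_mx : 'M[A]_(n * n) := mx2 (fun a b i l => (a == l)%:R * (b == i)%:R).

Lemma pm_mul f : flip_mx *m mx2 f = mx2 (fun a b i l => f b a i l).
Proof.
rewrite mul_mx2; apply: eq_mx2 => a b i l an bn _ _.
rewrite -(sum_delta (fun a1 => f a1 a i l) bn); apply: eq_bigr => a1 _.
rewrite -(sum_delta (fun b1 => (b == a1)%:R * f a1 b1 i l) an); apply: eq_bigr => b1 _.
by rewrite mulrA.
Qed.

Lemma mul_pm f : mx2 f *m flip_mx = mx2 (fun a b i l => f a b l i).
Proof.
rewrite mul_mx2; apply: eq_mx2 => a b i l _ _ iN ln.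
rewrite -(sum_delta' (fun a1 => f a b a1 i) ln); apply: eq_bigr => a1 _.
rewrite -(sum_delta' (fun b1 => (a1 == l :> nat)%:R * f a b a1 b1) iN); apply: eq_bigr => b1 _.
by ring.
Qed.

Lemma pm_inv : flip_mx *m flip_mx = 1%:M.
Proof. by rewrite mul_pm mx2_1; apply: eq_mx2 => a b i l *; rewrite -natrM mulnb. Qed.

(** An antiautomorphism: the inverses of Theta_k, of J and of the braid form of R_0 are the [tr21]
    of their mirror images. *)
Definition tr21 (M : 'M[A]_(n * n)) : 'M[A]_(n * n) := locked (flip_mx *m M^T *m flip_mx).

Lemma T21_def M : tr21 M = flip_mx *m M^T *m flip_mx. Proof. by rewrite /tr21 -lock. Qed.

Lemma T21E f : tr21 (mx2 f) = mx2 (fun a b i l => f l i b a).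
Proof.
rewrite !T21_def (_ : (mx2 f)^T = mx2 (fun a b i l => f i l a b)); last by apply/matrixP => r t; rewrite !mxE.
by rewrite pm_mul mul_pm.
Qed.

Lemma T21M M1 M2 : tr21 (M1 *m M2) = tr21 M2 *m tr21 M1.
Proof. by rewrite !T21_def trmx_mul !mulmxA -(mulmxA _ flip_mx flip_mx) pm_inv mulmx1. Qed.

Lemma T21_1 : tr21 1%:M = 1%:M.
Proof. by rewrite !T21_def trmx1 mulmx1 pm_inv. Qed.

Lemma T21D M1 M2 : tr21 (M1 + M2) = tr21 M1 + tr21 M2.
Proof. by rewrite !T21_def linearD /= mulmxDr mulmxDl. Qed.

Lemma T21Z x M : tr21 (x *: M) = x *: tr21 M.
Proof. by rewrite !T21_def linearZ /= -scalemxAr -scalemxAl. Qed.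

End Flip.

(** * Mirror symmetry *)

Section Mirror.
Context (n : nat) (arr : nat -> nat -> Prop) (arrP : arrows n arr).
Context (K : numFieldType) (s : nat -> nat -> K) (sP : r0_form n arr s).
Context (A : comNzRingType) (qp : K -> A).
Hypotheses (qp0 : qp 0%R = 1%R) (qpD : forall x y, qp (x + y)%R = (qp x * qp y)%R).
Local Notation im := (tau_im n arr).
Local Notation X := (theta_ker n arr s qp).
Local Notation c := (qdiff qp).
Local Notation mx2 := (mx2 n).
Local Open Scope ring_scope.

Local Notation cnv := (fun x y => arr y x).
Definition opp_form (u v : nat) : K := - s u v.
Definition qp_opp (x : K) : A := qp (- x).

Lemma kap_sm u v : kappa opp_form u v = kappa s v u.
Proof. by rewrite /kappa /opp_form (s_skew sP u v) opprK eq_sym. Qed.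

(** Changing the sign of s transposes kappa, and the equation kappa (tau a, v) = - kappa (v, a) read
    backwards is the one for the inverse of tau. *)
Lemma r0_cnv : r0_form n cnv opp_form.
Proof.
split=> [u v|x y v xy vn]; first by rewrite /opp_form (s_skew sP u v).
have h := r0_arr sP xy vn.
by rewrite !kap_sm h opprK.
Qed.

Lemma qm0 : qp_opp 0 = 1. Proof. by rewrite /qp_opp oppr0. Qed.
Lemma qmD x y : qp_opp (x + y) = qp_opp x * qp_opp y. Proof. by rewrite /qp_opp opprD qpD. Qed.
Lemma qcm : qdiff qp_opp = - c. Proof. by rewrite /qdiff /qp_opp opprK opprB. Qed.

(** The mirror image of the kernel of Theta_k, brought back by [tr21]: reversed intervals get the
    weight (- q) ^ (L - 1) in place of (- q ^ -1) ^ (L - 1). *)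
Definition theta_inv_ker (k a b i l : nat) : A := theta_ker n cnv opp_form qp_opp k l i b a.
Definition orient_winv (o : bool) (L : nat) : A := if o then (- qp 1) ^+ L.-1 else 1.

Lemma XtE o k a b i l : im o k i a b l -> theta_inv_ker k a b i l = orient_winv o (a - i) * qp (s i a + s b l).
Proof.
move=> h; have [ia lE _] := h; have h' := h; move/im_cnv: h' => h'.
rewrite /theta_inv_ker (XE (arrows_cnv arrP) opp_form qp_opp (proj2 (im_cnv arrP _ _ _ _ _ _) h)) /hop_w /orient_w /orient_winv /neg_qinv /qp_opp /opp_form.
have -> : (l - b = a - i)%N by lia.
rewrite opprK; congr (_ * qp _); ring.
Qed.

Lemma Xt_eq0 k a b i l : (forall o, ~ im o k i a b l) -> theta_inv_ker k a b i l = 0.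
Proof. by move=> h; apply: X_eq0 => o /(im_cnv arrP) /h. Qed.

Lemma Xt_neq0 k a b i l : theta_inv_ker k a b i l != 0 -> exists o, im o k i a b l.
Proof. by move=> /X_neq0 [o /(im_cnv arrP)]; exists o. Qed.

(** Two hops of the same power compose only when they are pieces of one reversed interval. The sum
    over cut points is then the quotient of x ^ (L - 1) - y ^ (L - 1) by x - y for x = - q ^ -1 and
    y = - q, whose difference is q - q ^ -1. *)
Lemma X_Xt_comp k a b i l : X k a b i l - theta_inv_ker k a b i l
  = c * \sum_(a1 < n) \sum_(b1 < n) X k a b a1 b1 * theta_inv_ker k a1 b1 i l.
Proof.
have comp (a1 b1 : nat) : X k a b a1 b1 * theta_inv_ker k a1 b1 i l != 0 ->
   [/\ im true k i a b l, (i < a1 < a)%N, b1 = (b + (a - a1))%N,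
     X k a b a1 b1 = orient_w qp true (a - a1) * qp (s a1 a + s b b1) &
     theta_inv_ker k a1 b1 i l = orient_winv true (a1 - i) * qp (s i a1 + s b1 l)].
  move=> /mul_neq0 [/X_neq0 [o1 h1] /Xt_neq0 [o2 h2]].
  have [a1a an _ _] := im_lt arrP h1; have [ia1 _ _ ln] := im_lt arrP h2; have [_ b1E _] := h1; have [_ lE _] := h2.
  case: (im_cat arrP h2 h1) => -[h e]; first by lia.
  have h1' := im_subT h (ltnW ia1) a1a (leqnn _); have h2' := im_subT h (leqnn _) ia1 (ltnW a1a).
  have e1 : (l - (a - i) = b)%N by lia.
  have e2 : (l - (a1 - i) = b1)%N by lia.
  rewrite e1 e2 in h1'; rewrite subnn subn0 e2 in h2'.
  by split=> //; [rewrite ia1|exact: XE|exact: XtE].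
have [hT|nT] := pselect (im true k i a b l); last first.
  rewrite big1 ?mulr0; last first.
    move=> a1 _; rewrite big1 // => b1 _; apply/eqP.
    by apply: contraT => /comp [] /nT.
  have [hF|nF] := pselect (im false k i a b l).
    by rewrite (XE arrP s qp hF) (XtE hF) /hop_w /= subrr.
  by rewrite X_eq0 ?Xt_eq0 ?subrr // => -[].
have [ia an _ ln] := im_lt arrP hT; have [_ lE _] := hT.
pose F a1 := X k a b a1 (b + (a - a1)) * theta_inv_ker k a1 (b + (a - a1)) i l.
have -> : \sum_(a1 < n) \sum_(b1 < n) X k a b a1 b1 * theta_inv_ker k a1 b1 i l = \sum_(a1 < n) F a1.
  apply: eq_bigr => a1 _; apply: (sum_at (F := fun b1 => X k a b a1 b1 * theta_inv_ker k a1 b1 i l)).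
    by move=> b1 /comp [].
  by move=> nb; apply/eqP; apply: contraT => /mul_neq0 [/(X_cons arrP) [_ _ _ ? _]]; lia.
rewrite (sum_range (lo := i) (hi := a)) ?(ltnW an) //; last by move=> x /comp [].
rewrite (XE arrP s qp hT) (XtE hT) /hop_w /orient_w /orient_winv -mulrBl subrXX.
have -> : neg_qinv qp - - qp 1 = c by rewrite /neg_qinv /qdiff; ring.
rewrite -mulrA; congr (_ * _); rewrite mulr_suml.
rewrite (_ : (a - i).-1 = a - i.+1)%N; last by lia.
apply: eq_bigr => -[t /= ta] _; rewrite /F; set m := (i.+1 + t)%N; set w := (b + _)%N.
have h1 : im true k m a b w.
  have := im_subT hT (i' := m) (j' := a); rewrite (_ : l - (a - i) = b)%N; last by lia.
  by rewrite (_ : l - (m - i) = w)%N; [apply|]; rewrite /w /m; lia.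
have h2 : im true k i m w l.
  have := im_subT hT (i' := i) (j' := m); rewrite subnn subn0.
  by rewrite (_ : l - (m - i) = w)%N; [apply|]; rewrite /w /m; lia.
rewrite (XE arrP s qp h1) (XtE h2) /hop_w /orient_w /orient_winv.
have -> : (a - m).-1 = ((a - i.+1).-1 - t)%N by rewrite /m; lia.
have -> : (m - i).-1 = t by rewrite /m; lia.
have sE : s i a + s b l = s m a + s b w + (s i m + s w l).
  have := s_catT arrP sP hT (m := m) (w := w); rewrite (_ : (i < m < a)%N); last by rewrite /m; lia.
  rewrite (_ : w = l - (m - i))%N; last by rewrite /w /m; lia.
  move=> /(_ isT erefl) E; have -> : s i a = s i a - s i m - s m a + s i m + s m a by ring.
  by rewrite E; ring.
by rewrite sE qpD; ring.
Qed.

Lemma Theta_inv k : theta_mx n arr s qp k *m (1%:M - c *: mx2 (theta_inv_ker k)) = 1%:M.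
Proof.
rewrite /theta_mx mulmxDl mul1mx mulmxBr mulmx1 -!scalemxAl -!scalemxAr mul_mx2.
have -> : mx2 (X k) = mx2 (theta_inv_ker k) + c *: mx2 (fun a b i l => \sum_(a1 < n) \sum_(b1 < n) X k a b a1 b1 * theta_inv_ker k a1 b1 i l).
  by apply/matrixP => r t; rewrite !mxE -X_Xt_comp addrC subrK.
by rewrite scalerDr addrK subrK.
Qed.

Lemma T21_Theta k : tr21 (theta_mx n cnv opp_form qp_opp k) = 1%:M - c *: mx2 (theta_inv_ker k).
Proof. by rewrite /theta_mx T21D T21_1 T21Z T21E qcm scaleNr. Qed.

Lemma Theta_T21 k : theta_mx n arr s qp k *m tr21 (theta_mx n cnv opp_form qp_opp k) = 1%:M.
Proof. by rewrite T21_Theta Theta_inv. Qed.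

Lemma J_T21 L : twist n arr s qp L *m tr21 (twist n cnv opp_form qp_opp L) = 1%:M.
Proof.
rewrite /twist; elim: L 1%N => [|L IH] k /=; first by rewrite T21_1 mulmx1.
by rewrite T21M mulmxA -(mulmxA (theta_mx n arr s qp k)) IH mulmx1 Theta_T21.
Qed.

Lemma B0_T21 : braid0 n arr s qp *m tr21 (braid0 n cnv opp_form qp_opp) = 1%:M.
Proof.
rewrite /braid0 T21M mulmxA -(mulmxA _ (theta_mx n arr s qp 0)) Theta_T21 mulmx1 T21E mul_mx2 mx2_1.
apply: eq_mx2 => a b i l an bn iN ln.
pose G a1 b1 := qp (kappa s b a) * diag_ker opp_form qp_opp l i b1 a1.
transitivity (G b a).
  rewrite -(sum_delta (fun a1 => G a1 a) bn); apply: eq_bigr => a1 _.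
  rewrite -(sum_delta (fun b1 => (b == a1)%:R * G a1 b1) an); apply: eq_bigr => b1 _.
  by rewrite /G /diag_ker; ring.
rewrite /G /diag_ker (eq_sym a) (eq_sym b).
have [->|_] := eqVneq l b; last by rewrite andbF mul0r mulr0.
have [->|_] := eqVneq i a; last by rewrite mul0r !mulr0.
by rewrite !mul1r kap_sm /qp_opp -qpD subrr qp0.
Qed.

End Mirror.

(** * Solution for the entries that do not raise the first index *)

Section Lower.
Context (n : nat) (arr : nat -> nat -> Prop) (arrP : arrows n arr).
Context (K : numFieldType) (s : nat -> nat -> K) (sP : r0_form n arr s).
Context (A : comNzRingType) (qp : K -> A).
Hypotheses (qp0 : qp 0%R = 1%R) (qpD : forall x y, qp (x + y)%R = (qp x * qp y)%R).
Context (N : nat) (nil : forall k x y, N <= k -> ~ tau_step n arr k x y) (N0 : 0 < N).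
Local Notation im := (tau_im n arr).
Local Notation JJ := (twist_tail n arr s qp N).
Local Notation kap := (kappa s).
Local Notation Hp := (hop n arr s qp).
Local Open Scope ring_scope.

(* The entries of R_GGS that do not raise the first index. *)
Definition entry_lower (f k i l : nat) : A :=
  if (i < f)%N then \sum_(0 <= p < N) Hp p f k i l else (k == l)%:R * qp (kap f k).
Local Notation Rl := entry_lower.

Lemma hop_eq_Rl a b i l : (i <= a)%N -> (a < n)%N -> (b < n)%N ->
  qp (kap a b) * JJ 0 a b i l = \sum_(k < n) JJ 1 b a k (a + (b - k)) * Rl (a + (b - k)) k i l.
Proof.
rewrite leq_eqVlt => /orP[/eqP -> an bn|ia an bn]; last first.
  rewrite (hop_eq_all arrP sP qp0 qpD nil N0 l ia an bn); apply: eq_bigr => k _.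
  by rewrite /entry_lower (leq_trans ia (leq_addr _ _)).
rewrite (JJ_diag arrP) -[LHS](sum_delta (fun k => qp (kap a k) * (k == l)%:R) bn).
apply: eq_bigr => k _; have [J0|J0] := eqVneq (JJ 1 b a k (a + (b - k))) 0.
  rewrite J0 mul0r; have [e|_] := eqVneq b k; last by rewrite mul0r.
  by move: J0; rewrite e subnn addn0 (JJ_diag arrP) eqxx => /eqP; rewrite oner_eq0.
have [kb _] := Jcons arrP J0; have [e|ne] := eqVneq b k.
  by rewrite /entry_lower -e subnn addn0 ltnn (JJ_diag arrP) eqxx !mul1r mulrC.
have kb' : (k < b)%N by lia.
rewrite mul0r /entry_lower; have -> : (a < a + (b - k))%N by lia.
rewrite mulr_sumr big1 // => p _; apply/eqP; apply: contraT.
move=> /mul_neq0 [_ /Hp_neq0 [o h]]; have [_ lE _] := h.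
have lb : l = b by lia.
by rewrite lb in h; case: (no_cycle arrP J0 kb' h); lia.
Qed.

Lemma J_JJ : twist n arr s qp N.+1 = mx2 n (JJ 1).
Proof.
rewrite /twist (oprod_Theta n arr s qp); apply/matrixP => r t.
by rewrite !mxE JJE.
Qed.

Lemma Theta_JJ : theta_mx n arr s qp 0 *m twist n arr s qp N.+1 = mx2 n (JJ 0).
Proof.
rewrite -[LHS]/(oprod (theta_mx n arr s qp) 0 N.+2) (oprod_Theta n arr s qp).
apply/matrixP => r t; rewrite !mxE JJE (Jk_ext s qp nil) //; lia.
Qed.

Lemma dker_mul f : mx2 n (diag_ker s qp) *m mx2 n f = mx2 n (fun a b i l => qp (kap b a) * f b a i l).
Proof.
rewrite mul_mx2; apply: eq_mx2 => a b i l an bn _ _.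
rewrite -(sum_delta (fun a1 => qp (kap b a) * f a1 a i l) bn); apply: eq_bigr => a1 _.
rewrite -(sum_delta (fun b1 => (b == a1)%:R * (qp (kap b a) * f a1 b1 i l)) an).
by apply: eq_bigr => b1 _; rewrite /diag_ker; ring.
Qed.

(** The twist is unitriangular: a nonzero entry of J in row (b, a) and column (k, f) has k <= b, and
    it is 1 at k = b. So the equation yields the rows of the solution by induction on b; it involves
    only rows with f >= a, which stay in the range i <= f. *)
Lemma lower_entries bk : twist n arr s qp N.+1 *m mx2 n bk = braid0 n arr s qp *m twist n arr s qp N.+1 ->
  forall f k i l, (f < n)%N -> (k < n)%N -> (i <= f)%N -> (l < n)%N -> bk k f i l = Rl f k i l.
Proof.
rewrite /braid0 -mulmxA Theta_JJ dker_mul J_JJ mul_mx2 => E.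
move=> a b; elim/ltn_ind: b a => b IH a i l an bn ia ln.
have := mx2_inj E bn an (leq_ltn_trans ia an) ln; rewrite hop_eq_Rl //.
have -> : \sum_(k < n) \sum_(f < n) JJ 1 b a k f * bk k f i l
    = \sum_(k < n) JJ 1 b a k (a + (b - k)) * bk k (a + (b - k))%N i l.
  apply: eq_bigr => k _; apply: (sum_at (F := fun f => JJ 1 b a k f * bk k f i l)).
    by move=> f /mul_neq0 [/(Jcons arrP) [_ ->]].
  move=> nf; apply/eqP; apply: contraT => /mul_neq0 [J0 _].
  have [kb|bk'] := ltnP (k : nat) b; first by have [_ ?] := JJ_bound arrP J0 kb; lia.
  by have [? _] := Jcons arrP J0; lia.
rewrite (bigD1 (Ordinal bn)) //= [RHS](bigD1 (Ordinal bn)) //= subnn addn0 (JJ_diag arrP) eqxx !mul1r.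
have -> : \sum_(k < n | k != Ordinal bn) JJ 1 b a k (a + (b - k)) * bk k (a + (b - k))%N i l
  = \sum_(k < n | k != Ordinal bn) JJ 1 b a k (a + (b - k)) * Rl (a + (b - k)) k i l.
  apply: eq_bigr => k ne; have [->|J0] := eqVneq (JJ 1 b a k (a + (b - k))) 0; first by rewrite !mul0r.
  have [kb _] := Jcons arrP J0.
  have kb' : (k < b)%N by rewrite ltn_neqAle kb andbT.
  by have [_ fn] := JJ_bound arrP J0 kb'; rewrite IH //; lia.
by move/addIr.
Qed.

End Lower.

Section Conjugate.
Context (n : nat) (arr : nat -> nat -> Prop) (arrP : arrows n arr).
Context (K : numFieldType) (s : nat -> nat -> K) (sP : r0_form n arr s).
Context (A : comNzRingType) (qp : K -> A).
Hypotheses (qp0 : qp 0%R = 1%R) (qpD : forall x y, qp (x + y)%R = (qp x * qp y)%R).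
Context (N : nat) (nil : forall k x y, N <= k -> ~ tau_step n arr k x y) (N0 : 0 < N).
Local Notation im := (tau_im n arr).
Local Notation c := (qdiff qp).
Local Notation kap := (kappa s).
Local Notation cnv := (fun x y => arr y x).
Local Notation opp_form := (opp_form s).
Local Notation qp_opp := (qp_opp qp).
Local Notation B0 := (braid0 n arr s qp).
Local Notation J := (twist n arr s qp N.+1).
Local Notation J' := (twist n cnv opp_form qp_opp N.+1).
Local Notation mx2 := (mx2 n).
Local Open Scope ring_scope.

Lemma T21K (M : 'M[A]_(n * n)) : tr21 (tr21 M) = M.
Proof. by have [f ->] := mx2_surj M; rewrite !T21E. Qed.

Lemma B0E a0 (a0P : arrows n a0) s0 (q0 : K -> A) : (forall u v, s0 u v = - s0 v u) -> q0 0 = 1 ->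
  (forall x y, q0 (x + y) = q0 x * q0 y) ->
  braid0 n a0 s0 q0 = mx2 (fun a b i l => (b == i)%:R * (a == l)%:R * q0 (kappa s0 b a)
    + qdiff q0 * ((a < b)%N && (a == i) && (b == l))%:R).
Proof.
move=> sk q00 q0D; have ThE : theta_mx n a0 s0 q0 0 = mx2 (fun a b i l => ((a == i) && (b == l))%:R + qdiff q0 * theta_ker n a0 s0 q0 0 a b i l).
  by rewrite /theta_mx mx2_1; apply/matrixP => r t; rewrite !mxE.
rewrite /braid0 ThE dker_mul; apply: eq_mx2 => a b i l an bn iN ln.
rewrite mulrDr -natrM mulnb mulrC; congr (_ + _).
rewrite mulrCA; congr (_ * _); have [X0|/X_neq0 [o h]] := eqVneq (theta_ker n a0 s0 q0 0 b a i l) 0.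
  have [/andP[/andP[ab /eqP e] /eqP e']|_] := boolP (_ && _); last by rewrite X0 mulr0.
  subst i l; move: X0; rewrite (XE a0P s0 q0 (@im0 n a0 a b _)) ?ab // /hop_w /= mul1r => X0.
  have := qp_inv q00 q0D (s0 a b + s0 a b); rewrite X0 mul0r => /esym/eqP.
  by rewrite oner_eq0.
have [e e'] := im0E a0P h; subst i l; have [ab _ _ _] := im_lt a0P h.
rewrite (XE a0P s0 q0 (@im0 n a0 a b _)) ?ab // /hop_w /= mul1r !eqxx -q0D.
rewrite /kappa (gtn_eqF ab) (sk b a) [X in q0 X](_ : _ = 0) ?q00 //.
by rewrite addr0; ring.
Qed.

(** Together with [B0_T21], by which the left side is the inverse of [braid0], this is the Hecke
    relation for R_0. *)
Lemma T21_B0 : tr21 (braid0 n cnv opp_form qp_opp) = B0 - c%:M.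
Proof.
rewrite (B0E (arrows_cnv arrP) (s_skew (r0_cnv sP)) (qm0 qp0) (qmD qpD)).
rewrite (B0E arrP (s_skew sP) qp0 qpD) T21E -scalemx1 mx2_1.
pose F (a b i l : nat) := (b == i)%:R * (a == l)%:R * qp (kap b a)
  + c * ((a < b)%N && (a == i) && (b == l))%:R - c * ((a == i) && (b == l))%:R.
transitivity (mx2 F); last by apply/matrixP => r t; rewrite !mxE /F.
apply: eq_mx2 => a b i l _ _ _ _; rewrite /F qcm (kap_sm sP) /qp_opp (eq_sym i b) (eq_sym l a) (eq_sym l b) (eq_sym i a).
have [/andP[/eqP <- /eqP <-]|nE] := boolP ((a == i) && (b == l)).
  rewrite !eqxx !andbT (eq_sym b a) /kappa; case: (ltngtP a b) => [ab|ab|<-] /=.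
  - by rewrite !mul0r ?mulr0 ?mulr1; ring.
  - by rewrite !mul0r ?mulr0 ?mulr1; ring.
  - by rewrite (s_diag sP) mul0rn add0r /qdiff /=; ring.
rewrite -!andbA (andbC (b == l)) (negbTE nE) !andbF !mulr0 subr0 !addr0.
have [bi|_] := eqVneq b i; last by rewrite !mul0r.
have [al|_] := eqVneq a l; last by rewrite mulr0 !mul0r.
subst i l; rewrite !mul1r; congr (qp _).
have ne : (a == b) = false by apply: contraNF nE => /eqP ->; rewrite eqxx.
by rewrite /kappa (s_skew sP a b) (eq_sym b a) ne /= !addr0; ring.
Qed.

(* The braid form P R of the twisted matrix R = J21^-1 R_0 J. *)
Definition braid_mx : 'M[A]_(n * n) := tr21 J' *m B0 *m J.
Local Notation B := braid_mx.

Lemma J_inv : J *m tr21 J' = 1%:M. Proof. exact: (J_T21 arrP sP qpD). Qed.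

Lemma JB : J *m B = B0 *m J. Proof. by rewrite /braid_mx !mulmxA J_inv mul1mx. Qed.

Lemma conj_mul m (X V M1 M2 : 'M[A]_m) : X *m V = 1%:M -> V *m X = 1%:M -> M1 *m M2 = 1%:M ->
  V *m M1 *m X *m (V *m M2 *m X) = 1%:M.
Proof. by move=> XV VX E; rewrite !mulmxA -(mulmxA _ X) XV mulmx1 -(mulmxA _ M1) E mulmx1. Qed.

Lemma B0_hecke : B0 *m (B0 - c%:M) = 1%:M.
Proof. by rewrite -T21_B0 (B0_T21 arrP sP qp0 qpD). Qed.

Lemma B_hecke : B *m (B - c%:M) = 1%:M.
Proof.
have Jv := mulmx1C J_inv.
have -> : B - c%:M = tr21 J' *m (B0 - c%:M) *m J.
  by rewrite mulmxBr mulmxBl /braid_mx mul_mx_scalar -scalemxAl Jv scalemx1.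
exact: (conj_mul J_inv Jv B0_hecke).
Qed.

(** Up to [tr21], the inverse B - c of B solves the mirror image of the equation for B. Hence
    [lower_entries] for the mirror data gives the entries that raise the first index. *)
Lemma mirror_B : exists bm, J' *m mx2 bm = braid0 n cnv opp_form qp_opp *m J' /\ tr21 (mx2 bm) = B - c%:M.
Proof.
have [bm E] := mx2_surj (tr21 (B - c%:M)); exists bm; rewrite -E T21K; split=> //.
apply: (can_inj T21K); rewrite (T21M J') T21K (T21M _ J') T21_B0 mulmxBl mulmxBr mul_scalar_mx mul_mx_scalar.
by congr (_ - _); rewrite /braid_mx -(mulmxA (tr21 J' *m B0) J) J_inv mulmx1.
Qed.

Lemma entries bk : B = mx2 bk -> forall f k i l, (f < n)%N -> (k < n)%N -> (i < n)%N -> (l < n)%N ->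
  bk k f i l = if (i <= f)%N then entry_lower n arr s qp N f k i l
               else c * ((k == i) && (f == l))%:R + entry_lower n cnv opp_form qp_opp N i l f k.
Proof.
move=> E f k i l fn kn iN ln; case: leqP => [i_f|fi].
  by apply: (lower_entries arrP sP qp0 qpD nil N0) => //; rewrite -E JB.
have [bm [Em Tm]] := mirror_B.
have nil' k' x y : (N <= k')%N -> ~ tau_step n cnv k' x y by move=> Nk /(step_cnv arrP) /(nil Nk).
rewrite -(lower_entries (arrows_cnv arrP) (r0_cnv sP) (qm0 qp0) (qmD qpD) nil' N0 Em) ?(ltnW fi) //.
move: Tm; rewrite T21E E -scalemx1 mx2_1 => Tm.
have Tm' : mx2 bk = mx2 (fun a b i l => c * ((a == i) && (b == l))%:R + bm l i b a).
  apply/matrixP => r t; move/matrixP: Tm => /(_ r t); rewrite !mxE => ->.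
  by rewrite addrCA subrr addr0.
by rewrite (mx2_inj Tm').
Qed.

End Conjugate.

(** * From the braid relation to the Yang-Baxter equation *)

Section Permutations.
Context (A : comNzRingType) (n : nat).
Local Notation mx2 := (mx2 n).
Local Notation mx3 := (mx3 n).
Local Notation M12 := (ker12 n).
Local Notation M23 := (ker23 n).
Local Notation M13 := (ker13 n).
Local Open Scope ring_scope.

Definition flip_ker (a b i l : nat) : A := (a == l)%:R * (b == i)%:R.

Lemma P12_mul f : M12 flip_ker *m mx3 f = mx3 (fun a b d a' b' d' => f b a d a' b' d').
Proof.
rewrite mul_mx3; apply: eq_mx3 => a b d a' b' d' an bn dn a'n b'n d'n.
rewrite -(sum_delta (fun a1 => f a1 a d a' b' d') bn); apply: eq_bigr => a1 _.
rewrite -(sum_delta (fun b1 => (b == a1)%:R * f a1 b1 d a' b' d') an).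
apply: eq_bigr => b1 _.
rewrite -(sum_delta (fun d1 => (a == b1)%:R * ((b == a1)%:R * f a1 b1 d1 a' b' d')) dn).
by apply: eq_bigr => d1 _; rewrite /flip_ker; ring.
Qed.

Lemma P23_mul f : M23 flip_ker *m mx3 f = mx3 (fun a b d a' b' d' => f a d b a' b' d').
Proof.
rewrite mul_mx3; apply: eq_mx3 => a b d a' b' d' an bn dn a'n b'n d'n.
rewrite -(sum_delta (fun a1 => f a1 d b a' b' d') an); apply: eq_bigr => a1 _.
rewrite -(sum_delta (fun b1 => (a == a1)%:R * f a1 b1 b a' b' d') dn).
apply: eq_bigr => b1 _.
rewrite -(sum_delta (fun d1 => (d == b1)%:R * ((a == a1)%:R * f a1 b1 d1 a' b' d')) bn).
by apply: eq_bigr => d1 _; rewrite /flip_ker; ring.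
Qed.

Lemma mul_P12 f : mx3 f *m M12 flip_ker = mx3 (fun a b d a' b' d' => f a b d b' a' d').
Proof.
rewrite mul_mx3; apply: eq_mx3 => a b d a' b' d' an bn dn a'n b'n d'n.
rewrite -(sum_delta' (fun a1 => f a b d a1 a' d') b'n); apply: eq_bigr => a1 _.
rewrite -(sum_delta' (fun b1 => (a1 == b' :> nat)%:R * f a b d a1 b1 d') a'n).
apply: eq_bigr => b1 _.
rewrite -(sum_delta' (fun d1 => (b1 == a' :> nat)%:R * ((a1 == b' :> nat)%:R * f a b d a1 b1 d1)) d'n).
by apply: eq_bigr => d1 _; rewrite /flip_ker; ring.
Qed.

Lemma mul_P23 f : mx3 f *m M23 flip_ker = mx3 (fun a b d a' b' d' => f a b d a' d' b').
Proof.
rewrite mul_mx3; apply: eq_mx3 => a b d a' b' d' an bn dn a'n b'n d'n.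
rewrite -(sum_delta' (fun a1 => f a b d a1 d' b') a'n); apply: eq_bigr => a1 _.
rewrite -(sum_delta' (fun b1 => (a1 == a' :> nat)%:R * f a b d a1 b1 b') d'n).
apply: eq_bigr => b1 _.
rewrite -(sum_delta' (fun d1 => (b1 == d' :> nat)%:R * ((a1 == a' :> nat)%:R * f a b d a1 b1 d1)) b'n).
by apply: eq_bigr => d1 _; rewrite /flip_ker; ring.
Qed.

Lemma P_braid_inv (U V : 'M[A]_(n * n * n)) :
  M12 flip_ker *m (M23 flip_ker *m (M12 flip_ker *m U)) = M23 flip_ker *m (M12 flip_ker *m (M23 flip_ker *m V)) -> U = V.
Proof.
have PK12 (M : 'M[A]_(n * n * n)) : M12 flip_ker *m (M12 flip_ker *m M) = M.
  rewrite mulmxA mul_P12; rewrite (_ : mx3 _ = 1%:M) ?mul1mx // mx3_1.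
  by apply: eq_mx3 => a b d a' b' d' *; rewrite /flip_ker -!natrM !mulnb.
have PK23 (M : 'M[A]_(n * n * n)) : M23 flip_ker *m (M23 flip_ker *m M) = M.
  rewrite mulmxA mul_P23; rewrite (_ : mx3 _ = 1%:M) ?mul1mx // mx3_1.
  by apply: eq_mx3 => a b d a' b' d' *; rewrite /flip_ker -!natrM !mulnb andbA.
have PB : M12 flip_ker *m (M23 flip_ker *m M12 flip_ker) = M23 flip_ker *m (M12 flip_ker *m M23 flip_ker).
  rewrite mul_P12 P12_mul mul_P23 P23_mul; apply: eq_mx3 => a b d a' b' d' *.
  by rewrite /flip_ker; ring.
have {}PB (M : 'M[A]_(n * n * n)) :
    M12 flip_ker *m (M23 flip_ker *m (M12 flip_ker *m M)) = M23 flip_ker *m (M12 flip_ker *m (M23 flip_ker *m M)).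
  by rewrite !mulmxA -(mulmxA _ (M23 flip_ker) (M12 flip_ker)) PB !mulmxA.
rewrite PB => E.
by rewrite -(PK23 U) -(PK12 (M23 flip_ker *m U)) -(PK23 (M12 flip_ker *m (M23 flip_ker *m U))) E !(PK12, PK23).
Qed.

Lemma qybe_of_braid (r : 'M[A]_(n * n)) (b := flip_mx A n *m r) :
  leg12 b *m leg23 b *m leg12 b = leg23 b *m leg12 b *m leg23 b ->
  leg12 r *m leg13 r *m leg23 r = leg23 r *m leg13 r *m leg12 r.
Proof.
rewrite /b => {b} E; apply/esym; apply: P_braid_inv; move: E.
have [f ->] := mx2_surj r; rewrite !leg12M !leg23M !leg12E !leg23E leg13E.
pose f13 a d a' d' (_ : nat) := f a d a' d'.
rewrite -/f13.
have e1 : M12 f *m M23 flip_ker = M23 flip_ker *m M13 f13.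
  by rewrite mul_P23 P23_mul; apply: eq_mx3 => *.
have e2 : M23 f *m M12 flip_ker = M12 flip_ker *m M13 f13.
  by rewrite mul_P12 P12_mul; apply: eq_mx3 => *; rewrite mulrC.
have e3 : M13 f13 *m M12 flip_ker = M12 flip_ker *m M23 f.
  by rewrite mul_P12 P12_mul; apply: eq_mx3 => *; rewrite mulrC.
have e4 : M13 f13 *m M23 flip_ker = M23 flip_ker *m M12 f.
  by rewrite mul_P23 P23_mul; apply: eq_mx3 => *.
move=> E; transitivity (M12 flip_ker *m M12 f *m (M23 flip_ker *m M23 f) *m (M12 flip_ker *m M12 f)).
  rewrite -!mulmxA (mulmxA (M12 f) (M23 flip_ker)) e1 -!mulmxA (mulmxA (M23 f) (M12 flip_ker)) e2.
  by rewrite -!mulmxA (mulmxA (M13 f13) (M12 flip_ker)) e3 -!mulmxA.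
rewrite E -!mulmxA (mulmxA (M23 f) (M12 flip_ker)) e2 -!mulmxA (mulmxA (M12 f) (M23 flip_ker)) e1.
by rewrite -!mulmxA (mulmxA (M13 f13) (M23 flip_ker)) e4 -!mulmxA.
Qed.

End Permutations.

Section BraidB.
Context (n : nat) (arr : nat -> nat -> Prop) (arrP : arrows n arr).
Context (K : numFieldType) (s : nat -> nat -> K) (sP : r0_form n arr s).
Context (A : comNzRingType) (qp : K -> A).
Hypotheses (qp0 : qp 0%R = 1%R) (qpD : forall x y, qp (x + y)%R = (qp x * qp y)%R).
Context (N : nat) (nil : forall k x y, N <= k -> ~ tau_step n arr k x y).
Local Notation B0 := (braid0 n arr s qp).
Local Notation B := (braid_mx n arr s qp N).
Local Notation J := (twist n arr s qp N.+1).
Local Notation cnv := (fun x y => arr y x).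
Local Notation tv := (theta23 n arr s qp).
Local Notation tw := (theta13 n arr s qp).
Local Notation Theta := (theta_mx n arr s qp).
Local Open Scope ring_scope.

Definition linv m (M : 'M[A]_m) := exists V, V *m M = 1%:M.

Lemma linvM m (M1 M2 : 'M[A]_m) : linv M1 -> linv M2 -> linv (M1 *m M2).
Proof. by move=> [V1 E1] [V2 E2]; exists (V2 *m V1); rewrite -mulmxA (mulmxA V1) E1 mul1mx. Qed.

Lemma linv_oprod m (F : nat -> 'M[A]_m) i L : (forall k, linv (F k)) -> linv (oprod F i L).
Proof.
move=> FU; elim: L i => [|L IH] i; first by exists 1%:M; rewrite mul1mx.
exact: linvM.
Qed.

Lemma linv_cancel m (M X Y : 'M[A]_m) : linv M -> M *m X = M *m Y -> X = Y.
Proof. by case=> V E H; rewrite -[X]mul1mx -[Y]mul1mx -E -!mulmxA H. Qed.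

Lemma linv_tv k : linv (tv k).
Proof.
have := mulmx1C (Theta_T21 arrP sP qpD k) => E.
by exists (leg23 (tr21 (theta_mx n cnv (opp_form s) (qp_opp qp) k))); rewrite -leg23_Theta -leg23M E leg23_1.
Qed.

Lemma linv_tw k : linv (tw (-1) 0 k).
Proof.
pose E (a b i l : nat) := (a == l)%:R * ((b == i)%:R * qp (- kappa s a b)).
have DE : mx2 n (diag_ker s qp) *m mx2 n E = 1%:M.
  rewrite dker_mul mx2_1; apply: eq_mx2 => a b i l *; rewrite /E.
  rewrite mulrCA (mulrCA (qp _)) -qpD subrr qp0 mulr1 -natrM mulnb andbC.
  by rewrite (eq_sym b l) (eq_sym a i) (eq_sym l b) (eq_sym i a).
have {DE} DE : ker12 n (diag_ker s qp) *m ker12 n E = 1%:M by rewrite -!leg12E -leg12M DE leg12_1.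
have -> : tw (-1) 0 k = ker12 n (diag_ker s qp) *m tv k *m ker12 n E.
  by rewrite (D12_v arrP sP qpD) -mulmxA DE mulmx1.
apply: linvM; last by exists (ker12 n (diag_ker s qp)).
by apply: linvM; [exists (ker12 n E); apply: mulmx1C|exact: linv_tv].
Qed.

Lemma conj_braid m (P b1 b2 x1 x2 : 'M[A]_m) : b1 *m P = P *m x1 -> b2 *m P = P *m x2 ->
  P *m (x1 *m x2 *m x1) = b1 *m b2 *m b1 *m P.
Proof. by move=> C1 C2; rewrite -!mulmxA C1 (mulmxA b2) C2 -!mulmxA !(mulmxA b1) C1 -!mulmxA. Qed.

(** The same matrix [Psi] conjugates B to [braid0] on the legs 1 and 2 and on the legs 2 and 3: each
    time one of its two factorizations splits off the twist on those legs and a factor that commutes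
    with [braid0] there. So the braid relation is inherited from [B0_braid]. *)
Lemma B_braid : leg12 B *m leg23 B *m leg12 B = leg23 B *m leg12 B *m leg23 B.
Proof.
have XN k a b i l : (N.+1 <= k)%N -> theta_ker n arr s qp k a b i l = 0.
  by move=> Nk; apply: (X_nil s qp nil); lia.
pose G1 := oprod (fun i => tw (-1) 0 i *m tv i) 1 N.+1.
have PsiE1 : Psi n arr s qp N.+1 = G1 *m leg12 J by rewrite leg12_J.
have PsiE2 := Psi_alt arrP sP qp0 qpD XN; rewrite -leg23_J in PsiE2.
set G2 := oprod _ _ _ in PsiE2.
have JBE := JB arrP sP qpD N.
have C1 : leg12 B0 *m Psi n arr s qp N.+1 = Psi n arr s qp N.+1 *m leg12 B.
  rewrite PsiE1 mulmxA (B0_comm12 arrP sP qp0 qpD) -mulmxA -leg12M -JBE.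
  by rewrite -(mulmxA G1) -leg12M.
have C2 : leg23 B0 *m Psi n arr s qp N.+1 = Psi n arr s qp N.+1 *m leg23 B.
  rewrite PsiE2 mulmxA (B0_comm23 arrP sP qp0 qpD) -mulmxA -leg23M -JBE.
  by rewrite -(mulmxA G2) -leg23M.
have PsiU : linv (Psi n arr s qp N.+1).
  rewrite PsiE1; apply: linvM.
    by apply: linv_oprod => k; apply: linvM; [exact: linv_tw|exact: linv_tv].
  exists (leg12 (tr21 (twist n cnv (opp_form s) (qp_opp qp) N.+1))).
  by rewrite -leg12M (mulmx1C (J_T21 arrP sP qpD _)) leg12_1.
apply: (linv_cancel PsiU).
by rewrite (conj_braid C1 C2) (conj_braid C2 C1) (B0_braid arrP sP qp0 qpD).
Qed.

End BraidB.

(** * Exponents of a hop and of its mirror image *)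

Section Symmetry.
Context (n : nat) (arr : nat -> nat -> Prop) (arrP : arrows n arr).
Context (K : numFieldType) (s : nat -> nat -> K) (sP : r0_form n arr s).
Local Notation im := (tau_im n arr).
Local Notation imx := (tau_imx n arr).
Local Notation kap := (kappa s).
Local Notation cnv := (fun x y => arr y x).
Local Open Scope ring_scope.

Local Notation U r i f := (tau_imf n arr r i f).1.
Local Notation V r i f := (tau_imf n arr r i f).2.

(** The corrections come from exchanging the arguments of kappa, once for each stage of the
    orbit. *)
Lemma kap_im_sum p o i f k l w : (w < n)%N -> im o p i f k l ->
  kap k w - kap l w = kap i w - kap f w
    - (\sum_(0 <= r < p) ((U r i f == w)%:R - (V r i f == w)%:R)) *+ 2.
Proof.
move=> wn; elim: p o k l => [|p IH] o k l h.
  by have [-> ->] := im0E arrP h; rewrite big_geq // mul0rn subr0.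
move: h; rewrite -addn1 => /(im_decomp arrP) [o1 [u [v [h1 h2]]]].
rewrite addn1 (kap_im1 arrP sP h2 wn) (kapC sP w u) (kapC sP w v) big_nat_recr //= (imfE arrP h1) /=.
have := IH _ _ _ h1; set S := \sum_(0 <= r < p) _ => E.
rewrite (eq_sym w u) (eq_sym w v).
transitivity (kap u w - kap v w - ((u == w)%:R - (v == w)%:R) *+ 2); first by ring.
by rewrite E; ring.
Qed.

Section Hop.
Context (o : bool) (p i f k l : nat) (h : im o p i f k l).
Local Notation L := (f - i)%N.

Let xb r : bool := `[< imx r i f f (f + L) >].
Let yb r : bool := `[< imx r i f (i - L) i >].
Let zb r : bool := `[< imx r i f (k - L) k >].
Let wb r : bool := `[< imx r i f l (l + L) >].

(** The stage p - r touches (i, f) exactly if the images of both under tau ^ r touch, and these are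
    (k, l) and the stage r. The predicates record the side: the stage begins at f, ends at i, ends
    at k, or begins at l. *)
Lemma orb_shift r : (r <= p)%N -> xb (p - r) || yb (p - r) = zb r || wb r.
Proof.
move=> rp; have [if_ fn kl ln] := im_lt arrP h; have [_ lE _] := h.
have dec t : (t <= p)%N -> exists o1 o2 u v, [/\ im o1 t i f u v, im o2 (p - t) u v k l & v = (u + L)%N].
  move=> tp; move: h; rewrite -{1}(subnKC tp) => /(im_decomp arrP) [o1 [u [v [h1 h2]]]].
  by exists o1, (o (+) o1), u, v; split=> //; case: h1.
have [o1 [_ [x [y [h1 _ yE]]]]] := dec r rp.
have [o2 [o3 [u [v [h2 h3 vE]]]]] := dec (p - r)%N (leq_subr _ _).
rewrite subKn // in h3.
have unq t o' u' v' u1 v1 : im o' t i f u' v' -> v1 = (u1 + L)%N -> `[< imx t i f u1 v1 >] = (u' == u1).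
  move=> h' v1E; apply/asboolP/eqP => [[o4 h4]|e]; first by have [] := im_fun arrP h' h4.
  by exists o'; have [_ v'E _] := h'; rewrite v1E -e -v'E.
have unq' t o' u' v' u1 v1 : im o' t i f u' v' -> u1 = (v1 - L)%N -> `[< imx t i f u1 v1 >] = (v' == v1).
  move=> h' v1E; apply/asboolP/eqP => [[o4 h4]|e]; first by have [] := im_fun arrP h' h4.
  exists o'; have [_ v'E _] := h'; rewrite v1E -e (_ : v' - L = u')%N //; lia.
rewrite /xb /yb /zb /wb (unq _ _ _ _ _ _ h2) // (unq' _ _ _ _ _ _ h2) // (unq' _ _ _ _ _ _ h1) //.
rewrite (unq _ _ _ _ _ _ h1) //.
apply/orP/orP => -[/eqP e|/eqP e].
- subst u; case: (im_cat arrP h1 h3) => -[_ e]; [left|right]; by rewrite e.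
- subst v; rewrite e in h3; case: (im_cat arrP h3 h1) => -[_ e']; [right|left]; by rewrite e'.
- rewrite e in h1; case: (im_cat_inv arrP h1 h3) => -[_ e']; [left|right]; by rewrite e'.
- rewrite e in h1; case: (im_cat_inv arrP h3 h1) => -[_ e']; [right|left]; by rewrite e'.
Qed.

Lemma excl_xy r : ~~ (xb r && yb r).
Proof.
apply/negP => /andP[/asboolP [o1 h1] /asboolP [o2 h2]].
have [e1 e2] := im_fun arrP h1 h2; have [? _ _ _] := im_lt arrP h; lia.
Qed.

Lemma excl_zw r : ~~ (zb r && wb r).
Proof.
apply/negP => /andP[/asboolP [o1 h1] /asboolP [o2 h2]].
have [e1 e2] := im_fun arrP h1 h2; have [? _ ? _] := im_lt arrP h; lia.
Qed.

Lemma NN_E : pass_count n arr K p f k i = \sum_(1 <= r < p) (zb r && xb (p - r))%:R.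
Proof.
apply: eq_bigr => r _; congr (nat_of_bool _)%:R.
rewrite /passes_through /zb /xb; apply/asboolP/andP => [[h1 h2]|[/asboolP h1 /asboolP h2]]; last by split.
by split; apply/asboolP.
Qed.

Lemma NN_cnvE : pass_count n cnv K p l i k = \sum_(1 <= r < p) (wb r && yb (p - r))%:R.
Proof.
have [if_ fn kl ln] := im_lt arrP h; have [_ lE _] := h.
have LE : (l - k = L)%N by lia.
have cnvx t u v : (t <= p)%N -> tau_imx n cnv t k l u v <-> imx (p - t) i f u v.
  move=> tp; split=> -[o1].
    move=> /(im_cnv arrP) h1.
    apply/(imx_pre arrP i f (p - t) h1); rewrite subnK //; exists o; exact: h.
  move=> h1; move: h; rewrite -{1}(subnK tp) => /(im_decomp arrP) [o2 [u1 [v1 [h2 h3]]]].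
  have [e1 e2] := im_fun arrP h1 h2; subst u1 v1.
  by exists (o (+) o2); apply/(im_cnv arrP).
apply: eq_big_nat => r /andP[r0 rp]; congr (nat_of_bool _)%:R.
rewrite /passes_through LE /wb /yb; apply/asboolP/andP.
  move=> [/(cnvx _ _ _ (ltnW rp)) h1 /(cnvx _ _ _ (leq_subr _ _))]; rewrite (subKn (ltnW rp)) => h2.
  by split; apply/asboolP.
move=> [/asboolP h1 /asboolP h2]; split; first exact/(cnvx _ _ _ (ltnW rp)).
by apply/(cnvx _ _ _ (leq_subr _ _)); rewrite (subKn (ltnW rp)).
Qed.

(** Once the mixed terms are reindexed by r |-> p - r, the claim holds summand by summand: it is a
    boolean identity in the four predicates at r and p - r, from [orb_shift] and the two
    exclusions. *)
Lemma NN_diff : pass_count n arr K p f k i - pass_count n cnv K p l i k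
  = \sum_(1 <= r < p) ((xb r)%:R - (wb r)%:R).
Proof.
rewrite NN_E NN_cnvE big_nat_rev /= -sumrB.
have E : \sum_(1 <= r < p) (xb (p - r) && wb r)%:R = \sum_(1 <= r < p) (xb r && wb (p - r))%:R :> K.
  rewrite [RHS]big_nat_rev /=; apply: eq_big_nat => r rp.
  by rewrite (_ : 1 + p - r.+1 = p - r)%N ?subKn //; lia.
transitivity (\sum_(1 <= r < p) ((xb r)%:R - (wb r)%:R)
  + \sum_(1 <= r < p) ((xb (p - r) && wb r)%:R - (xb r && wb (p - r))%:R) : K); last first.
  by rewrite [X in _ + X]sumrB E subrr addr0.
rewrite -big_split /=.
apply: eq_big_nat => r rp; rewrite (_ : 1 + p - r.+1 = p - r)%N; last by lia.
rewrite subKn; last by lia.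
have := orb_shift (r := r); have := orb_shift (r := (p - r)%N) (leq_subr _ _).
rewrite subKn; last by lia.
have := excl_xy r; have := excl_xy (p - r); have := excl_zw r; have := excl_zw (p - r).
have -> : (r <= p)%N by lia.
move=> + + + + + /(_ isT).
case: (xb r); case: (yb r); case: (zb r); case: (wb r); case: (xb (p - r)); case: (yb (p - r));
  case: (zb (p - r)); case: (wb (p - r)) => //= *; ring.
Qed.

(** This makes the exponent of the mirror image of a hop the negative of its own. It is the
    difference of [kap_im_sum] at w = f and at w = l: the corrections count the stages of the orbit
    that begin at f or at l, and by [NN_diff] so do the two pass counts. *)
Lemma hop_symmetry : (0 < p)%N ->
  (s i f + s k l - s i l + s f k) *+ 2
  = (f == k)%:R - (l == i)%:R + (pass_count n arr K p f k i - pass_count n cnv K p l i k) *+ 2.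
Proof.
have [if_ fn kl ln] := im_lt arrP h; have [_ lE _] := h.
move=> p0.
have sumE : \sum_(1 <= r < p) ((xb r)%:R - (wb r)%:R)
  = \sum_(1 <= r < p) ((U r i f == f)%:R - (V r i f == f)%:R - ((U r i f == l)%:R - (V r i f == l)%:R)) :> K.
  apply: eq_big_nat => r rp; move: h; rewrite -{1}(subnKC (ltnW (proj2 (andP rp)))).
  move=> /(im_decomp arrP) [o1 [u [v [h1 h2]]]]; have [_ vE _] := h1; rewrite (imfE arrP h1) /=.
  have -> : xb r = (u == f).
    apply/asboolP/eqP => [[o2 h3]|e]; first by have [] := im_fun arrP h1 h3.
    by subst u; exists o1; rewrite -vE.
  have -> : wb r = (u == l).
    apply/asboolP/eqP => [[o2 h3]|e]; first by have [] := im_fun arrP h1 h3.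
    by subst u; exists o1; rewrite -vE.
  have -> : (v == f) = false.
    apply/eqP => e; have ui : u = i by lia.
    by rewrite e ui in h1; have := im_self arrP h1 (@im0 n arr i f _); rewrite if_ fn => /(_ isT); lia.
  have -> : (v == l) = false; last by rewrite /=; ring.
  apply/eqP => e; have uk : u = k by lia.
  by rewrite e uk in h1; have := im_self arrP h1 h; lia.
have := kap_im_sum fn h; have := kap_im_sum ln h.
rewrite !(big_ltn p0) /= (imfE arrP (@im0 n arr i f _)) /=; last by lia.
pose D w := \sum_(1 <= r < p) ((U r i f == w)%:R - (V r i f == w)%:R) : K.
have -> : pass_count n arr K p f k i - pass_count n cnv K p l i k = D f - D l by rewrite NN_diff sumE sumrB.
rewrite -/(D f) -/(D l) => El Ef.
transitivity ((kap i f - kap f f - (kap k f - kap l f)) - (kap i l - kap f l - (kap k l - kap l l))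
  - ((i == f)%:R - 1 - (k == f)%:R + (l == f)%:R - (i == l)%:R + (f == l)%:R + (k == l)%:R - 1)).
  rewrite /kappa !(s_diag sP) !eqxx (s_skew sP k f) (s_skew sP l f) /=; ring.
rewrite Ef El !eqxx (ltn_eqF if_) (ltn_eqF kl) (eq_sym k f) (eq_sym l f) (eq_sym l i) /=; ring.
Qed.

End Hop.
End Symmetry.

(** * Belavin-Drinfeld triples *)

Section Triple.
Context (K : numFieldType) (n : nat).
Context (Gamma1 Gamma2 : {set 'I_n.-1}) (tau : 'I_n.-1 -> 'I_n.-1).
Hypothesis (bd : BD_triple K Gamma1 Gamma2 tau).
Local Open Scope ring_scope.
Local Notation ev := (@evec K n).
Local Notation al := (@alpha K n).

Definition simple_arr (x y : nat) : Prop :=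
  exists2 k : 'I_n.-1, k \in Gamma1 & x = k /\ y = tau k.
Local Notation step := (tau_step n simple_arr).
Local Notation im := (tau_im n simple_arr).

Lemma ord_lt (k : 'I_n.-1) : (k.+1 < n)%N. Proof. by have := ltn_ord k; lia. Qed.

Lemma inner_ev i j : (i < n)%N -> inner (ev i) (ev j) = (i == j)%:R.
Proof.
move=> ltin; rewrite /inner (bigD1 (Ordinal ltin)) //= big1 ?addr0 => [|l ne].
  by rewrite !mxE /= eqxx mul1r.
rewrite !mxE (_ : (l == i :> nat) = false) ?mul0r //.
by apply: contraNF ne => /eqP e; apply/eqP/val_inj.
Qed.

Lemma innerBl (u v w : 'rV[K]_n) : inner (u - v) w = inner u w - inner v w.
Proof. by rewrite /inner -sumrB; apply: eq_bigr => i _; rewrite !mxE mulrBl. Qed.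

Lemma innerBr (u v w : 'rV[K]_n) : inner w (u - v) = inner w u - inner w v.
Proof. by rewrite /inner -sumrB; apply: eq_bigr => i _; rewrite !mxE mulrBr. Qed.

Lemma inner_alpha i j : (i.+1 < n)%N -> (j.+1 < n)%N ->
  inner (al i) (al j) = (i == j)%:R *+ 2 - (adj i j)%:R.
Proof.
move=> iN jN; rewrite /alpha innerBl !innerBr !inner_ev ?(ltnW iN) // eqSS /adj.
rewrite (eq_sym j i.+1); have [<-|ne] := eqVneq i j.
  by rewrite (gtn_eqF (ltnSn i)) (ltn_eqF (ltnSn i)) /=; ring.
have [<-|_] := eqVneq i.+1 j; first by rewrite (ltn_eqF (ltnW (ltnSn i.+1))) /=; ring.
by case: eqVneq => _ /=; ring.
Qed.

Lemma step_iter m (i : 'I_n.-1) y : step m i y <->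
  (forall t, (t < m)%N -> iter t tau i \in Gamma1) /\ y = iter m tau i :> nat.
Proof.
elim: m i y => [|m IH] i y /=.
  by split=> [[-> _]|[_ ->]]; split=> //; exact: ord_lt.
split=> [[z [k kG [ik ->]] /IH [G1 ->]]|[G1 ->]].
  have -> : i = k by apply: val_inj.
  split=> [[|t] //= tm|]; last by rewrite -iterSr.
  by rewrite -iterS iterSr; apply: G1.
exists (tau i); first by exists i => //; apply: (G1 0%N).
apply: (proj2 (IH (tau i) _)); split=> [t tm|]; last by rewrite -iterS iterSr.
by rewrite -iterSr; apply: (G1 t.+1).
Qed.

Lemma simple_arrP : arrows n simple_arr.
Proof.
have [tinj _ tin tnil] := bd; split.
- by move=> x y [k _ [-> ->]]; split; exact: ord_lt.
- by move=> x y y' [k _ [-> ->]] [k' _ [/val_inj <- ->]].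
- by move=> x x' y [k kG [-> ->]] [k' k'G [-> /val_inj e]]; rewrite (tinj _ _ k'G kG).
- move=> x y x' y' [k kG [-> ->]] [k' k'G [-> ->]].
  have := tin _ _ kG k'G; rewrite !inner_alpha; try exact: ord_lt.
  have -> : (tau k == tau k' :> nat) = (k == k' :> nat).
    by apply/eqP/eqP => [/val_inj /(tinj _ _ kG k'G) ->|/val_inj ->].
  move/addrI/oppr_inj/eqP; rewrite eqr_nat.
  by case: (adj k k'); case: (adj (tau k) (tau k')).
have [i|kf kfP] := @boolp.choice _ _ (fun i k => i \in Gamma1 -> iter k tau i \notin Gamma1).
  by have [/tnil [k]|_] := boolP (i \in Gamma1); [exists k|exists 0%N].
(* Each i in [Gamma1] has left it at time [kf i], and the sum bounds all these times; the extra step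
   ensures that a chain starts in [Gamma1]. *)
exists (\sum_i kf i).+1 => x y [z [i iG [_ ->]] st].
have /step_iter [G1 _] : step (\sum_i kf i).+1 i y by exists (tau i) => //; exists i.
by have := kfP i iG; rewrite G1 // ltnS (bigD1 i) //= leq_addr.
Qed.

Lemma ev_alpha i j : (i <= j)%N -> ev i - ev j = \sum_(i <= x < j) al x.
Proof. exact: tele. Qed.

Lemma ev_inj i j i' j' : (i < n)%N -> (j < n)%N -> (i' < n)%N -> (j' < n)%N -> i' <> j' ->
  ev i - ev j = ev i' - ev j' -> i = i' /\ j = j'.
Proof.
move=> iN jN iN' jN' /eqP ne e.
have E x : (i == x)%:R - (j == x)%:R = (i' == x)%:R - (j' == x)%:R :> K.
  by rewrite -!inner_ev // -!innerBl e.
have H (b1 b2 : bool) : b1%:R - b2%:R = 1 :> K -> b1.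
  by move=> /eqP; rewrite subr_eq -(natrD _ 1 b2) eqr_nat; case: b1; case: b2.
have ji : (j' == i') = false by apply/eqP => ee; case/eqP: ne.
have Ei := E i'; rewrite eqxx ji subr0 in Ei.
have Ej := E j'; rewrite eqxx (negbTE ne) sub0r in Ej.
move/(congr1 (-%R)): Ej; rewrite opprB opprK => Ej.
by split; apply/eqP; [exact: H Ei|exact: H Ej].
Qed.

(** The linear form that reads off the coefficient of [alpha x] in a combination of simple roots. *)
Definition coefc (x : nat) : 'cV[K]_n := \col_(l < n) (l <= x)%N%:R.

Lemma root_coefE v x : root_coef v x = (v *m coefc x) 0 0.
Proof.
rewrite mxE /root_coef big_mkcond; apply: eq_bigr => l _; rewrite !mxE.
by case: leq; rewrite ?mulr1 ?mulr0.
Qed.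

Lemma ev_coefc i x : (i < n)%N -> (ev i *m coefc x) 0 0 = (i <= x)%N%:R.
Proof.
move=> iN; rewrite mxE (bigD1 (Ordinal iN)) //= big1 ?addr0 => [|l ne].
  by rewrite !mxE eqxx mul1r.
rewrite !mxE (_ : (l == i :> nat) = false) ?mul0r //.
by apply: contraNF ne => /eqP e; apply/eqP/val_inj.
Qed.

Lemma tildeP i j : (i < j < n)%N ->
  tilde Gamma1 (ev i - ev j) <-> (forall x, (i <= x < j)%N -> exists y, simple_arr x y).
Proof.
move=> /andP[ij jn]; split=> [/andP[sub _] x xij|H].
  have xn : (x < n.-1)%N by lia.
  suff xG : Ordinal xn \in Gamma1 by exists (tau (Ordinal xn)); exists (Ordinal xn).
  (* If the simple root x is missing, the form [coefc x] vanishes on the span of [Gamma1], while its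
     value on e_i - e_j is 1. *)
  apply: contraT => xG; have : (ev i - ev j <= kermx (coefc x))%MS.
    apply: submx_trans sub _; apply/sumsmx_subP => k kG; rewrite genmxE; apply/sub_kermxP.
    apply/matrixP => a b; rewrite !ord1 mulmxBl mxE [in X in _ + X]mxE !ev_coefc ?ord_lt //; last exact: ltnW (ord_lt k).
    rewrite mxE; have kx : (k : nat) <> x by move=> e; case/negP: xG; rewrite (_ : Ordinal xn = k) //; apply: val_inj.
    by case: (ltngtP k x) => // [kx1|]; rewrite ?subrr // => /kx.
  move/sub_kermxP/matrixP => /(_ 0 0); rewrite mulmxBl mxE [in X in _ + X]mxE !ev_coefc ?(ltn_trans ij) //.
  have -> : (i <= x)%N by lia.
  have -> : (j <= x)%N = false by lia.
  by rewrite mxE /= subr0 => /eqP; rewrite oner_eq0.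
apply/andP; split.
  rewrite ev_alpha ?(ltnW ij) // big_seq; apply: summx_sub => x; rewrite mem_index_iota => xij.
  have [y [k kG [-> _]]] := H x xij.
  by apply: (sumsmx_sup k) => //; rewrite genmxE.
apply/existsP; exists (Ordinal (ltn_trans ij jn)); apply/existsP; exists (Ordinal jn).
by rewrite ij eqxx.
Qed.

Lemma tau_ext_sum (I : Type) (r : seq I) (F : I -> 'rV[K]_n) :
  tau_ext tau (\sum_(x <- r) F x) = \sum_(x <- r) tau_ext tau (F x).
Proof.
rewrite /tau_ext exchange_big /=; apply: eq_bigr => k _; rewrite root_coefE mulmx_suml summxE scaler_suml.
by apply: eq_bigr => x _; rewrite root_coefE.
Qed.

Lemma tau_ext_im o i j u v : im o 1 i j u v -> tau_ext tau (ev i - ev j) = ev u - ev v.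
Proof.
move=> h; have [ij _ uv _] := im_lt simple_arrP h.
rewrite !ev_alpha ?(ltnW ij) ?(ltnW uv) // tau_ext_sum.
apply: (im_sum h) => x y _ xy; have [k _ [-> ->]] := proj1 (step1 simple_arrP x y) xy.
exact: tau_ext_alpha.
Qed.

Lemma tau_powS p (v w : 'rV[K]_n) : tau_pow Gamma1 tau p.+1 v w = tilde Gamma1 v && tau_pow Gamma1 tau p (tau_ext tau v) w.
Proof.
rewrite /tau_pow iterSr andbA; congr (_ && _); apply/forallP/andP => [H|[H0 /forallP H] [[|m] mp]] //.
  split; first exact: (H ord0).
  by apply/forallP => m; have := H (lift ord0 m); rewrite lift0 iterSr.
by rewrite /= -iterS iterSr; apply: (H (Ordinal (mp : (m < p)%N))).
Qed.

Lemma tau_powP p i j w : (i < j < n)%N -> tau_pow Gamma1 tau p (ev i - ev j) w <->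
  exists o u v, im o p i j u v /\ w = ev u - ev v.
Proof.
elim: p i j w => [|p IH] i j w ij.
  rewrite /tau_pow; split=> [/andP[_ /eqP ->]|[o [u [v [h ->]]]]].
    exists false, i, j; split=> //; split=> [||x xij]; [lia|lia|split=> //; lia].
  apply/andP; split; first by apply/forallP => -[].
  have [ij' _ H] := h; have [eu _] := H i ltac:(lia).
  have [ev' _] := H j.-1 ltac:(lia); have [_ vE _] := h.
  have [-> ->] : u = i /\ v = j by case: (o) eu ev'; lia.
  by rewrite /=.
rewrite tau_powS; split=> [/andP[/(tildeP ij) dom tp]|[o [u [v [h ->]]]]].
  have [|x xij|o [u [v h]]] := @im_of_dom n simple_arr simple_arrP 1 i j; first by lia.
    by have [y xy] := dom x xij; exists y; exact: (proj2 (step1 simple_arrP x y) xy).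
  rewrite (tau_ext_im h) in tp; have [_ _ uv vn] := im_lt simple_arrP h.
  have uvn : (u < v < n)%N by lia.
  have [o' [u' [v' [h' ->]]]] := proj1 (IH u v w uvn) tp.
  by exists (o (+) o'), u', v'; split=> //; exact: (im_comp simple_arrP h h').
have := h; rewrite -add1n => /(im_decomp simple_arrP) [o1 [u1 [v1 [h1 h2]]]].
apply/andP; split.
  apply/(tildeP ij) => x xij; have [y xy _] := im_root h1 xij.
  by exists y; exact: (proj1 (step1 simple_arrP x y) xy).
rewrite (tau_ext_im h1); have [_ _ uv vn] := im_lt simple_arrP h1.
have uvn : (u1 < v1 < n)%N by lia.
by apply/(IH u1 v1 _ uvn); exists (o (+) o1), u, v; split=> //.
Qed.

Lemma precP i j k l : (i < n)%N -> (j < n)%N -> (k < n)%N -> (l < n)%N ->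
  prec Gamma1 tau (ev i - ev j) (ev k - ev l) <-> exists p o, (0 < p)%N /\ im o p i j k l.
Proof.
move=> iN jN kN lN; split=> [/asboolP [p p0 tp]|[p [o [p0 h]]]].
  have ij : (i < j)%N.
    move: tp; rewrite -(prednK p0) tau_powS => /andP[/andP[_ /existsP[i' /existsP[j' /andP[ij' /eqP e]]]] _].
    by have [|-> ->] := ev_inj iN jN (ltn_ord i') (ltn_ord j') _ e; [lia|].
  have [|o [u [v [h e]]]] := proj1 (@tau_powP p i j _ _) tp; first by rewrite ij.
  exists p, o; split=> //; have [_ _ uv vn] := im_lt simple_arrP h.
  by have [|-> ->] := ev_inj kN lN (ltn_trans uv vn) vn _ e; [lia|].
apply/asboolP; exists p => //; have [ij _ _ _] := im_lt simple_arrP h.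
by apply/tau_powP; [rewrite ij|exists o, k, l].
Qed.

(** From length 2 on, the image of the first simple root alone tells the two orientations apart. *)
Lemma prec_revP i j k l : (k < n)%N -> (l < n)%N -> (i < j < n)%N ->
  prec_rev K Gamma1 tau i j k l <-> exists p, [/\ (0 < p)%N, im true p i j k l & (2 <= j - i)%N].
Proof.
move=> kN lN ij; have iN : (i < i.+1 < n)%N by lia.
split=> [/asboolP [p [p0 tp ij2 tp1]]|[p [p0 h ij2]]].
  have [o [u [v [h e]]]] := proj1 (tau_powP p _ ij) tp.
  have [_ _ uv vn] := im_lt simple_arrP h.
  have [|ku lv] := ev_inj kN lN (ltn_trans uv vn) vn _ e; first by lia.
  rewrite -ku -lv in h uv; exists p; split=> //.
  have [o1 [u1 [v1 [h1 e1]]]] := proj1 (tau_powP p _ iN) tp1; have [_ _ uv1 vn1] := im_lt simple_arrP h1.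
  have [|||l1 _] := ev_inj (i := l.-1) (j := l.-1.+1) _ _ (ltn_trans uv1 vn1) vn1 _ e1; [lia|lia|lia|].
  case: o h => // h; have st := im_rootF h (x := i).
  have [_ _ H1] := h1; have st1 := H1 i ltac:(lia); have [_ lE _] := h; have [_ v1E _] := h1.
  have := step_fun simple_arrP (st ltac:(lia)) st1; case: (o1); lia.
apply/asboolP; exists p; split=> //; first by apply/tau_powP => //; exists true, k, l.
apply/(tau_powP p _ iN); have [_ lE H] := h; have st := H i ltac:(lia).
exists false, l.-1, l.-1.+1; split=> //; split; [lia|lia|] => x xi.
have -> : x = i by lia.
by move: st; rewrite subnn addn0 subn1.
Qed.

End Triple.
Local Open Scope ring_scope.

(** * Power series, tensor coefficients and r0 *)

Section Qpow.
Context (K : numFieldType).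

Lemma qpow0 : qpow 0 = 1 :> fps K.
Proof.
by apply: fpsP => -[|m] /=; rewrite ?expr0n /= ?mulr0 ?mulr1 ?invr1.
Qed.

Lemma qpowD (x y : K) : qpow (x + y) = qpow x * qpow y.
Proof.
apply: fpsP => m; rewrite /= addrC exprDn mulr_sumr; apply: eq_bigr => i _.
have im : (i <= m)%N by rewrite -ltnS.
have nz N : N`!%:R != 0 :> K by rewrite pnatr_eq0 -lt0n fact_gt0.
rewrite -mulr_natr -(bin_fact im) !natrM.
have bz : 'C(m, i)%:R != 0 :> K by rewrite pnatr_eq0 -lt0n bin_gt0.
by field; rewrite !nz bz.
Qed.

End Qpow.

Section Tcoef.
Context (A : comNzRingType) (n : nat).
Implicit Types (a b i l p j k m : 'I_n) (z : 'M[A]_(n * n)).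

Lemma tcoef_munit p j k m a b i l :
  tcoef (munit p j *t munit k m : 'M[A]_(n * n)) a b i l
  = [&& a == p, i == j, b == k & l == m]%:R.
Proof. by rewrite /tcoef tensmxE !mxE -natrM mulnb -andbA. Qed.

Lemma tcoef_sum (I : Type) (r : seq I) (P : pred I) (F : I -> 'M[A]_(n * n)) a b i l :
  tcoef (\sum_(x <- r | P x) F x) a b i l = \sum_(x <- r | P x) tcoef (F x) a b i l.
Proof. exact: summxE. Qed.

Lemma tcoefD z1 z2 a b i l : tcoef (z1 + z2) a b i l = tcoef z1 a b i l + tcoef z2 a b i l.
Proof. exact: mxE. Qed.

Lemma tcoefB z1 z2 a b i l : tcoef (z1 - z2) a b i l = tcoef z1 a b i l - tcoef z2 a b i l.
Proof. by rewrite /tcoef !mxE. Qed.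

Lemma tcoefZ x z a b i l : tcoef (x *: z) a b i l = x * tcoef z a b i l.
Proof. exact: mxE. Qed.

Lemma sum_only (F : 'I_n -> A) a : (forall x, x != a -> F x = 0) -> \sum_x F x = F a.
Proof. by move=> F0; rewrite (bigD1 a) //= big1 ?addr0. Qed.

Lemma tcoef_mx2 (f : nat -> nat -> nat -> nat -> A) a b i l : tcoef (mx2 n f) a b i l = f a b i l.
Proof. exact: mx2E. Qed.

Lemma tcoef_inj z1 z2 : (forall a b i l, tcoef z1 a b i l = tcoef z2 a b i l) -> z1 = z2.
Proof.
move=> E; apply/matrixP => r t; case: (mxtens_indexP r) => a b; case: (mxtens_indexP t) => i l.
exact: E.
Qed.

Lemma tcoef_expand (F : 'I_n -> 'I_n -> 'I_n -> 'I_n -> A) a b i l :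
  tcoef (\sum_p \sum_j \sum_k \sum_m F p j k m *: (munit p j *t munit k m)) a b i l = F a i b l.
Proof.
have Z p j k m : tcoef (F p j k m *: (munit p j *t munit k m)) a b i l
    = F p j k m * [&& a == p, i == j, b == k & l == m]%:R by rewrite tcoefZ tcoef_munit.
rewrite tcoef_sum (sum_only (a := a)) => [|x /negPf ne]; last first.
  rewrite tcoef_sum big1 // => j _; rewrite tcoef_sum big1 // => k _; rewrite tcoef_sum big1 // => m _.
  by rewrite Z (eq_sym a) ne mulr0.
rewrite tcoef_sum (sum_only (a := i)) => [|x /negPf ne]; last first.
  rewrite tcoef_sum big1 // => k _; rewrite tcoef_sum big1 // => m _.
  by rewrite Z (eq_sym i) ne andbF mulr0.
rewrite tcoef_sum (sum_only (a := b)) => [|x /negPf ne]; last first.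
  by rewrite tcoef_sum big1 // => m _; rewrite Z (eq_sym b) ne !andbF mulr0.
rewrite tcoef_sum (sum_only (a := l)) => [|x /negPf ne]; last by rewrite Z (eq_sym l) ne !andbF mulr0.
by rewrite Z !eqxx mulr1.
Qed.

Lemma flipP_pm : flipP = flip_mx A n :> 'M[A]_(n * n).
Proof.
apply: tcoef_inj => a b i l; rewrite tcoef_mx2 tcoef_sum (sum_only (a := a)) => [|x /negPf ne].
  rewrite tcoef_sum (sum_only (a := i)) => [|x /negPf ne].
    by rewrite tcoef_munit !eqxx /= andbC (eq_sym l a) -natrM mulnb.
  by rewrite tcoef_munit (eq_sym i) ne andbF.
by rewrite tcoef_sum big1 // => j _; rewrite tcoef_munit (eq_sym a) ne.
Qed.

Lemma tcoef_P0 a b i l : tcoef (P0 : 'M[A]_(n * n)) a b i l = [&& a == i, a == b & a == l]%:R.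
Proof.
rewrite tcoef_sum (sum_only (a := a)) => [|x /negPf ne].
  by rewrite tcoef_munit eqxx (eq_sym i) (eq_sym b) (eq_sym l).
by rewrite tcoef_munit (eq_sym a) ne.
Qed.

Lemma tcoef_diag a b i l :
  tcoef (\sum_i \sum_(j | i != j) munit i i *t munit j j : 'M[A]_(n * n)) a b i l
  = [&& a == i, b == l & a != b]%:R.
Proof.
rewrite tcoef_sum (sum_only (a := a)) => [|x /negPf ne]; last first.
  by rewrite tcoef_sum big1 // => j _; rewrite tcoef_munit (eq_sym a) ne.
rewrite tcoef_sum big_mkcond (sum_only (a := b)) /=; last first.
  by move=> x /negPf ne; case: ifP => // _; rewrite tcoef_munit (eq_sym b) ne !andbF.
rewrite tcoef_munit !eqxx (eq_sym i) (eq_sym l) andTb andTb.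
by case: (a == b); case: (a == i); case: (b == l).
Qed.

Lemma tcoef_lower a b i l :
  tcoef (\sum_(i < n) \sum_(j < n | (j < i)%N) munit i j *t munit j i : 'M[A]_(n * n)) a b i l
  = [&& a == l, b == i & (b < a)%N]%:R.
Proof.
rewrite tcoef_sum (sum_only (a := a)) => [|x /negPf ne]; last first.
  by rewrite tcoef_sum big1 // => j _; rewrite tcoef_munit (eq_sym a) ne.
rewrite tcoef_sum big_mkcond (sum_only (a := b)) /=; last first.
  by move=> x /negPf ne; case: ifP => // _; rewrite tcoef_munit (eq_sym b) ne !andbF.
rewrite tcoef_munit !eqxx (eq_sym i) (eq_sym l) andTb andTb.
by case: ifP => ba; case: (b == i); case: (a == l).
Qed.

Lemma tcoef_lower' a b i l :
  tcoef (\sum_(i < n) \sum_(j < n | (i < j)%N) munit j i *t munit i j : 'M[A]_(n * n)) a b i l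
  = [&& a == l, b == i & (b < a)%N]%:R.
Proof.
rewrite tcoef_sum (sum_only (a := b)) => [|x /negPf ne]; last first.
  by rewrite tcoef_sum big1 // => j _; rewrite tcoef_munit (eq_sym b) ne !andbF.
rewrite tcoef_sum big_mkcond (sum_only (a := a)) /=; last first.
  by move=> x /negPf ne; case: ifP => // _; rewrite tcoef_munit (eq_sym a) ne.
rewrite tcoef_munit !eqxx (eq_sym i) (eq_sym l) andTb andTb.
by case: ifP => ba; case: (b == i); case: (a == l).
Qed.

End Tcoef.

Section GGSKernels.
Context (K : numFieldType) (n : nat).
Context (Gamma1 : {set 'I_n.-1}) (tau : 'I_n.-1 -> 'I_n.-1).
Local Notation ev := (@evec K n).
Local Notation pr i j k l := (prec Gamma1 tau (ev i - ev j) (ev k - ev l)).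
Local Notation sg := (sgn K Gamma1 tau).
Implicit Types (a b i l : 'I_n).

Lemma tcoef_a a b i l : tcoef (GGS_a K Gamma1 tau) a b i l
  = (pr i a b l)%:R * sg i a b l - (pr l b a i)%:R * sg l b a i.
Proof.
rewrite /GGS_a.
have E (p j k m : 'I_n) : tcoef (sg p j k m *: wedge (munit j p) (munit k m)) a b i l
    = sg p j k m * [&& a == j, i == p, b == k & l == m]%:R
      - sg p j k m * [&& a == k, i == m, b == j & l == p]%:R.
  by rewrite tcoefZ /wedge tcoefB !tcoef_munit mulrBr.
rewrite tcoef_sum; under eq_bigr => p _.
  rewrite tcoef_sum; under eq_bigr => j _.
    rewrite tcoef_sum; under eq_bigr => k _.
      rewrite tcoef_sum big_mkcond.
      under eq_bigr => m _ do rewrite E.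
      rewrite (_ : \sum_m _ = \sum_(m < n) ((if pr p j k m then sg p j k m * [&& a == j, i == p, b == k & l == m]%:R else 0)
        - (if pr p j k m then sg p j k m * [&& a == k, i == m, b == j & l == p]%:R else 0))); last first.
        by apply: eq_bigr => m _; case: ifP => _; rewrite ?subr0.
      rewrite sumrB; over.
    rewrite sumrB; over.
  rewrite sumrB; over.
rewrite sumrB; congr (_ - _).
  rewrite (sum_only (a := i)) => [|x /negPf ne]; last first.
    by rewrite big1 // => j _; rewrite big1 // => k _; rewrite big1 // => m _; rewrite (eq_sym i) ne andbF mulr0 if_same.
  rewrite (sum_only (a := a)) => [|x /negPf ne]; last first.
    by rewrite big1 // => k _; rewrite big1 // => m _; rewrite (eq_sym a) ne mulr0 if_same.
  rewrite (sum_only (a := b)) => [|x /negPf ne]; last first.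
    by rewrite big1 // => m _; rewrite (eq_sym b) ne !andbF mulr0 if_same.
  rewrite (sum_only (a := l)) => [|x /negPf ne]; last by rewrite (eq_sym l) ne !andbF mulr0 if_same.
  by rewrite !eqxx mulr1; case: ifP; rewrite ?mul1r ?mul0r.
rewrite (sum_only (a := l)) => [|x /negPf ne]; last first.
  by rewrite big1 // => j _; rewrite big1 // => k _; rewrite big1 // => m _; rewrite (eq_sym l) ne !andbF mulr0 if_same.
rewrite (sum_only (a := b)) => [|x /negPf ne]; last first.
  by rewrite big1 // => k _; rewrite big1 // => m _; rewrite (eq_sym b) ne !andbF mulr0 if_same.
rewrite (sum_only (a := a)) => [|x /negPf ne]; last first.
  by rewrite big1 // => m _; rewrite (eq_sym a) ne mulr0 if_same.
rewrite (sum_only (a := i)) => [|x /negPf ne]; last by rewrite (eq_sym i) ne !andbF mulr0 if_same.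
by rewrite !eqxx mulr1; case: ifP; rewrite ?mul1r ?mul0r.
Qed.

Lemma tcoef_Rs a b i l : tcoef (R_s K n) a b i l
  = q * [&& a == i, a == b & a == l]%:R + [&& a == i, b == l & a != b]%:R
    + (q - qinv) * [&& a == l, b == i & (b < a)%N]%:R.
Proof.
have E x y (U V W : 'M[fps K]_(n * n)) : tcoef (x *: U + V + y *: W) a b i l
    = x * tcoef U a b i l + tcoef V a b i l + y * tcoef W a b i l by rewrite !tcoefD !tcoefZ.
rewrite /R_s [LHS]E; congr (_ * _ + _ + _ * _).
- exact: tcoef_P0.
- exact: tcoef_diag.
- exact: tcoef_lower.
Qed.

Lemma tcoef_rs a b i l : tcoef (r_s K n) a b i l
  = 2^-1 * [&& a == i, a == b & a == l]%:R + [&& a == l, b == i & (b < a)%N]%:R.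
Proof. by rewrite /r_s tcoefD tcoefZ tcoef_P0 tcoef_lower'. Qed.

Lemma tcoef_Rbar a b i l : tcoef (Rbar_GGS K Gamma1 tau) a b i l
  = tcoef (R_s K n) a b i l + (q - qinv)
    * (fpsC (tcoef (GGS_a K Gamma1 tau) a b i l)
       * qpow (tcoef (GGS_a K Gamma1 tau) a b i l * tcoef (GGS_eps K Gamma1 tau) a b i l)).
Proof.
have E x (U V : 'M[fps K]_(n * n)) : tcoef (U + x *: V) a b i l
    = tcoef U a b i l + x * tcoef V a b i l by rewrite tcoefD tcoefZ.
rewrite /Rbar_GGS [LHS]E; congr (_ + _ * _).
exact: tcoef_expand.
Qed.

End GGSKernels.

Section Diagonal.
Context (K : numFieldType) (n : nat).

Definition dg (A : comNzRingType) (d : nat -> nat -> A) (x y z t : nat) : A :=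
  ((x == z) && (y == t))%:R * d x y.

Lemma dg_mul (A : comNzRingType) d f : mx2 n (dg d) *m mx2 n f = mx2 n (fun x y z t => d x y * f x y z t) :> 'M[A]_(n * n).
Proof.
rewrite mul_mx2; apply: eq_mx2 => a b i l an bn _ _.
rewrite -(sum_delta (fun a1 => d a b * f a1 b i l) an); apply: eq_bigr => a1 _.
rewrite -(sum_delta (fun b1 => (a == a1)%:R * (d a b * f a1 b1 i l)) bn); apply: eq_bigr => b1 _.
by rewrite /dg -mulnb natrM; ring.
Qed.

Lemma mul_dg (A : comNzRingType) d f : mx2 n f *m mx2 n (dg d) = mx2 n (fun x y z t => f x y z t * d z t) :> 'M[A]_(n * n).
Proof.
rewrite mul_mx2; apply: eq_mx2 => a b i l _ _ iN ln.
rewrite -(sum_delta' (fun a1 => f a b a1 l * d a1 l) iN); apply: eq_bigr => a1 _.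
rewrite -(sum_delta' (fun b1 => (a1 == i :> nat)%:R * (f a b a1 b1 * d a1 b1)) ln); apply: eq_bigr => b1 _.
by rewrite /dg -mulnb natrM; ring.
Qed.

Lemma qpow_mx_dg (s : nat -> nat -> K) : qpow_mx (mx2 n (dg s)) = mx2 n (dg (fun x y => qpow (s x y))).
Proof.
have pw m : mx2 n (dg s) ^+ m = mx2 n (dg (fun x y => s x y ^+ m)).
  elim: m => [|m IH].
    by rewrite expr0 -[1]/(1%:M) mx2_1; apply: eq_mx2 => *; rewrite /dg mulr1.
  by rewrite exprS -[_ * _]/(_ *m _) IH dg_mul; apply: eq_mx2 => a b i l *; rewrite /dg mulrCA exprS.
apply: tcoef_inj => a b i l; rewrite tcoef_mx2 /tcoef mxE.
have E m : (mx2 n (dg s) ^+ m) (mxtens_index (a, b)) (mxtens_index (i, l))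
    = (((a : nat) == i) && ((b : nat) == l))%:R * s a b ^+ m by rewrite pw mx2E.
rewrite /dg; case: (_ && _) E => E; rewrite ?mul1r ?mul0r; apply: fpsP => m /=.
  by rewrite mxE E mul1r.
by rewrite mxE E mul0r mulr0.
Qed.

End Diagonal.

Section Rzero.
Context (K : numFieldType) (n : nat).
Context (Gamma1 : {set 'I_n.-1}) (tau : 'I_n.-1 -> 'I_n.-1).

Lemma hwedgeh_diag (r0 : 'M[K]_(n * n)) : in_hwedgeh r0 ->
  exists s : nat -> nat -> K, (forall u v, s u v = - s v u) /\ r0 = mx2 n (dg s).
Proof.
case=> xs r0E; pose t (a b : 'I_n) := \sum_(xy <- xs) (xy.1 0 a * xy.2 0 b - xy.2 0 a * xy.1 0 b).
have tE a b i l : tcoef r0 a b i l = ((a == i) && (b == l))%:R * t a b.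
  rewrite r0E tcoef_sum mulr_sumr; apply: eq_bigr => xy _.
  rewrite /wedge tcoefB /tcoef !tensmxE !mxE -mulr_natr -[X in _ * X - _]mulr_natr.
  rewrite -[X in _ - X * _]mulr_natr -[X in _ - _ * X]mulr_natr -mulnb natrM; ring.
exists (fun u v => if insub u is Some a then if insub v is Some b then t a b else 0 else 0); split.
  move=> u v; case: insubP => [a _ _|_]; case: insubP => [b _ _|_]; rewrite ?oppr0 //.
  by rewrite /t -sumrN; apply: eq_bigr => xy _; ring.
by apply: tcoef_inj => a b i l; rewrite tE tcoef_mx2 /dg !valK.
Qed.

Lemma contractE (v : 'rV[K]_n) (z : 'M[K]_(n * n)) b : contract v z b b = \sum_i tcoef z i b i b * v 0 i.
Proof.
have hE i j : hform v (munit i j) = (i == j)%:R * v 0 i.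
  rewrite /hform (sum_only (a := i)) => [|x /negPf ne]; last by rewrite !mxE ne mulr0.
  by rewrite !mxE eqxx mulrC.
rewrite /contract summxE; apply: eq_bigr => i _; rewrite summxE.
rewrite (sum_only (a := i)) => [|x /negPf ne]; last first.
  rewrite summxE big1 // => k _; rewrite summxE big1 // => l _.
  by rewrite hE eq_sym ne mul0r mulr0 scale0r mxE.
rewrite summxE (sum_only (a := b)) => [|x /negPf ne]; last first.
  by rewrite summxE big1 // => l _; rewrite !mxE (eq_sym b) ne mulr0.
rewrite summxE (sum_only (a := b)) => [|x /negPf ne]; last first.
  by rewrite !mxE (eq_sym b x) ne andbF mulr0.
by rewrite !mxE !eqxx mulr1 hE eqxx mul1r.
Qed.

Lemma sum_ev (F : nat -> K) x : (x < n)%N -> \sum_(i < n) F i * (@evec K n x) 0 i = F x.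
Proof.
move=> xn; rewrite -[RHS](sum_delta' F xn); apply: eq_bigr => i _.
by rewrite mxE mulrC.
Qed.

(** The diagonal entry at v of the equation of r0, multiplied by -2; [P0] contributes the Kronecker
    symbols in kappa. *)
Lemma r0_form_of (s : nat -> nat -> K) : (forall u v, s u v = - s v u) ->
  r0_equation Gamma1 tau (mx2 n (dg s)) -> r0_form n (simple_arr Gamma1 tau) s.
Proof.
move=> sk E; split=> // x y v [k kG [-> ->]] vn.
have kn := ord_lt k; have tn := ord_lt (tau k).
have := E k kG => /matrixP /(_ (Ordinal vn) (Ordinal vn)).
rewrite contractE [in RHS]mxE contractE.
have -> : \sum_i tcoef (mx2 n (dg s)) i (Ordinal vn) i (Ordinal vn) * (alpha k - alpha (tau k)) 0 i
    = s k v - s k.+1 v - s (tau k) v + s (tau k).+1 v.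
  rewrite -!(sum_ev (fun i => s i v)) //; try exact: ltnW.
  rewrite -!sumrB -big_split; apply: eq_bigr => i _.
  by rewrite tcoef_mx2 /dg !eqxx mul1r /alpha !mxE /=; ring.
have -> : \sum_i tcoef (P0 : 'M[K]_(n * n)) i (Ordinal vn) i (Ordinal vn) * (alpha k + alpha (tau k)) 0 i
    = ((k : nat) == v)%:R - (k.+1 == v)%:R + ((tau k : nat) == v)%:R - ((tau k).+1 == v)%:R.
  rewrite -!(sum_ev (fun i => (i == v)%:R)) //; try exact: ltnW.
  rewrite -!sumrB -big_split -sumrB; apply: eq_bigr => i _.
  by rewrite tcoef_P0 eqxx andbb -val_eqE /alpha !mxE /=; ring.
rewrite /kappa (sk v k) (sk v k.+1) (eq_sym v k) (eq_sym v k.+1) => H.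
have {}H : (s k v - s k.+1 v - s (tau k) v + s (tau k).+1 v) *+ 2
  = ((k : nat) == v)%:R - (k.+1 == v)%:R + ((tau k : nat) == v)%:R - ((tau k).+1 == v)%:R.
  by rewrite H -[LHS]mulr_natl mulrA mulfV ?mul1r // pnatr_eq0.
apply/eqP; rewrite -subr_eq0; apply/eqP.
transitivity (- ((s k v - s k.+1 v - s (tau k) v + s (tau k).+1 v) *+ 2
  - (((k : nat) == v)%:R - (k.+1 == v)%:R + ((tau k : nat) == v)%:R - ((tau k).+1 == v)%:R))); first by ring.
by rewrite H subrr oppr0.
Qed.

End Rzero.

Section FpsCoef.
Context (K : numFieldType).

Lemma fcoef_sum (I : Type) (r : seq I) (P : pred I) (F : I -> fps K) m :
  fcoef (\sum_(x <- r | P x) F x) m = \sum_(x <- r | P x) fcoef (F x) m.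
Proof. by elim/big_rec2: _ => [//|x y z _ <-]. Qed.

Lemma fcoefM0 (x y : fps K) : fcoef (x * y) 0 = fcoef x 0 * fcoef y 0.
Proof. by rewrite /= big_ord1. Qed.

Lemma fcoefM1 (x y : fps K) : fcoef (x * y) 1 = fcoef x 0 * fcoef y 1 + fcoef x 1 * fcoef y 0.
Proof. by rewrite /= !big_ord_recr big_ord0 /= add0r. Qed.

Lemma fcoefM2 (x y : fps K) : fcoef (x * y) 2
  = fcoef x 0 * fcoef y 2 + fcoef x 1 * fcoef y 1 + fcoef x 2 * fcoef y 0.
Proof. by rewrite /= !big_ord_recr big_ord0 /= add0r. Qed.

Lemma fpsC0 : fpsC 0 = 0 :> fps K. Proof. by apply: fpsP => -[]. Qed.

Lemma fcoefCM (x : K) y m : fcoef (fpsC x * y) m = x * fcoef y m.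
Proof.
rewrite /= big_ord_recl /= subn0 big1 ?addr0 // => i _.
by rewrite mul0r.
Qed.

Lemma fpsCM (x y : K) : fpsC (x * y) = fpsC x * fpsC y.
Proof. by apply: fpsP => m; rewrite fcoefCM; case: m => [|m] /=; rewrite ?mulr0. Qed.

Lemma fpsCN (x : K) : fpsC (- x) = - fpsC x.
Proof. by apply: fpsP => -[|m] /=; rewrite ?oppr0. Qed.

Lemma fpsCX (x : K) m : fpsC (x ^+ m) = fpsC x ^+ m.
Proof. by elim: m => [|m IH]; rewrite ?expr0 // !exprS fpsCM IH. Qed.

Lemma qpowX (x : K) m : qpow x ^+ m = qpow (x *+ m).
Proof. by elim: m => [|m IH]; rewrite ?expr0 ?mulr0n ?qpow0 // exprS mulrS qpowD IH. Qed.

Lemma fcoef_bool (b : bool) m : fcoef (b%:R : fps K) m = ((m == 0%N) && b)%:R.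
Proof. by case: b m => -[|m]. Qed.

(** The value of [orient_w] at hbar = 0, which by [sgn_im] is the sign of the pair of roots. *)
Definition orient_sgn (o : bool) (L : nat) : K := if o then (-1) ^+ L.-1 else 1.

Lemma sgl_sq o L : orient_sgn o L * orient_sgn o L = 1.
Proof. by case: o; rewrite /orient_sgn ?mulr1 // -exprMn mulrNN mulr1 expr1n. Qed.

Lemma qpow_sgl (x : K) L : (- qpow x) ^+ L = fpsC ((-1) ^+ L) * qpow (x *+ L).
Proof. by rewrite [LHS]exprNn qpowX fpsCX fpsCN. Qed.

End FpsCoef.

(** * The form x q ^ y (q - q ^ -1) of the hops *)

Section Entries.
Context (K : numFieldType) (n : nat) (arr : nat -> nat -> Prop) (arrP : arrows n arr).
Context (s : nat -> nat -> K) (sP : r0_form n arr s).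
Context (N : nat) (nil : forall k x y, (N <= k)%N -> ~ tau_step n arr k x y) (N0 : (0 < N)%N).
Local Notation im := (tau_im n arr).
Local Notation qp := (@qpow K).
Local Notation c := (qdiff qp).
Local Notation cnv := (fun x y => arr y x).
Local Notation NN := (pass_count n arr K).
Local Notation Rl := (entry_lower n arr s qp N).
Local Notation Rl' := (entry_lower n cnv (opp_form s) (qp_opp qp) N).

Definition orient_exp (o : bool) (L : nat) : K := if o then L.-1%:R else 0.

(** The exponent left in a hop after the factors q ^ r0 on both sides and the sign are split off;
    the last term is the power of q in the weight of a reversed interval. *)
Definition eta (p : nat) (o : bool) (f k i l : nat) : K :=
  s i f + s k l + s f k - s i l - (f == k)%:R - NN p f k i *+ 2 - orient_exp o (f - i).

Lemma Hp_val p o f k i l : im o p i f k l -> hop n arr s qp p f k i l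
  = qp (s f k) * (c * (fpsC (orient_sgn K o (f - i)) * qp (eta p o f k i l))) * qp (s i l).
Proof.
move=> h; rewrite /hop (XE arrP s qp h) /hop_w.
have -> : orient_w qp o (f - i) = fpsC (orient_sgn K o (f - i)) * qp (- orient_exp o (f - i)).
  rewrite /orient_w /orient_sgn /neg_qinv /orient_exp; case: (o); last by rewrite oppr0 qpow0 mulr1.
  by rewrite qpow_sgl mulNrn.
set x := fpsC _.
have -> (u v w : fps K) : c * (x * u * v * w) = x * c * (u * v * w) by ring.
have -> (u v w : fps K) : u * (c * (x * v)) * w = x * c * (u * v * w) by ring.
by rewrite -!qpowD; congr (_ * qp _); rewrite /eta; ring.
Qed.

(** Passing to q ^ -1 changes the sign of q - q ^ -1, hence that of the coefficient. That the
    exponent is exactly the opposite of the one for the hop from (k, f) to (l, i) is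
    [hop_symmetry]. *)
Lemma Hp_mirror_val p o f k i l : (0 < p)%N -> im o p l k f i -> hop n cnv (opp_form s) (qp_opp qp) p i l f k
  = qp (s f k) * (c * (fpsC (- orient_sgn K o (k - l)) * qp (- eta p o k f l i))) * qp (s i l).
Proof.
move=> p0 h; have h' : tau_im n cnv o p f i l k by apply/(im_cnv arrP).
have S := hop_symmetry arrP sP h p0; have [_ iE _] := h; have [_ kE _] := h'.
rewrite /hop (XE (arrows_cnv arrP) (opp_form s) (qp_opp qp) h') /hop_w qcm.
have LE : (i - f = k - l)%N by lia.
have -> : orient_w (qp_opp qp) o (i - f) = fpsC (orient_sgn K o (k - l)) * qp (orient_exp o (k - l)).
  rewrite LE /orient_w /orient_sgn /neg_qinv /orient_exp; case: (o); last by rewrite qpow0 mulr1.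
  by rewrite /qp_opp opprK qpow_sgl.
rewrite fpsCN; set x := fpsC _; rewrite /qp_opp.
have -> (u v w : fps K) : - c * (x * u * v * w) = - (x * c) * (u * v * w) by ring.
have -> (u v w : fps K) : u * (c * (- x * v)) * w = - (x * c) * (u * v * w) by ring.
rewrite -!qpowD; congr (_ * qp _).
have {}S : (s l k + s f i - s l i + s k f) *+ 2 - ((k == f)%:R - (i == l)%:R + (NN p k f l - pass_count n cnv K p i l f) *+ 2) = 0.
  by rewrite S subrr.
apply/eqP; rewrite -subr_eq0 -S; apply/eqP.
by rewrite /eta /opp_form (s_skew sP l i) (s_skew sP k f); ring.
Qed.

Lemma hop_bound o p i f k l : im o p i f k l -> (p < N)%N.
Proof. by move=> h; rewrite ltnNge; apply/negP => Np; case: (im_nil nil Np h). Qed.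

Lemma sum_hop (F : nat -> fps K) p : (p < N)%N -> (forall r, r <> p -> F r = 0) ->
  \sum_(0 <= r < N) F r = F p.
Proof.
move=> pN F0; rewrite big_mkord (bigD1 (Ordinal pN)) //= big1 ?addr0 // => r ne.
by apply: F0 => e; case/eqP: ne; apply: val_inj.
Qed.

Lemma Rl_hop o p f k i l : im o p i f k l -> Rl f k i l = hop n arr s qp p f k i l.
Proof.
move=> h; have [if_ _ _ _] := im_lt arrP h; rewrite /entry_lower if_; apply: (sum_hop (hop_bound h)) => r ne.
rewrite /hop X_eq0 ?mul0r ?mulr0 // => o' h'; case: ne; exact: (im_self arrP h' h).
Qed.

Lemma Rl_none f k i l : (i < f)%N -> (forall p o, ~ im o p i f k l) -> Rl f k i l = 0.
Proof.
move=> if_ nh; rewrite /entry_lower if_ big1 // => p _.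
by rewrite /hop X_eq0 ?mul0r ?mulr0 // => o /nh.
Qed.

Lemma Rl_mirror_hop o p f k i l : im o p l k f i -> Rl' i l f k = hop n cnv (opp_form s) (qp_opp qp) p i l f k.
Proof.
move=> h; have [_ _ fi _] := im_lt arrP h; rewrite /entry_lower fi; apply: (sum_hop (hop_bound h)) => r ne.
rewrite /hop X_eq0 ?mul0r ?mulr0 // => o' /(im_cnv arrP) h'; case: ne; exact: (im_self arrP h' h).
Qed.

Lemma Rl_mirror_none f k i l : (f < i)%N -> (forall p o, ~ im o p l k f i) -> Rl' i l f k = 0.
Proof.
move=> fi nh; rewrite /entry_lower fi big1 // => p _.
by rewrite /hop X_eq0 ?mul0r ?mulr0 // => o /(im_cnv arrP) /nh.
Qed.

End Entries.

(** * Comparison with the GGS matrix *)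

Section Identification.
Context (K : numFieldType) (n : nat).
Context (Gamma1 Gamma2 : {set 'I_n.-1}) (tau : 'I_n.-1 -> 'I_n.-1).
Hypothesis (bd : BD_triple K Gamma1 Gamma2 tau).
Context (s : nat -> nat -> K) (sP : r0_form n (simple_arr Gamma1 tau) s).
Local Notation ar := (simple_arr Gamma1 tau).
Local Notation arP := (simple_arrP bd).
Context (N : nat) (nil : forall k x y, (N <= k)%N -> ~ tau_step n ar k x y) (N0 : (0 < N)%N).
Local Notation im := (tau_im n ar).
Local Notation qp := (@qpow K).
Local Notation c := (qdiff qp).
Local Notation B := (braid_mx n ar s qp N).
Local Notation al := (tcoef (GGS_a K Gamma1 tau)).
Local Notation rho := (fun a b i l => tcoef (r_s K n) a b i l + al a b i l).
Implicit Types (a b i l f k : 'I_n).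

Lemma sgn_im p o i j k l : (0 < p)%N -> (i < n)%N -> (j < n)%N -> (k < n)%N -> (l < n)%N ->
  im o p i j k l -> sgn K Gamma1 tau i j k l = orient_sgn K o (j - i).
Proof.
move=> p0 iN jN kN lN h; have [ij _ _ _] := im_lt arP h; have ijn : (i < j < n)%N by rewrite ij.
rewrite /sgn; case: ifPn => [/(prec_revP bd kN lN ijn) [p' [p'0 h' ij2]]|nrev].
  have e := im_self arP h h'; rewrite e in h; have ij1 : (i.+1 < j)%N by lia.
  rewrite (im_or arP ij1 h h') /orient_sgn.
  have -> : (1 - (j - i)%N%:Z) = - ((j - i).-1)%:Z by lia.
  by rewrite -exprz_inv invrN1.
case: o h => // h; rewrite /orient_sgn; have [ij2|ij2] := leqP 2 (j - i)%N.
  by case/negP: nrev; apply/(prec_revP bd kN lN ijn); exists p.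
by have -> : (j - i).-1 = 0%N by lia.
Qed.

Lemma precE i a b l : prec Gamma1 tau (evec i - evec a : 'rV[K]_n) (evec b - evec l)
  = `[< exists p o, (0 < p)%N /\ im o p i a b l >].
Proof.
by apply/idP/asboolP => [/(precP bd (ltn_ord _) (ltn_ord _) (ltn_ord _) (ltn_ord _))|h] //; apply/(precP bd).
Qed.

Lemma al_lower p o f k i l : (0 < p)%N -> im o p i f k l -> al f k i l = orient_sgn K o (f - i).
Proof.
move=> p0 h; rewrite (tcoef_a K Gamma1 tau) !precE; have [if_ _ _ _] := im_lt arP h.
rewrite asboolT ?asboolF /= ?mul1r ?mul0r ?subr0; first exact: (sgn_im p0 _ _ _ _ h).
  by move=> [p' [o' [_ /(im_lt arP) [_ _ ? _]]]]; lia.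
by exists p, o.
Qed.

Lemma al_upper p o f k i l : (0 < p)%N -> im o p l k f i -> al f k i l = - orient_sgn K o (k - l).
Proof.
move=> p0 h; rewrite (tcoef_a K Gamma1 tau) !precE; have [_ _ fi _] := im_lt arP h.
rewrite asboolF ?asboolT /= ?mul1r ?mul0r ?sub0r; first by rewrite (sgn_im p0 _ _ _ _ h).
  by exists p, o.
by move=> [p' [o' [_ /(im_lt arP) [? _ _ _]]]]; lia.
Qed.

Lemma al_none f k i l : (forall p o, (0 < p)%N -> ~ im o p i f k l) ->
  (forall p o, (0 < p)%N -> ~ im o p l k f i) -> al f k i l = 0.
Proof.
move=> h1 h2; rewrite (tcoef_a K Gamma1 tau) !precE !asboolF ?mul0r ?subrr //.
  by move=> [p [o [p0 /(h2 _ _ p0)]]].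
by move=> [p [o [p0 /(h1 _ _ p0)]]].
Qed.

Definition Rsk f k i l : fps K := tcoef (R_s K n) f k i l.

(* A place that no hop reaches carries an entry of R_s, and the coefficients of a hop and
   of its mirror image differ only in sign. *)
Lemma B_form bk f k i l : B = mx2 n bk ->
  [/\ al f k i l = 0 & bk k f i l = qp (s f k) * Rsk f k i l * qp (s i l)] \/
  exists t x, [/\ al f k i l = x /\ al k f l i = - x, x * x = 1, Rsk f k i l = 0 /\ Rsk k f l i = 0,
    bk k f i l = qp (s f k) * (c * (fpsC x * qp t)) * qp (s i l) &
    bk f k l i = qp (s k f) * (c * (fpsC (- x) * qp (- t))) * qp (s l i)].
Proof.
move=> E; have ent := entries arP sP (@qpow0 K) (@qpowD K) nil N0 E.
have lower p o (f' k' i' l' : 'I_n) : (0 < p)%N -> im o p i' f' k' l' ->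
    [/\ Rsk f' k' i' l' = 0, Rsk k' f' l' i' = 0,
    bk k' f' i' l' = qp (s f' k') * (c * (fpsC (orient_sgn K o (f' - i')) * qp (eta n ar s p o f' k' i' l'))) * qp (s i' l') &
    bk f' k' l' i' = qp (s k' f') * (c * (fpsC (- orient_sgn K o (f' - i')) * qp (- eta n ar s p o f' k' i' l'))) * qp (s l' i')].
  move=> p0 h; have [if_ fn kl ln] := im_lt arP h; have [_ lE _] := h.
  have ne : ~~ ((f' == l') && (k' == i')).
    apply/negP => /andP[/eqP e1 /eqP e2]; subst l' k'.
    have := im_self arP h (@im0 n ar i' f' _); rewrite if_ fn => /(_ isT) e.
    by rewrite e in p0.
  have nf : (f' == i') = false by apply/negbTE; rewrite -val_eqE /=; lia.
  have nk : (k' == l') = false by apply/negbTE; rewrite -val_eqE /=; lia.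
  split.
  - by rewrite /Rsk tcoef_Rs nf /= (andbA (f' == l')) (negbTE ne) !mulr0 !addr0.
  - rewrite /Rsk tcoef_Rs nk /= (andbA (k' == i')) (andbC (k' == i')) (negbTE ne) !mulr0 !addr0 //.
  - by rewrite ent // (ltnW if_) (Rl_hop arP s nil h) (Hp_val arP s h).
  - rewrite ent // leqNgt kl /= (Rl_mirror_hop arP s nil h) (Hp_mirror_val arP sP N0 p0 h).
    have -> : ((f' : nat) == l') && ((k' : nat) == i') = false by apply/negbTE.
    by rewrite mulr0 add0r.
have [[p [o [p0 h]]]|n1] := pselect (exists p o, (0 < p)%N /\ im o p i f k l).
  right; have [r1 r2 e1 e2] := lower p o f k i l p0 h.
  exists (eta n ar s p o f k i l), (orient_sgn K o (f - i)); split=> //; last exact: sgl_sq.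
  by split; [exact: al_lower h|exact: al_upper h].
have [[p [o [p0 h]]]|n2] := pselect (exists p o, (0 < p)%N /\ im o p l k f i).
  right; have [r1 r2 e1 e2] := lower p o k f l i p0 h.
  exists (- eta n ar s p o k f l i), (- orient_sgn K o (k - l)); rewrite !opprK; split=> //.
    by split; [exact: al_upper h|exact: al_lower h].
  by rewrite mulrNN sgl_sq.
left; split.
  by apply: al_none => p o p0 h; [apply: n1|apply: n2]; exists p, o.
have qqc : q - qinv = c :> fps K by [].
rewrite ent // /Rsk tcoef_Rs -!val_eqE qqc /=.
have qc1 (u v : nat) : qp (s u v) * qp (s v u) = 1.
  by rewrite -qpowD (s_skew sP v u) subrr qpow0.
case: (ltngtP i f) => [if_|fi|e].
- rewrite !mulr0 add0r add0r.
  have [/andP[/eqP e1 /eqP e2]|ne] := boolP (((f : nat) == l) && ((k : nat) == i)).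
    have h : im false 0 i f k l by rewrite e2 -e1; apply: im0; rewrite if_ ltn_ord.
    rewrite (Rl_hop arP s nil h) (Hp0 arP sP (@qpow0 K) (@qpowD K)) // e2 e1 !eqxx /=.
    have il : (i < l)%N by rewrite -e1.
    by rewrite il /= !mul1r !mulr1 mulrAC qc1 mul1r.
  rewrite andbA (negbTE ne) /= !mulr0 mul0r Rl_none // => p o h.
  have [p0|p0] := posnP p; last by apply: n1; exists p, o.
  by rewrite p0 in h; have [e1 e2] := im0E arP h; rewrite -e1 -e2 !eqxx in ne.
- have -> : [&& (f : nat) == l, (k : nat) == i & (k < f)%N] = false.
    by apply/negP => /and3P[_ /eqP ki kf]; lia.
  rewrite !mulr0 !addr0 mulr0 mul0r.
  have [/andP[/eqP e1 /eqP e2]|ne] := boolP (((k : nat) == i) && ((f : nat) == l)).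
    have h : im false 0 l k f i by rewrite e1 -e2; apply: im0; rewrite fi ltn_ord.
    rewrite (Rl_mirror_hop arP s nil h).
    rewrite (Hp0 (arrows_cnv arP) (r0_cnv sP) (qm0 (@qpow0 K)) (qmD (@qpowD K))) // e1 e2 !eqxx qcm.
    by rewrite !mul1r mulr1 subrr.
  rewrite mulr0 add0r (Rl_mirror_none arP) // => p o h.
  have [p0|p0] := posnP p; last by apply: n2; exists p, o.
  by rewrite p0 in h; have [e1 e2] := im0E arP h; rewrite -e1 -e2 !eqxx in ne.
have -> : [&& (f : nat) == l, (k : nat) == i & (k < f)%N] = false.
  by apply/negP => /and3P[_ /eqP ki kf]; lia.
rewrite /entry_lower e ltnn mulr0 addr0 /kappa -e.
have [kl|kl] := eqVneq (k : nat) l; last first.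
  have [ik|_] := eqVneq (i : nat) k; last by rewrite /= !mulr0 !add0r mulr0 !mul0r.
  by rewrite ik (negbTE kl) /= !mulr0 addr0 mulr0 !mul0r.
rewrite -kl mul1r; have [<-|_] := eqVneq (i : nat) k => /=.
  by rewrite !(s_diag sP) mul0rn add0r qpow0 mul1r mulr1 addr0 mulr1.
by rewrite mulr0 add0r mulr1 addr0 mulr2n qpowD.
Qed.

(** Removing q ^ r0 on both sides does not affect the product in the Hecke relation: the braid form
    exchanges the legs in between, and s k f + s f k = 0. *)
Lemma rb_hecke bk a b i l : B = mx2 n bk ->
  \sum_(k < n) \sum_(f < n) (qp (- s b a) * bk a b k f * qp (- s k f)) * (qp (- s f k) * bk k f i l * qp (- s i l))
  = c * (qp (- s b a) * bk a b i l * qp (- s i l)) + ((a == i) && (b == l))%:R.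
Proof.
move=> E; have := B_hecke arP sP (@qpow0 K) (@qpowD K) N; rewrite E mulmxBr mul_mx_scalar mul_mx2.
move/matrixP => /(_ (mxtens_index (a, b)) (mxtens_index (i, l))); rewrite mx2_1 ![in LHS]mxE !mxtens_indexK /= mx2E => H.
have {}H : \sum_(k < n) \sum_(f < n) bk a b k f * bk k f i l = ((a == i) && (b == l))%:R + c * bk a b i l.
  by rewrite -[((a == i) && _)%:R]H subrK.
transitivity (qp (- s b a) * (\sum_(k < n) \sum_(f < n) bk a b k f * bk k f i l) * qp (- s i l)).
  rewrite mulr_sumr mulr_suml; apply: eq_bigr => k _; rewrite mulr_sumr mulr_suml; apply: eq_bigr => f _.
  have e : qp (- s k f) * qp (- s f k) = 1 by rewrite -qpowD (s_skew sP f k) opprK addrC subrr qpow0.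
  transitivity (qp (- s b a) * bk a b k f * (qp (- s k f) * qp (- s f k)) * bk k f i l * qp (- s i l)).
    by ring.
  by rewrite e mulr1; ring.
rewrite H mulrDr mulrDl addrC; congr (_ + _); first by ring.
have [/andP[/eqP <- /eqP <-]|_] := boolP (_ && _); last by rewrite mulr0 mul0r.
by rewrite mulr1 -qpowD (s_skew sP b a) opprK subrr qpow0.
Qed.

End Identification.

(** * The Hecke relation to second order in hbar *)

Section SecondOrder.
Context (K : numFieldType) (n : nat).
Context (Gamma1 Gamma2 : {set 'I_n.-1}) (tau : 'I_n.-1 -> 'I_n.-1).
Hypothesis (bd : BD_triple K Gamma1 Gamma2 tau).
Context (s : nat -> nat -> K) (sP : r0_form n (simple_arr Gamma1 tau) s).
Local Notation ar := (simple_arr Gamma1 tau).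
Local Notation arP := (simple_arrP bd).
Context (N : nat) (nil : forall k x y, (N <= k)%N -> ~ tau_step n ar k x y) (N0 : (0 < N)%N).
Local Notation qp := (@qpow K).
Local Notation c := (qdiff qp).
Local Notation B := (braid_mx n ar s qp N).
Local Notation al := (tcoef (GGS_a K Gamma1 tau)).
Local Notation ep := (tcoef (GGS_eps K Gamma1 tau)).
Local Notation rs := (tcoef (r_s K n)).
Local Notation Rsk := (Rsk K).
Implicit Types (a b i l f k : 'I_n).
Context (bk : nat -> nat -> nat -> nat -> fps K) (BE : B = mx2 n bk).

(** An entry of q ^ (- r0) R q ^ (- r0), the matrix to be identified with [Rbar_GGS]; the row (k, f)
    of the braid form is the row (f, k) of R. *)
Definition rb f k i l : fps K := locked (qp (- s f k) * bk k f i l * qp (- s i l)).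

Lemma rbE f k i l : rb f k i l = qp (- s f k) * bk k f i l * qp (- s i l).
Proof. by rewrite /rb -lock. Qed.

Lemma rb_eq a b i l : \sum_(k < n) \sum_(f < n) rb b a k f * rb f k i l
  = c * rb b a i l + ((a == i) && (b == l))%:R.
Proof.
rewrite rbE -(rb_hecke bd sP a b i l BE); apply: eq_bigr => k _; apply: eq_bigr => f _.
by rewrite !rbE.
Qed.

Definition rho f k i l : K := rs f k i l + al f k i l.

Lemma qc0 : fcoef (c : fps K) 0 = 0.
Proof. by rewrite /= !expr0 subrr. Qed.

Lemma qc1 : fcoef (c : fps K) 1 = 2.
Proof. by rewrite /= !expr1 ?fact0 ?invr1; ring. Qed.

Lemma qc2 : fcoef (c : fps K) 2 = 0.
Proof. by rewrite /= sqrrN subrr. Qed.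

Lemma qp_cancel (x y : K) (z : fps K) : qp (- x) * (qp x * z * qp y) * qp (- y) = z.
Proof.
have e u : qp u * qp (- u) = 1 by rewrite -qpowD subrr qpow0.
transitivity ((qp x * qp (- x)) * z * (qp y * qp (- y))); first by ring.
by rewrite !e mul1r mulr1.
Qed.

Lemma rb_form f k i l :
  [/\ al f k i l = 0 & rb f k i l = Rsk f k i l] \/
  exists t x, [/\ al f k i l = x /\ al k f l i = - x, x * x = 1, Rsk f k i l = 0 /\ Rsk k f l i = 0,
    rb f k i l = c * (fpsC x * qp t) & rb k f l i = c * (fpsC (- x) * qp (- t))].
Proof.
case: (B_form bd sP nil N0 f k i l BE) => [[h1 h2]|[t [x [h1 h2 h3 h4 h5]]]]; [left|right].
  by split=> //; rewrite rbE h2 qp_cancel.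
by exists t, x; split=> //; rewrite rbE (h4, h5) qp_cancel.
Qed.

Lemma Rsk0 f k i l : fcoef (Rsk f k i l) 0 = ((f == i) && (k == l))%:R.
Proof.
rewrite /Rsk tcoef_Rs /= !big_ord1 !fcoef_bool /= !expr0 subrr mul0r addr0 ?fact0 ?invr1 !mul1r -natrD.
case: (f == i) => //=; have [<-|_] := eqVneq f k; first by rewrite andbF addn0.
by rewrite andbT.
Qed.

Lemma Rsk1 f k i l : fcoef (Rsk f k i l) 1 = 2 * rs f k i l.
Proof.
rewrite /Rsk tcoef_Rs tcoef_rs -/(qdiff qp) -[fcoef _ 1]/(fcoef (q * _) 1 + fcoef (_%:R) 1 + fcoef (c * _) 1).
rewrite !fcoefM1 !fcoef_bool qc0 qc1 /= expr0 expr1 ?fact0 ?invr1.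
by field.
Qed.

Lemma fcoef_hop x t : [/\ fcoef (c * (fpsC x * qp t)) 0 = 0, fcoef (c * (fpsC x * qp t)) 1 = 2 * x
  & fcoef (c * (fpsC x * qp t)) 2 = 2 * (x * t)].
Proof.
rewrite fcoefM0 fcoefM1 fcoefM2 !fcoefCM qc0 qc1 qc2 /= expr0 expr1 ?fact0 ?invr1.
by split; ring.
Qed.

Lemma rb0 f k i l : fcoef (rb f k i l) 0 = ((f == i) && (k == l))%:R.
Proof.
case: (rb_form f k i l) => [[_ ->]|[t [x [_ _ [r0 _] -> _]]]]; first exact: Rsk0.
by have [-> _ _] := fcoef_hop x t; rewrite -Rsk0 r0.
Qed.

Lemma rb1 f k i l : fcoef (rb f k i l) 1 = 2 * rho f k i l.
Proof.
rewrite /rho mulrDr -Rsk1; case: (rb_form f k i l) => [[-> ->]|[t [x [[-> _] _ [r0 _] -> _]]]].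
  by rewrite mulr0 addr0.
by have [_ -> _] := fcoef_hop x t; rewrite r0 add0r.
Qed.

(** The coefficient of hbar in [rb_eq]. It expresses the classical relation r + r21 = P and serves
    to eliminate r21 at the next order. *)
Lemma hecke1 a b i l : rho a b i l + rho b a l i = ((b == i) && (a == l))%:R.
Proof.
have := congr1 (fun z => fcoef z 1) (rb_eq a b i l).
rewrite -[fcoef (c * _ + _) 1]/(fcoef (c * _) 1 + fcoef _ 1).
rewrite [fcoef _%:R 1]fcoef_bool addr0 fcoefM1 qc0 qc1 mul0r add0r rb0 fcoef_sum.
have E k : fcoef (\sum_(f < n) rb b a k f * rb f k i l) 1
    = (b == k)%:R * fcoef (rb a k i l) 1 + (k == l)%:R * fcoef (rb b a k i) 1.
  rewrite fcoef_sum; under eq_bigr do rewrite fcoefM1 !rb0; rewrite big_split /=.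
  congr (_ + _).
    rewrite (sum_only (a := a)) => [|x /negPf ne]; first by rewrite eqxx andbT.
    by rewrite (eq_sym a) ne andbF mul0r.
  rewrite (sum_only (a := i)) => [|x /negPf ne]; first by rewrite eqxx /= mulrC.
  by rewrite ne mulr0.
under eq_bigr do rewrite E; rewrite big_split /=.
rewrite (sum_only (a := b)) => [|x /negPf ne]; last by rewrite eq_sym ne mul0r.
rewrite (sum_only (a := l)) => [|x /negPf ne]; last by rewrite ne mul0r.
rewrite !eqxx !mul1r !rb1 -mulrDr => H.
by apply: (mulfI (_ : 2 != 0 :> K)); rewrite ?pnatr_eq0.
Qed.

(** The coefficient of hbar ^ 2 in [rb_eq] contains products of rho with its flipped version. By
    [hecke1] the latter is the flip minus rho, and the contribution of the flip cancels against the
    right side. *)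
Lemma hecke2 a b i l : fcoef (rb a b i l) 2 + fcoef (rb b a l i) 2
  = 4 * \sum_(f < n) \sum_(k < n) rho a b f k * rho f k i l.
Proof.
have := congr1 (fun z => fcoef z 2) (rb_eq a b i l).
rewrite -[fcoef (c * _ + _) 2]/(fcoef (c * _) 2 + fcoef _ 2).
rewrite [fcoef _%:R 2]fcoef_bool addr0 fcoefM2 qc0 qc1 qc2 !mul0r add0r addr0 rb1 fcoef_sum.
have E k : fcoef (\sum_(f < n) rb b a k f * rb f k i l) 2
    = (b == k)%:R * fcoef (rb a k i l) 2 + (k == l)%:R * fcoef (rb b a k i) 2
      + 4 * ((a == k)%:R * rho b k i l - \sum_(f < n) rho a b f k * rho f k i l).
  rewrite fcoef_sum; under eq_bigr do rewrite fcoefM2 !rb0 !rb1; rewrite !big_split /=.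
  rewrite addrAC; congr (_ + _ + _).
  - rewrite (sum_only (a := a)) => [|x /negPf ne]; first by rewrite eqxx andbT.
    by rewrite (eq_sym a) ne andbF mul0r.
  - rewrite (sum_only (a := i)) => [|x /negPf ne]; first by rewrite eqxx /= mulrC.
    by rewrite ne mulr0.
  have -> : (a == k)%:R * rho b k i l = \sum_(f < n) ((b == f) && (a == k))%:R * rho f k i l.
    rewrite (sum_only (a := b)) => [|x /negPf ne]; first by rewrite eqxx.
    by rewrite eq_sym ne mul0r.
  rewrite -sumrB mulr_sumr; apply: eq_bigr => f _; rewrite -(hecke1 a b f k); ring.
under eq_bigr do rewrite E; rewrite !big_split /= -mulr_sumr sumrB.
rewrite (sum_only (a := b)) => [|x /negPf ne]; last by rewrite eq_sym ne mul0r.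
rewrite (sum_only (a := l)) => [|x /negPf ne]; last by rewrite ne mul0r.
rewrite (sum_only (a := a)) => [|x /negPf ne]; last by rewrite eq_sym ne mul0r.
rewrite !eqxx !mul1r exchange_big /= => H.
apply/eqP; rewrite -subr_eq0; apply/eqP.
set S := \sum_(_ < n) _ in H *; set u := fcoef _ _ in H *; set v := fcoef (rb b a l i) 2 in H *.
transitivity (u + v + 4 * (rho b a i l - S) - 2 * (2 * rho b a i l)); first by ring.
by rewrite H subrr.
Qed.

(** Epsilon is (r_s + a) ^ 2 - r_s ^ 2, and r_s ^ 2 has no entry that changes the first index. *)
Lemma eps_hop f k i l : f != i -> 4 * ep f k i l
  = 4 * \sum_(x < n) \sum_(y < n) rho f k x y * rho x y i l.
Proof.
move=> fi; congr (_ * _).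
have rr : tcoef (r_s K n *m r_s K n) f k i l = 0.
  rewrite /tcoef mxE sum_tens big1 // => x _; rewrite big1 // => y _.
  rewrite -[X in X * _]/(rs f k x y) -[X in _ * X]/(rs x y i l) !tcoef_rs -!val_eqE.
  have [/and3P[/eqP e1 /eqP e2 /eqP e3]|_] := boolP [&& (f : nat) == x, (f : nat) == k & (f : nat) == y].
    have -> : ((x : nat) == i) = false by rewrite -e1; apply: negbTE fi.
    have -> : (y < x)%N = false by rewrite -e1 -e3 ltnn.
    by rewrite !andbF !mulr0 addr0 mulr0.
  rewrite mulr0 add0r; have [/and3P[/eqP e1 /eqP e2 kf]|_] := boolP (_ && _); last by rewrite mul0r.
  have -> : ((x : nat) == y) = false by rewrite -e1 -e2 ltn_eqF.
  have -> : (y < x)%N = false by rewrite -e1 -e2 ltnNge (ltnW kf).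
  by rewrite !andbF !mulr0 addr0 mulr0.
have sq (U V : 'M[K]_(n * n)) : tcoef ((U + V) *m (U + V)) f k i l
    = tcoef (U *m U) f k i l + tcoef (V *m U + U *m V + V *m V) f k i l.
  by rewrite mulmxDl !mulmxDr -tcoefD; congr (tcoef _ _ _ _ _); rewrite !addrA; congr (_ + _); rewrite -!addrA; congr (_ + _); rewrite addrC.
have -> : ep f k i l = tcoef ((r_s K n + GGS_a K Gamma1 tau) *m (r_s K n + GGS_a K Gamma1 tau)) f k i l.
  by rewrite sq rr add0r.
rewrite /tcoef mxE sum_tens; apply: eq_bigr => x _; apply: eq_bigr => y _.
by rewrite /rho -!tcoefD.
Qed.

Lemma R_GGS_entry f k i l :
  qp (s f k) * tcoef (Rbar_GGS K Gamma1 tau) f k i l * qp (s i l) = bk k f i l.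
Proof.
have -> : tcoef (Rbar_GGS K Gamma1 tau) f k i l = rb f k i l.
  rewrite tcoef_Rbar; case: (rb_form f k i l) => [[-> ->]|[t [x [[xE xE'] xx [r0 r0'] E E']]]].
    by rewrite fpsC0 mul0r mulr0 addr0.
  rewrite E -/(Rsk f k i l) r0 add0r xE; congr (_ * (_ * qp _)).
  have fi : f != i.
    apply: contraTneq (oner_neq0 K) => e; rewrite -xx -xE (al_none bd) ?mul0r ?eqxx //.
      by move=> p o _ /(im_lt arP) []; rewrite e ltnn.
    by move=> p o _ /(im_lt arP) [_ _]; rewrite e ltnn.
  (* The hop and its mirror image contribute the same coefficient 2 x t, so the entry of epsilon is
     x t; as x ^ 2 = 1, the exponent x epsilon prescribed by [GGS_atilde] is t. *)
  have := hecke2 f k i l; rewrite -eps_hop // E E'.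
  have [_ _ ->] := fcoef_hop x t; have [_ _ ->] := fcoef_hop (- x) (- t); rewrite mulrNN => H.
  have {}H : ep f k i l = x * t.
    by apply: (mulfI (_ : 4 != 0 :> K)); rewrite ?pnatr_eq0 // -H; ring.
  by rewrite H mulrA xx mul1r.
rewrite rbE; transitivity (qp (- - s f k) * (qp (- s f k) * bk k f i l * qp (- s i l)) * qp (- - s i l)).
  by rewrite !opprK.
exact: qp_cancel.
Qed.

End SecondOrder.

Section Main.
Context (K : numFieldType) (n : nat).
Context (Gamma1 Gamma2 : {set 'I_n.-1}) (tau : 'I_n.-1 -> 'I_n.-1).
Hypothesis (bd : BD_triple K Gamma1 Gamma2 tau).

Lemma R_GGS_twist (r0 : 'M[K]_(n * n)) : in_hwedgeh r0 -> r0_equation Gamma1 tau r0 ->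
  exists (s : nat -> nat -> K) N, [/\ r0_form n (simple_arr Gamma1 tau) s,
    (forall k x y, (N <= k)%N -> ~ tau_step n (simple_arr Gamma1 tau) k x y) &
    R_GGS Gamma1 tau r0 = flip_mx _ n *m braid_mx n (simple_arr Gamma1 tau) s (@qpow K) N].
Proof.
move=> /hwedgeh_diag [s [sk ->]] /(r0_form_of sk) sP.
(* The bound is taken as m + 1 because the formulas for the entries sum over powers from 0 to N - 1
   and need N > 0. *)
have [m nilm] := arr_nil (simple_arrP bd); exists s, m.+1.
have nil k x y : (m.+1 <= k)%N -> ~ tau_step n (simple_arr Gamma1 tau) k x y.
  by move=> mk; rewrite -(subnKC (ltnW mk)) => /(stepD (simple_arrP bd)) [z /nilm].
split; [exact: sP|exact: nil|].
have [bk BE] := mx2_surj (braid_mx n (simple_arr Gamma1 tau) s (@qpow K) m.+1).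
have [rf rE] := mx2_surj (Rbar_GGS K Gamma1 tau).
rewrite /R_GGS qpow_mx_dg rE dg_mul mul_dg BE pm_mul.
apply: tcoef_inj => f k i l; rewrite !tcoef_mx2 -(R_GGS_entry bd sP nil (ltn0Sn m) BE f k i l).
by rewrite rE tcoef_mx2.
Qed.

Lemma R_GGS_qybe_hecke (r0 : 'M[K]_(n * n)) (RG := R_GGS Gamma1 tau r0) : in_hwedgeh r0 -> r0_equation Gamma1 tau r0 ->
  leg12 RG *m leg13 RG *m leg23 RG = leg23 RG *m leg13 RG *m leg12 RG
  /\ (flipP *m RG - q%:M) *m (flipP *m RG + qinv%:M) = 0.
Proof.
move=> h1 h2; rewrite /RG; have [s [N [sP nil ->]]] := R_GGS_twist h1 h2.
set b := braid_mx _ _ _ _ _; have pb : flip_mx _ n *m (flip_mx _ n *m b) = b by rewrite mulmxA pm_inv mul1mx.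
split.
  by apply: qybe_of_braid; rewrite pb; apply: (B_braid (simple_arrP bd) sP (@qpow0 K) (@qpowD K) nil).
rewrite flipP_pm pb; have H := B_hecke (simple_arrP bd) sP (@qpow0 K) (@qpowD K) N.
have -> : (b - q%:M) *m (b + qinv%:M) = b *m (b - (qdiff (@qpow K))%:M) - 1%:M.
  rewrite mulmxDr !mulmxBl mulmxBr !mul_mx_scalar !mul_scalar_mx scale_scalar_mx (mulrC qinv) mulq_qinv.
  rewrite /qdiff scalerBl opprB -!addrA; congr (_ + _).
  by rewrite addrCA.
by rewrite H subrr.
Qed.

End Main.

Lemma eqmod_hbar_refl (K : comNzRingType) (k m p : nat) (A B : 'M[fps K]_(m, p)) :
  A = B -> eqmod_hbar k A B.
Proof. by move=> ->; exists 0; rewrite subrr scaler0. Qed.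

Theorem theorem1p1 (R : realType) :
  (forall n : nat, (2 <= n)%N -> (n <= 12)%N ->
   forall (Gamma1 Gamma2 : {set 'I_n.-1}) (tau : 'I_n.-1 -> 'I_n.-1),
     BD_triple R[i] Gamma1 Gamma2 tau ->
   forall r0 : 'M[R[i]]_(n * n),
     in_hwedgeh r0 -> r0_equation Gamma1 tau r0 ->
   let RG := R_GGS Gamma1 tau r0 in
   leg12 RG *m leg13 RG *m leg23 RG = leg23 RG *m leg13 RG *m leg12 RG
   /\ (flipP *m RG - q%:M) *m (flipP *m RG + qinv%:M) = 0)
  /\
  (forall n : nat, (2 <= n)%N ->
   forall (Gamma1 Gamma2 : {set 'I_n.-1}) (tau : 'I_n.-1 -> 'I_n.-1),
     BD_triple R[i] Gamma1 Gamma2 tau ->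
   forall r0 : 'M[R[i]]_(n * n),
     in_hwedgeh r0 -> r0_equation Gamma1 tau r0 ->
   let RG := R_GGS Gamma1 tau r0 in
   eqmod_hbar 3 (leg12 RG *m leg13 RG *m leg23 RG)
                (leg23 RG *m leg13 RG *m leg12 RG)
   /\ eqmod_hbar 3 ((flipP *m RG - q%:M) *m (flipP *m RG + qinv%:M)) 0).
Proof.
split=> [n _ _|n _] Gamma1 Gamma2 tau bd r0 h1 h2 RG.
  exact: (R_GGS_qybe_hecke bd h1 h2).
have [qybe hecke] := R_GGS_qybe_hecke bd h1 h2.
by split; apply: eqmod_hbar_refl.
Qed.
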